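(* Fix $\ell\in\mathbb{N}$ and a constant $\kappa>0$ independent of $N$. For each $N$ consider $\ell$ random vectors $X^{(1)},\dots,X^{(\ell)}$ in $\mathbb{R}^M$, $M=M_N\ge1$, defined on the same probability space, with an arbitrary correlation structure with respect to each other, and matrices $H_N^{(i)}=\Phi^{(i)}(X^{(i)})$ with $\Phi^{(i)}=\Phi^{(i)}_N:\mathbb{R}^M\to\mathscr{S}_N$ deterministic. Assume that for each $i\in\{1,\dots,\ell\}$: (I) The entries of $X^{(i)}$ are independent and real-valued. (M) $\Phi^{(i)}$ is Lipschitz (with respect to the norm $\|\cdot\|_{\widetilde F}$ on $\mathscr{S}_N$), and $(\Phi^{(i)})^{-1}(A)$ is convex for any convex set $A$. (E) There is a sequence of probability measures $(\mu_N^{(i)})_N$ on $\mathbb{R}$ such that $d_{\mathrm{BL}}(\mathbb{E}\hat\mu_{H_N^{(i)}},\mu_N^{(i)})\le N^{-\kappa}$; these measures are supported in a common compact set; and each has a density $\mu^{(i)}_N(\cdot)$ in $(-\kappa,\kappa)$ satisfying $\mu_N^{(i)}(x)<\kappa^{-1}|x|^{-1+\kappa}$ for all $|x|<\kappa$ and all $N$. (C$^\ell$) Writing $(\lambda_j)_{j=1}^N$ for the eigenvalues of $H_N^{(i)}$, for every $\epsilon>0$, $$\lim_{N\to\infty}\mathbb{P}\big(H_N^{(i)}\text{ has no eigenvalues in }[-e^{-N^\epsilon},e^{-N^\epsilon}]\big)=1,\qquad \lim_{N\to\infty}\frac1N\log\mathbb{E}\Big[\prod_{j=1}^N(1+|\lambda_j|\mathbf{1}_{|\lambda_j|>e^{N^\epsilon}})^\ell\Big]=0,$$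 and for all sufficiently small $\delta>0$, $$\limsup_{N\to\infty}\frac1{N\log N}\log\mathbb{E}\big[|\det(H_N^{(i)})|^{\ell(1+\delta)}\big]<\infty.$$ (S) With $(X^{(i)}_{\mathrm{cut}})_k=X^{(i)}_k\mathbf{1}_{|X^{(i)}_k|<N^{-\kappa}/\|\Phi^{(i)}\|_{\mathrm{Lip}}}$, $$\lim_{N\to\infty}\frac1{N\log N}\log\mathbb{P}\big(d_{\mathrm{KS}}(\hat\mu_{\Phi^{(i)}(X^{(i)})},\hat\mu_{\Phi^{(i)}(X^{(i)}_{\mathrm{cut}})})>N^{-\kappa}\big)=-\infty.$$ Then $$\lim_{N\to\infty}\left(\frac1N\log\mathbb{E}\Big[\prod_{i=1}^\ell|\det(H_N^{(i)})|\Big]-\sum_{i=1}^\ell\int_{\mathbb{R}}\log|\lambda|\,\mu_N^{(i)}(d\lambda)\right)=0.$$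
   Context: $\mathscr{S}_N$ is the space of $N\times N$ real symmetric matrices with norm $\|T\|_{\widetilde F}^2=\sum_{1\le i\le j\le N}T_{ij}^2$. $\|\cdot\|_{\mathrm{Lip}}$ is the Lipschitz constant (Euclidean norms; $\|\cdot\|_{\widetilde F}$ on $\mathscr{S}_N$). $\hat\mu_T=\frac1N\sum_{j=1}^N\delta_{\lambda_j(T)}$ is the empirical spectral measure. $d_{\mathrm{BL}}(\mu,\nu)=\sup\{|\int f\,d(\mu-\nu)|:\|f\|_{\mathrm{Lip}}+\|f\|_{L^\infty}\le1\}$ and $d_{\mathrm{KS}}(\mu,\nu)=\sup_x|\mu((-\infty,x])-\nu((-\infty,x])|$. *)

(* Defs.v *)
From HB Require Import structures.
From mathcomp Require Import all_boot all_order all_algebra.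
From mathcomp Require Import sesquilinear spectral complex.
From mathcomp Require Import all_classical all_reals all_analysis.

Set Implicit Arguments.
Unset Strict Implicit.
Unset Printing Implicit Defensive.

Import Order.TTheory GRing.Theory Num.Theory.
Import numFieldNormedType.Exports.

Local Open Scope classical_set_scope.
Local Open Scope ring_scope.

(* The library norm on matrices is the sup norm, hence the next two norms. *)
Definition norm2 (R : realType) (m : nat) (x : 'rV[R]_m) : R :=
  Num.sqrt (\sum_(k < m) x ord0 k ^+ 2).

Definition normFt (R : realType) (n : nat) (T : 'M[R]_n) : R :=
  Num.sqrt (\sum_(i < n) \sum_(j < n | (i <= j)%N) T i j ^+ 2).

(* The value is +oo when [f] is not Lipschitz. *)
Definition lip_const (R : realType) (U V : zmodType) (nU : U -> R) (nV : V -> R)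
    (f : U -> V) : \bar R :=
  ereal_sup [set (nV (f p.1 - f p.2) / nU (p.1 - p.2))%:E
            | p in [set p : U * U | p.1 != p.2]].

Definition lip_norm2 (R : realType) (m n : nat)
    (F : 'rV[R]_m -> 'M[R]_n) : \bar R :=
  lip_const (@norm2 R m) (@normFt R n) F.

(* All eigenvalues with multiplicity, in nondecreasing order; [eigenvaluesP]
   below shows that the default value is never used on symmetric matrices. *)
Definition eigenvalues (R : realType) (n : nat) (T : 'M[R]_n) : n.-tuple R :=
  xget [tuple of nseq n 0]
    [set s : n.-tuple R | sorted <=%R s /\
       char_poly T = \prod_(x <- s) ('X - x%:P)].

Definition empirical_measure (R : realType) (n : nat) (T : 'M[R]_n)
    (A : set R) : \bar R :=
  ((n%:R^-1)%:E * \sum_(j < n) \d_(tnth (eigenvalues T) j) A)%E.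

(* E[nu] as the set function A |-> E[nu(A)]; the library integral accepts set
   functions that are not packaged as measures. *)
Definition mean_measure (R : realType) d (T : measurableType d)
    (P : probability T R) (nu : T -> set R -> \bar R) (A : set R) : \bar R :=
  (\int[P]_w nu w A)%E.

(* The essential supremum is a plain supremum: the test functions are
   Lipschitz, hence continuous. *)
Definition dBL (R : realType) (mu nu : set R -> \bar R) : \bar R :=
  ereal_sup [set `|\int[mu]_x (f x)%:E - \int[nu]_x (f x)%:E|%E
            | f in [set f : R -> R |
                (lip_const Num.norm Num.norm f
                 + ereal_sup [set `|f x|%:E | x in setT] <= 1)%E]].

Definition dKS (R : realType) (mu nu : set R -> \bar R) : \bar R :=
  ereal_sup [set `|mu `]-oo, x]%classic - nu `]-oo, x]%classic|%E | x in [set: R]].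

Definition independent_RVs (R : realType) d (T : measurableType d)
    (P : probability T R) (m : nat) (X : 'I_m -> T -> R) : Prop :=
  forall (J : {set 'I_m}) (B : 'I_m -> set R), (forall k, measurable (B k)) ->
    (P (\bigcap_(k in [set` J]) (X k @^-1` B k))
     = \prod_(k in J) P (X k @^-1` B k))%E.

Definition has_density_on (R : realType) (D : set R) (mu : set R -> \bar R)
    (f : R -> R) : Prop :=
  [/\ measurable_fun D f, (forall x, D x -> 0 <= f x) &
    forall A : set R, measurable A -> A `<=` D ->
      mu A = (\int[lebesgue_measure]_(x in A) (f x)%:E)%E].

(* The threshold is extended real-valued: N^-kappa / ||Phi||_Lip is +oo when
   Phi is constant, and then nothing is cut. *)
Definition cut_vector (R : realType) (m : nat) (t : \bar R) (x : 'rV[R]_m) :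
    'rV[R]_m :=
  \row_k (if (`|x ord0 k|%:E < t)%E then x ord0 k else 0).

Lemma char_poly_similar (F : fieldType) (n : nat) (P D : 'M[F]_n) : P \in unitmx ->
  char_poly (invmx P *m D *m P) = char_poly D.
Proof.
move=> Pu; rewrite /char_poly /char_poly_mx !map_mxM /=.
set Q := map_mx _ (invmx P); set P' := map_mx _ P.
have QP : Q *m P' = 1%:M by rewrite -map_mxM mulVmx// map_mx1.
have XE : 'X%:M = Q *m 'X%:M *m P' by rewrite scalar_mxC -mulmxA QP mulmx1.
rewrite [in LHS]XE.
rewrite -mulmxBl -mulmxBr !det_mulmx mulrC mulrA -det_mulmx.
by rewrite (mulmx1C QP) det1 mul1r.
Qed.

Lemma eigenvaluesP (R : realType) (n : nat) (T : 'M[R]_n) : T^T = T ->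
  sorted <=%R (eigenvalues T) /\
  char_poly T = \prod_(x <- eigenvalues T) ('X - x%:P).
Proof.
move=> Tsym; rewrite /eigenvalues.
apply: (@xgetPex _ _ [set s : n.-tuple R | sorted <=%R s /\
  char_poly T = \prod_(x <- s) ('X - x%:P)]).
pose A : 'M[R[i]]_n := map_mx (real_complex R) T.
have Aherm : A \is hermsymmx.
  apply: realsym_hermsym.
    apply/is_hermitianmxP; rewrite expr0 scale1r.
    by apply/matrixP => i j; rewrite !mxE -[in LHS]Tsym mxE.
  by apply/mxOverP => i j; rewrite mxE; apply/complex_realP; exists (T i j).
have /mxOverP Dreal := hermitian_spectral_diag_real Aherm.
have /orthomx_spectralP := hermitian_normalmx Aherm.
set P := spectralmx A; set D := spectral_diag A => AE.
pose s : n.-tuple R := [tuple complex.Re (D ord0 i) | i < n].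
have Ts : char_poly T = \prod_(x <- s) ('X - x%:P).
  apply: (map_poly_inj (real_complex R)).
  rewrite map_char_poly -/A AE char_poly_similar ?spectral_unit//.
  rewrite char_poly_trig ?diag_mx_is_trig// rmorph_prod big_image/=.
  apply: eq_bigr => i _.
  by rewrite rmorphB/= map_polyX map_polyC/= RRe_real ?Dreal// !mxE eqxx.
exists [tuple of sort <=%R s]; split; first exact/sort_sorted/le_total.
by rewrite Ts; apply/esym/perm_big; rewrite perm_sort.
Qed.

(* Main.v *)
(** Let [f x] be the logarithm of [|x|] clamped between [N^(-kappa/2)] and
[e^(N^eps)]. It is a difference of two
convex Lipschitz functions, and the trace of a convex Lipschitz function is a
convex Lipschitz function of the matrix; by (M) its composition with [Phi] has
convex sublevel sets. Talagrand's inequality for convex sets, applied to the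
truncated vector of (S), therefore concentrates [tr f(H) / N] with error
probability [e^(-A N log N)] for every [A], and (E) identifies its centre with
[\int f dmu], hence with [\int log|x| dmu].

Upper bound: [|det H| <= e^(tr f(H)) * \prod_j (1 + |lam_j| 1_(|lam_j| > e^(N^eps)))],
where the expectation of the product is controlled by (C); on the exceptional
event, of probability [e^(-A N log N)], Young's inequality trades the moment
bound in (C) for a large power of that probability.
Lower bound: with probability at least 1/2 no eigenvalue is smaller than
[e^(-N^eps)] and only [o(N^(1 - eps))] of them are smaller than [N^(-kappa/2)],
so that [|det H| >= e^(tr f(H) - o(N))]. *)

(* Hypothesis (M) provides convex sublevel sets and nothing more: the statistic is only quasiconvex
   in the vector. Concentration therefore comes from the geometric form of Talagrand's inequality,
   which bounds the product of the probabilities of {F <= a} and {F >= a'}. The centre obtained this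
   way is unknown; boundedness of the clamped logarithm ties it to the expectation, and only the
   expectation is compared with (E). Since the moment condition allows determinants of size e^(C N
   log N), exponentially small error probabilities would not suffice. The lower level N^(-kappa/2)
   balances this: truncation size times Lipschitz constants is N^(-kappa) N^(kappa/2) sqrt N, so
   fluctuations of order o(N) have probability e^(-N^(1 + kappa/2)), while the height N^eps of the
   clamp is absorbed by the factor N^(-kappa) of (E) and (S). As (S) controls a Kolmogorov distance,
   linear statistics are compared through monotone pieces. Arbitrary correlation between the
   matrices is handled by bounding products by sums of l-th powers, and bad events by unions. *)
Require Import Defs.
From HB Require Import structures.
From mathcomp Require Import all_boot all_order all_algebra.
From mathcomp Require Import spectral complex.
From mathcomp Require Import all_classical all_reals all_analysis.
From mathcomp Require Import measurable_realfun.
From mathcomp Require Import ring lra.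
Import Order.TTheory GRing.Theory Num.Theory.
Import numFieldNormedType.Exports.
Local Open Scope classical_set_scope.
Local Open Scope ring_scope.
Set Implicit Arguments.
Unset Strict Implicit.
Unset Printing Implicit Defensive.

(** * Talagrand's inequality for convex sets *)

Section Talagrand.
Variable R : realType.

Lemma ln_le_subr1 (x : R) : 0 < x -> ln x <= x - 1.
Proof.
move=> x0; have := @le_ln1Dx R (x - 1); rewrite addrCA subrr addr0.
by apply; rewrite ltrBDr addrC subrr.
Qed.

Lemma expR_convex (t u v : R) : 0 <= t <= 1 ->
  expR ((1 - t) * u + t * v) <= (1 - t) * expR u + t * expR v.
Proof.
move=> /andP[t0 t1].
have := @convex_expR R (@Itv01 R t t0 t1) v u.
by rewrite !convRE/= /unstable.onem addrC [leRHS]addrC.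
Qed.

(** The scalar inequality that closes the induction in [talagrand]: [r] is the probability of a
    section relative to the most probable one, [t] the weight given to the latter. *)
Lemma talagrand_param (r : R) : 0 < r <= 1 ->
  exists2 t, 0 <= t <= 1 & expR (t ^+ 2 / 9 - (1 - t) * ln r) <= 2 - r.
Proof.
move=> /andP[r0 r1]; have [rh|rh] := leP r (1/2).
  exists 1; first by rewrite ler01 lexx.
  rewrite subrr mul0r subr0 expr1n.
  apply: (@le_trans _ _ (3/2)); last by lra.
  rewrite -[leRHS]lnK ?posrE; last by lra.
  rewrite ler_expR.
  have : ln (3/2 : R)^-1 <= (3/2)^-1 - 1 by apply: ln_le_subr1; rewrite invr_gt0; lra.
  rewrite lnV ?posrE; last by lra.
  by rewrite invf_div; lra.
pose x := 1 - r.
have x0 : 0 <= x by rewrite subr_ge0.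
have xh : x < 1/2 by rewrite /x; lra.
(* Chosen so that [1 - t = (1 - x) * (1 - 2 * x)] contains the factor [r = 1 - x], which cancels the
   denominator of the bound [- ln r <= x / r]. Since [t <= 3 * x], the exponent is at most
   [x - x ^+ 2], below [x / (1 + x)]. *)
exists (3 * x - 2 * x ^+ 2).
  apply/andP; split; nra.
have -> : 2 - r = 1 + x by rewrite /x; lra.
have lr : - ln r <= x / r.
  have := @ln_le_subr1 r^-1; rewrite invr_gt0 => /(_ r0).
  rewrite lnV ?posrE// => /le_trans; apply.
  by rewrite /x mulrBl divff ?gt_eqF// mul1r.
have l1x : x / (1 + x) <= ln (1 + x).
  have := @ln_le_subr1 (1 + x)^-1; rewrite invr_gt0 => /(_ ltac:(lra)).
  rewrite lnV ?posrE; last by lra.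
  have -> : (1 + x)^-1 - 1 = - (x / (1 + x)) by field; lra.
  by rewrite lerN2.
rewrite -[leRHS]lnK ?posrE; last by lra.
rewrite ler_expR; apply: le_trans l1x.
have rE : 1 - (3 * x - 2 * x ^+ 2) = r * (1 - 2 * x) by rewrite /x; ring.
rewrite rE.
have h1 : - (r * (1 - 2 * x) * ln r) <= x * (1 - 2 * x).
  have -> : - (r * (1 - 2 * x) * ln r) = (r * (1 - 2 * x)) * (- ln r) by ring.
  apply: (@le_trans _ _ (r * (1 - 2 * x) * (x / r))).
    by apply: ler_wpM2l => //; apply: mulr_ge0; lra.
  by rewrite le_eqVlt; apply/orP; left; apply/eqP; field; lra.
apply: (@le_trans _ _ (x - x ^+ 2)).
  have h2 : (3 * x - 2 * x ^+ 2) ^+ 2 / 9 <= x ^+ 2.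
    rewrite ler_pdivrMr//.
    have : (3 * x - 2 * x ^+ 2) ^+ 2 <= (3 * x) ^+ 2.
      rewrite ler_sqr ?nnegrE; nra.
    by rewrite exprMn; lra.
  lra.
rewrite ler_pdivlMr; last by lra.
nra.
Qed.

(** Hölder's inequality with exponents 1/(1-t) and 1/t: after division by a^(1-t) b^t it is the
    convexity of the exponential, applied termwise. *)
Lemma expR_hoelder (S : finType) (w u v : S -> R) (a b t : R) :
  (forall s, 0 <= w s) -> 0 <= t <= 1 -> 0 < a -> 0 < b ->
  \sum_s w s * expR (u s) <= a -> \sum_s w s * expR (v s) <= b ->
  \sum_s w s * expR ((1 - t) * u s + t * v s) <= expR ((1 - t) * ln a + t * ln b).
Proof.
move=> w0 t01 a0 b0 ua vb; have /andP[t0 t1] := t01.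
set g := (1 - t) * ln a + t * ln b.
rewrite -[leRHS]mul1r -ler_pdivrMr ?expR_gt0// -expRN mulr_suml.
apply: (@le_trans _ _ (\sum_s ((1 - t) * (w s * expR (u s) / a) +
    t * (w s * expR (v s) / b)))).
  apply: ler_sum => s _; rewrite -[leLHS]mulrA -expRD.
  have -> : (1 - t) * u s + t * v s - g = (1 - t) * (u s - ln a) + t * (v s - ln b).
    by rewrite /g; ring.
  apply: (@le_trans _ _ (w s * ((1 - t) * expR (u s - ln a) + t * expR (v s - ln b)))).
    by apply: ler_wpM2l => //; exact: expR_convex.
  rewrite !expRD !expRN !lnK ?posrE// le_eqVlt; apply/orP; left; apply/eqP; ring.
rewrite big_split/= -!mulr_sumr -!mulr_suml.
have : (\sum_s w s * expR (u s)) / a <= 1 by rewrite ler_pdivrMr// mul1r.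
have : (\sum_s w s * expR (v s)) / b <= 1 by rewrite ler_pdivrMr// mul1r.
set p := _ / b; set q := _ / a => p1 q1.
nra.
Qed.

Definition sqdist (m : nat) (x y : 'I_m -> R) : R := \sum_k (x k - y k) ^+ 2.

(** The infimum of the empty set is 0, so an empty set is at distance 0 instead of infinity; empty
    sets are treated apart wherever near-minimisers are used. *)
Definition sqdist_set (m : nat) (A : set ('I_m -> R)) (x : 'I_m -> R) : R :=
  inf [set sqdist x y | y in A].

Lemma sqdist_ge0 m (x y : 'I_m -> R) : 0 <= sqdist x y.
Proof. by apply: sumr_ge0 => k _; exact: sqr_ge0. Qed.

Lemma sqdist_set_ge0 m (A : set ('I_m -> R)) x : 0 <= sqdist_set A x.
Proof.
have [->|/set0P A0] := eqVneq A set0.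
  by rewrite /sqdist_set image_set0 inf0.
apply: lb_le_inf; first by case: A0 => y Ay; exists (sqdist x y); exists y.
by move=> _ [y _ <-]; exact: sqdist_ge0.
Qed.

Lemma sqdist_set_le m (A : set ('I_m -> R)) x y : A y -> sqdist_set A x <= sqdist x y.
Proof.
move=> Ay; apply: ge_inf; last by exists y.
by exists 0 => _ [z _ <-]; exact: sqdist_ge0.
Qed.

Lemma sqdist_set_approx m (A : set ('I_m -> R)) x e : A !=set0 -> 0 < e ->
  exists2 y, A y & sqdist x y < sqdist_set A x + e.
Proof.
move=> [y0 Ay0] e0.
have := @inf_adherent R [set sqdist x y | y in A] e e0.
case.
  split; first by exists (sqdist x y0); exists y0.
  by exists 0 => _ [z _ <-]; exact: sqdist_ge0.
by move=> _ [y Ay <-] h; exists y.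
Qed.

Definition fconvex (m : nat) (A : set ('I_m -> R)) := forall x y t, A x -> A y ->
  0 <= t <= 1 -> A (fun k => (1 - t) * x k + t * y k).

Definition fcons m (t : R) (y : 'I_m -> R) : 'I_m.+1 -> R :=
  fun k => oapp y t (unlift ord0 k).

Lemma fcons0 m t (y : 'I_m -> R) : fcons t y ord0 = t.
Proof. by rewrite /fcons unlift_none. Qed.

Lemma fconsS m t (y : 'I_m -> R) k : fcons t y (lift ord0 k) = y k.
Proof. by rewrite /fcons liftK. Qed.

Lemma fcons_mix m (t0 t1 : R) (y0 y1 : 'I_m -> R) a :
  (fun k => (1 - a) * fcons t0 y0 k + a * fcons t1 y1 k) =
  fcons ((1 - a) * t0 + a * t1) (fun k => (1 - a) * y0 k + a * y1 k).
Proof.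
apply/funext => k; case: (unliftP ord0 k) => [j ->|->]; first by rewrite !fconsS.
by rewrite !fcons0.
Qed.

Definition section m (A : set ('I_m.+1 -> R)) (t : R) : set ('I_m -> R) :=
  [set y | A (fcons t y)].

Lemma section_convex m (A : set ('I_m.+1 -> R)) t : fconvex A -> fconvex (section A t).
Proof.
move=> cA x y a Ax Ay a01; rewrite /section/=.
have := cA _ _ a Ax Ay a01; rewrite fcons_mix.
by have -> : (1 - a) * t + a * t = t by ring.
Qed.

(** Mix a near-nearest point of the section at [s] with one of the section at [t]. By convexity the
    mixture lies in [A]; its first coordinate costs [a ^+ 2 * (s - t) ^+ 2], the others cost the
    mixture of the distances by convexity of the square. *)
Lemma sqdist_section m (A : set ('I_m.+1 -> R)) s t y a : fconvex A ->
  section A s !=set0 -> section A t !=set0 -> 0 <= a <= 1 ->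
  sqdist_set A (fcons s y) <= a ^+ 2 * (s - t) ^+ 2 +
    ((1 - a) * sqdist_set (section A s) y + a * sqdist_set (section A t) y).
Proof.
move=> cA As At a01; have /andP[a0 a1] := a01.
apply/ler_addgt0Pr => e e0.
have [y1 Ay1 h1] := sqdist_set_approx y As e0.
have [y2 Ay2 h2] := sqdist_set_approx y At e0.
have := cA _ _ a Ay1 Ay2 a01; rewrite fcons_mix => /sqdist_set_le.
move=> /(_ (fcons s y)) /le_trans; apply.
rewrite {1}/sqdist big_ord_recl !fcons0.
have -> : (s - ((1 - a) * s + a * t)) ^+ 2 = a ^+ 2 * (s - t) ^+ 2 by ring.
rewrite -!addrA lerD2l.
apply: (@le_trans _ _ ((1 - a) * sqdist y y1 + a * sqdist y y2)).
  rewrite /sqdist !mulr_sumr -big_split/=; apply: ler_sum => k _.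
  rewrite !fconsS -subr_ge0.
  have -> : (1 - a) * (y k - y1 k) ^+ 2 + a * (y k - y2 k) ^+ 2 -
   (y k - ((1 - a) * y1 k + a * y2 k)) ^+ 2 = a * (1 - a) * (y1 k - y2 k) ^+ 2 by ring.
  by apply: mulr_ge0; [apply: mulr_ge0; lra|exact: sqr_ge0].
nra.
Qed.

Section FinProd.
Variable J : finType.

Lemma sum_ffun_recl m (F : {ffun 'I_m.+1 -> J} -> R) :
  \sum_s F s = \sum_j \sum_(s : {ffun 'I_m -> J})
    F [ffun k => oapp s j (unlift ord0 k)].
Proof.
pose h (p : J * {ffun 'I_m -> J}) : {ffun 'I_m.+1 -> J} :=
  [ffun k => oapp p.2 p.1 (unlift ord0 k)].
rewrite pair_bigA/= (reindex h)//=.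
exists (fun s => (s ord0, [ffun k => s (lift ord0 k)])).
  move=> [j s] _; rewrite /h !ffunE unlift_none/=; congr pair.
  by apply/ffunP => k; rewrite !ffunE liftK.
move=> s _; apply/ffunP => k; rewrite !ffunE.
by case: (unliftP ord0 k) => [j ->|->]/=; rewrite ?ffunE.
Qed.

Definition pweight m (w : 'I_m -> J -> R) (s : {ffun 'I_m -> J}) := \prod_k w k (s k).

Definition ppoint m (v : 'I_m -> J -> R) (s : {ffun 'I_m -> J}) : 'I_m -> R :=
  fun k => v k (s k).

Lemma pweight_recl m (w : 'I_m.+1 -> J -> R) j (s : {ffun 'I_m -> J}) :
  pweight w [ffun k => oapp s j (unlift ord0 k)] =
  w ord0 j * pweight (fun k => w (lift ord0 k)) s.
Proof.
rewrite /pweight big_ord_recl ffunE unlift_none/=; congr (_ * _).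
by apply: eq_bigr => k _; rewrite ffunE liftK.
Qed.

Lemma ppoint_recl m (v : 'I_m.+1 -> J -> R) j (s : {ffun 'I_m -> J}) :
  ppoint v [ffun k => oapp s j (unlift ord0 k)] =
  fcons (v ord0 j) (ppoint (fun k => v (lift ord0 k)) s).
Proof.
apply/funext => k; rewrite /ppoint ffunE.
by case: (unliftP ord0 k) => [i ->|->]; rewrite ?fconsS ?fcons0.
Qed.

(** Induction on the dimension, for finitely supported product measures. With p the probability of a
    section, q the largest such probability and r = p/q, [sqdist_section] followed by Hölder and the
    induction hypothesis bounds the exponential moment given the first coordinate by e^(a^2/9)
    r^(-(1-a)) / q, hence by (2 - r)/q for the right a. Averaging over the first coordinate gives (2
    - P/q)/q, and (2 - x) x <= 1 with x = P/q. The constant 36 makes the squared diameter (2b)^2 of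
    a coordinate cost at most 1/9. *)
Theorem talagrand m (w v : 'I_m -> J -> R) (b : R) (A : set ('I_m -> R)) :
  0 < b -> (forall k j, 0 <= w k j) -> (forall k, \sum_j w k j = 1) ->
  (forall k j, `|v k j| <= b) -> fconvex A ->
  (\sum_s pweight w s * expR ((36 * b ^+ 2)^-1 * sqdist_set A (ppoint v s))) *
  (\sum_s pweight w s * (ppoint v s \in A)%:R) <= 1.
Proof.
move=> b0; set c := (36 * b ^+ 2)^-1.
have c0 : 0 <= c by rewrite invr_ge0 mulr_ge0// sqr_ge0.
elim: m w v A => [|m IH] w v A w0 w1 vb cA.
  have E0 (F : {ffun 'I_0 -> J} -> R) : \sum_s F s = F (ffun0 (card_ord 0)).
    rewrite (bigD1 (ffun0 (card_ord 0)))//= big1 ?addr0// => s /eqP[].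
    by apply/ffunP; case.
  rewrite !E0 /pweight big_ord0 !mul1r; set x := ppoint v _.
  have [xA|] := boolP (x \in A); last by rewrite mulr0.
  rewrite mulr1.
  have -> : sqdist_set A x = 0.
    apply/eqP; rewrite eq_le sqdist_set_ge0 andbT.
    rewrite inE in xA; apply: (le_trans (sqdist_set_le x xA)).
    by rewrite /sqdist big_ord0.
  by rewrite mulr0 expR0.
pose w' (k : 'I_m) := w (lift ord0 k); pose v' (k : 'I_m) := v (lift ord0 k).
pose As j := section A (v ord0 j).
pose p j := \sum_s pweight w' s * (ppoint v' s \in As j)%:R.
have pw0 s : 0 <= pweight w' s by apply: prodr_ge0 => k _; exact: w0.
have p0 j : 0 <= p j by apply: sumr_ge0 => s _; rewrite mulr_ge0.
have PE : \sum_s pweight w s * (ppoint v s \in A)%:R = \sum_j w ord0 j * p j.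
  rewrite sum_ffun_recl; apply: eq_bigr => j _.
  rewrite mulr_sumr; apply: eq_bigr => s _.
  by rewrite pweight_recl ppoint_recl mulrA.
rewrite PE.
have [j1 _] : exists j1 : J, True.
  case: (pickP (fun _ : J => true)) => [j _|]; first by exists j.
  move=> J0; have := w1 ord0; rewrite big_pred0// => /esym/eqP.
  by rewrite oner_eq0.
pose j0 := [arg max_(j > j1) p j]%O.
have pj0 j : p j <= p j0 by rewrite /j0; case: arg_maxP => //= i _; apply.
set q := p j0 in pj0.
have [q0|q0] := eqVneq q 0.
  rewrite [X in _ * X]big1 ?mulr0 ?ler01// => j _.
  have -> : p j = 0 by apply/eqP; rewrite eq_le p0 -q0 pj0.
  by rewrite mulr0.
have {}q0 : 0 < q by rewrite lt_def q0 p0.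
have IHj j : (\sum_s pweight w' s * expR (c * sqdist_set (As j) (ppoint v' s))) * p j <= 1.
  by apply: IH => //; [move=> k; exact: w0|move=> k; exact: w1|move=> k; exact: vb|
     exact: section_convex].
have Ane j : 0 < p j -> As j !=set0.
  move=> pj; apply/set0P/eqP => A0; move: pj; rewrite /p.
  by rewrite big1 ?ltxx// => s _; rewrite A0 (_ : _ \in _ = false) ?mulr0//; apply/negbTE; rewrite notin_setE.
have key j : \sum_s pweight w' s * expR (c * sqdist_set A (fcons (v ord0 j) (ppoint v' s)))
    <= (2 - p j / q) / q.
  have cst : c * (v ord0 j - v ord0 j0) ^+ 2 <= 9^-1.
    have : (v ord0 j - v ord0 j0) ^+ 2 <= 4 * b ^+ 2.
      have -> : 4 * b ^+ 2 = (b + b) ^+ 2 by ring.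
      rewrite -[leLHS]real_normK ?num_real// ler_sqr ?nnegrE//; last by lra.
      by apply: (le_trans (ler_normB _ _)); apply: lerD.
    move=> /(ler_wpM2l c0) /le_trans; apply.
    by rewrite le_eqVlt; apply/orP; left; apply/eqP; rewrite /c; field; rewrite gt_eqF.
  have q1 : \sum_s pweight w' s * expR (c * sqdist_set (As j0) (ppoint v' s)) <= q^-1.
    by rewrite -[leRHS]mul1r ler_pdivlMr.
  have sec a s : As j !=set0 -> 0 <= a <= 1 ->
     c * sqdist_set A (fcons (v ord0 j) (ppoint v' s)) <= a ^+ 2 / 9 +
       ((1 - a) * (c * sqdist_set (As j) (ppoint v' s)) +
            a * (c * sqdist_set (As j0) (ppoint v' s))).
    move=> Aj a01.
    have := @sqdist_section m A (v ord0 j) (v ord0 j0) (ppoint v' s) a cA Aj (Ane _ q0) a01.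
    move=> /(ler_wpM2l c0) /le_trans; apply.
    rewrite mulrDr; apply: lerD.
      by rewrite mulrCA ler_wpM2l// sqr_ge0.
    by rewrite le_eqVlt; apply/orP; left; apply/eqP; ring.
  (* A section of probability 0 may be empty, with the meaningless distance 0. It is replaced
     entirely by the section of [j0], at the cost e^(1/9) <= 2. *)
  have [pj|pj] := eqVneq (p j) 0.
    rewrite pj mul0r subr0.
    apply: (@le_trans _ _ (expR (9^-1) * q^-1)).
      apply: le_trans (ler_wpM2l (expR_ge0 _) q1).
      rewrite mulr_sumr; apply: ler_sum => s _.
      rewrite mulrCA ler_wpM2l// -expRD ler_expR.
      have [y Ay] := Ane _ q0.
      apply: (@le_trans _ _ (c * ((v ord0 j - v ord0 j0) ^+ 2 +
           sqdist_set (As j0) (ppoint v' s)))); last by rewrite mulrDr lerD2r.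
      apply: ler_wpM2l => //.
      apply/ler_addgt0Pr => e e0.
      have [y1 Ay1 h1] := sqdist_set_approx (ppoint v' s) (Ane _ q0) e0.
      have {}Ay1 : A (fcons (v ord0 j0) y1) := Ay1.
      apply: (le_trans (sqdist_set_le _ Ay1)).
      rewrite {1}/sqdist big_ord_recl !fcons0 -addrA lerD2l.
      under eq_bigr do rewrite !fconsS.
      exact: ltW.
    apply: ler_wpM2r; first by rewrite invr_ge0 ltW.
    apply: (@le_trans _ _ (expR (ln 2))); last by rewrite lnK ?posrE.
    rewrite ler_expR.
    have : ln (2 : R)^-1 <= 2^-1 - 1 by apply: ln_le_subr1; rewrite invr_gt0.
    by rewrite lnV ?posrE//; lra.
  have {}pj : 0 < p j by rewrite lt_def pj p0.
  have r01 : 0 < p j / q <= 1.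
    by rewrite divr_gt0//= ler_pdivrMr// mul1r.
  have [a a01 ha] := talagrand_param r01.
  have p1 : \sum_s pweight w' s * expR (c * sqdist_set (As j) (ppoint v' s)) <= (p j)^-1.
    by rewrite -[leRHS]mul1r ler_pdivlMr.
  have H := expR_hoelder pw0 a01 (_ : 0 < (p j)^-1) (_ : 0 < q^-1) p1 q1.
  have {}H := H ltac:(by rewrite invr_gt0) ltac:(by rewrite invr_gt0).
  apply: (@le_trans _ _ (expR (a ^+ 2 / 9) * expR ((1 - a) * ln (p j)^-1 + a * ln q^-1))).
    apply: le_trans (ler_wpM2l (expR_ge0 _) H).
    rewrite mulr_sumr; apply: ler_sum => s _.
    rewrite mulrCA ler_wpM2l// -expRD ler_expR.
    by apply: sec => //; exact: Ane.
  apply: le_trans (ler_wpM2r _ ha); last by rewrite invr_ge0 ltW.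
  have qE : q^-1 = expR (ln q^-1) by rewrite lnK// posrE invr_gt0.
  rewrite [X in _ <= _ * X]qE -!expRD ler_expR lnM ?posrE ?invr_gt0// !lnV ?posrE//.
  by rewrite le_eqVlt; apply/orP; left; apply/eqP; ring.
have lhs : \sum_s pweight w s * expR (c * sqdist_set A (ppoint v s)) <=
   \sum_j w ord0 j * ((2 - p j / q) / q).
  rewrite sum_ffun_recl; apply: ler_sum => j _.
  apply: le_trans (ler_wpM2l (w0 _ _) (key j)).
  rewrite mulr_sumr; apply: ler_sum => s _.
  by rewrite pweight_recl ppoint_recl mulrA.
set P := \sum_j w ord0 j * p j in PE *.
have P0 : 0 <= P by apply: sumr_ge0 => j _; rewrite mulr_ge0.
apply: (le_trans (ler_wpM2r P0 lhs)).
have -> : \sum_j w ord0 j * ((2 - p j / q) / q) = (2 - P / q) / q.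
  transitivity (\sum_j (2 / q * w ord0 j - (q ^+ 2)^-1 * (w ord0 j * p j))).
    by apply: eq_bigr => j _; field; rewrite gt_eqF.
  rewrite big_split/= sumrN -!mulr_sumr w1 -/P; field; rewrite gt_eqF//.
have -> : (2 - P / q) / q * P = 1 - (1 - P / q) ^+ 2 by field; rewrite gt_eqF.
by rewrite gerBl sqr_ge0.
Qed.

End FinProd.
End Talagrand.

(** * Traces of convex functions of a symmetric matrix *)

Section TraceFun.
Variable R : realType.

Lemma sum_perm (f : R -> R) n (D : 'I_n -> R) (s : n.-tuple R) :
  perm_eq [seq D i | i : 'I_n] s -> \sum_j f (tnth s j) = \sum_i f (D i).
Proof.
move=> h; rewrite -(big_tuple _ _ _ xpredT f) -(perm_big _ h)/=.
by rewrite big_image.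
Qed.

Definition trace_fun n (f : R -> R) (T : 'M[R]_n) : R :=
  \sum_(j < n) f (tnth (eigenvalues T) j).

(* Supporting lines of slope at most [L] pack convexity and the Lipschitz bound. *)
Definition conv_lip (L : R) (f : R -> R) := forall x0, exists2 s, `|s| <= L &
  forall x, f x0 + s * (x - x0) <= f x.

Lemma conv_lip_jensen L f n (c x : 'I_n -> R) : conv_lip L f ->
  (forall k, 0 <= c k) -> \sum_k c k = 1 ->
  f (\sum_k c k * x k) <= \sum_k c k * f (x k).
Proof.
move=> cf c0 c1; set m := \sum_k _; have [s _ hs] := cf m.
apply: (@le_trans _ _ (\sum_k c k * (f m + s * (x k - m)))).
  rewrite (eq_bigr (fun k => (f m - s * m) * c k + s * (c k * x k))); last first.
    by move=> k _; ring.
  by rewrite big_split/= -!mulr_sumr c1 -/m le_eqVlt; apply/orP; left; apply/eqP; ring.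
by apply: ler_sum => k _; exact: ler_wpM2l.
Qed.

Lemma conv_lip_lip L f x y : conv_lip L f -> f x - f y <= L * `|x - y|.
Proof.
move=> cf; have [s sL /(_ y) hs] := cf x.
rewrite lerBlDr -lerBlDl; apply: le_trans hs.
rewrite lerD2l -[leRHS]opprK lerN2 -mulrN opprB.
by apply: (le_trans (ler_norm _)); rewrite normrM ler_wpM2r.
Qed.

Lemma conv_lip_convex L f x y a : conv_lip L f -> 0 <= a <= 1 ->
  f ((1 - a) * x + a * y) <= (1 - a) * f x + a * f y.
Proof.
move=> cf /andP[a0 a1]; set z := (_ + _); have [s _ hs] := cf z.
have := ler_wpM2l a0 (hs y); have := ler_wpM2l (_ : 0 <= 1 - a) (hs x).
rewrite subr_ge0 a1 => /(_ isT) h1 h2; apply: le_trans (lerD h1 h2).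
by rewrite le_eqVlt; apply/orP; left; apply/eqP; rewrite /z; ring.
Qed.

Lemma sum_sqr_le n (x : 'I_n -> R) : (\sum_j x j) ^+ 2 <= n%:R * \sum_j x j ^+ 2.
Proof.
rewrite -subr_ge0.
have : 0 <= \sum_i \sum_j (x i - x j) ^+ 2.
  by apply: sumr_ge0 => i _; apply: sumr_ge0 => j _; exact: sqr_ge0.
have -> : \sum_i \sum_j (x i - x j) ^+ 2 =
    2 * (n%:R * \sum_j x j ^+ 2 - (\sum_j x j) ^+ 2).
  under eq_bigr => i _.
    rewrite (eq_bigr (fun j => x i ^+ 2 + x j ^+ 2 - 2 * x i * x j)); last first.
      by move=> j _; ring.
    rewrite big_split/= sumrN -mulr_sumr big_split/= sumr_const card_ord.
    over.
  rewrite big_split/= sumrN -mulr_suml -mulr_sumr big_split/= sumr_const card_ord.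
  have nE (y : R) : y *+ n = n%:R * y by rewrite mulr_natl.
  by rewrite sumrMnl (nE (\sum_i _)); ring.
by rewrite pmulr_rge0.
Qed.

Definition frob n (B : 'M[R]_n) : R := \sum_i \sum_j B i j ^+ 2.

Lemma normFt_ge0 n (B : 'M[R]_n) : 0 <= normFt B. Proof. exact: sqrtr_ge0. Qed.

(** Off-diagonal entries are counted twice in [frob] and once in [normFt]. *)
Lemma frob_le_normFt n (B : 'M[R]_n) : B^T = B -> frob B <= 2 * normFt B ^+ 2.
Proof.
move=> Bs; rewrite sqr_sqrtr; last first.
  by apply: sumr_ge0 => i _; apply: sumr_ge0 => j _; exact: sqr_ge0.
have Bij i j : B i j = B j i by rewrite -[in LHS]Bs mxE.
rewrite mulr_natl mulr2n /frob [X in _ <= _ + X](exchange_big_dep xpredT)//=.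
rewrite -big_split/=; apply: ler_sum => i _.
rewrite (bigID (fun j : 'I_n => (i <= j)%N))/=; rewrite lerD2l.
apply: (@le_trans _ _ (\sum_(j < n | (j <= i)%N) B i j ^+ 2)).
  rewrite [leRHS](bigID (fun j : 'I_n => ~~ (i <= j)%N))/= -[leLHS]addr0.
  apply: lerD; last by apply: sumr_ge0 => k _; exact: sqr_ge0.
  rewrite le_eqVlt; apply/orP; left; apply/eqP; apply: eq_bigl => j.
  by case: leqP => //=; rewrite ?andbF// andbT => /ltnW ->.
rewrite le_eqVlt; apply/orP; left; apply/eqP; apply: eq_big => // j _.
by rewrite Bij.
Qed.

Lemma eigenvalue_eigenvalues n (T : 'M[R]_n) x : T^T = T ->
  eigenvalue T x = (x \in eigenvalues T).
Proof.
move=> Ts; have [_ Te] := eigenvaluesP Ts.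
by rewrite eigenvalue_root_char Te root_prod_XsubC.
Qed.

Lemma det_eigenvalues n (T : 'M[R]_n) : T^T = T ->
  `|\det T| = \prod_(j < n) `|tnth (eigenvalues T) j|.
Proof.
move=> Ts; have [_ Te] := eigenvaluesP Ts.
have := char_poly_det T; rewrite Te -horner_coef0 horner_prod => /(congr1 Num.norm).
rewrite normrM normrX normrN1 expr1n mul1r => <-.
rewrite normr_prod big_tuple; apply: eq_bigr => j _.
by rewrite hornerXsubC sub0r normrN.
Qed.

Lemma eigenvalues_sorted n (T : 'M[R]_n) : T^T = T -> sorted <=%R (eigenvalues T).
Proof. by move=> /eigenvaluesP[]. Qed.

End TraceFun.

(** * Spectral decomposition over a closed field and variational formula for traces *)

Section Spectral.
Variables (R : realType) (C : numClosedFieldType) (rc : {rmorphism R -> C}) (re : C -> R).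
Hypothesis reD : forall z t, re (z + t) = re z + re t.
Hypothesis reM : forall x z, re (rc x * z) = x * re z.
Hypothesis re1 : re 1 = 1.
Hypothesis rc_re : forall z, z \is Num.real -> rc (re z) = z.
Hypothesis rc_real : forall x, rc x \is Num.real.
Hypothesis re_ge0 : forall z, 0 <= re (z * z^*).
Hypothesis sqr_re_le : forall z, re z ^+ 2 <= re (z * z^*).
Local Open Scope sesquilinear_scope.
Local Notation toC := (map_mx rc).

Let re0 : re 0 = 0.
Proof. by have := reM 0 0; rewrite rmorph0 !mul0r. Qed.

Let reK x : re (rc x) = x.
Proof. by rewrite -[rc x]mulr1 reM re1 mulr1. Qed.

Lemma re_sum (I : Type) (r : seq I) (Q : pred I) (F : I -> C) :
  re (\sum_(i <- r | Q i) F i) = \sum_(i <- r | Q i) re (F i).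
Proof. exact: (big_morph re reD re0). Qed.

Definition sqmod (z : C) : R := re (z * z^*).

Lemma spectral_sym n (T : 'M[R]_n) : T^T = T ->
  exists (V : 'M[C]_n) (D : 'I_n -> R), [/\ V \is unitarymx,
    perm_eq [seq D i | i : 'I_n] (eigenvalues T) &
    toC T = V^t* *m diag_mx (\row_i rc (D i)) *m V].
Proof.
move=> Tsym; pose A : 'M[C]_n := toC T.
have Aherm : A \is hermsymmx.
  apply: realsym_hermsym.
    apply/is_hermitianmxP; rewrite expr0 scale1r.
    by apply/matrixP => i j; rewrite !mxE -[in LHS]Tsym mxE.
  by apply/mxOverP => i j; rewrite mxE; exact: rc_real.
have /mxOverP Dreal := hermitian_spectral_diag_real Aherm.
have /orthomx_spectralP := hermitian_normalmx Aherm.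
set P := spectralmx A; set D := spectral_diag A => AE.
have PU : P \is unitarymx by exact: spectral_unitarymx.
exists P, (fun i => re (D ord0 i)); split => //.
  have Ts : char_poly T = \prod_(x <- [seq re (D ord0 i) | i : 'I_n]) ('X - x%:P).
    apply: (map_poly_inj rc).
    rewrite map_char_poly -/A AE char_poly_similar ?spectral_unit//.
    rewrite char_poly_trig ?diag_mx_is_trig// rmorph_prod big_image/=.
    apply: eq_bigr => i _.
    by rewrite rmorphB/= map_polyX map_polyC/= rc_re ?Dreal// !mxE eqxx.
  have [_ Te] := eigenvaluesP Tsym.
  by apply: prod_XsubC_eq; rewrite -Ts -Te.
rewrite -/A {1}AE (invmx_unitary PU); congr (_ *m diag_mx _ *m _).
by apply/rowP => i; rewrite mxE rc_re.
Qed.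

(** The Rayleigh quotient of [B] at the j-th row of [U]. It is linear in [B], whereas eigenvalues
    are not. *)
Definition qform n (U : 'M[C]_n) (B : 'M[R]_n) (j : 'I_n) : R :=
  re ((U *m toC B *m U^t*) j j).

Lemma qform_lin n (U : 'M[C]_n) (B0 B1 : 'M[R]_n) (a b : R) j :
  qform U (a *: B0 + b *: B1) j = a * qform U B0 j + b * qform U B1 j.
Proof.
rewrite /qform.
have -> : toC (a *: B0 + b *: B1) =
    rc a *: toC B0 + rc b *: toC B1.
  by apply/matrixP => i k; rewrite !mxE rmorphD !rmorphM.
rewrite mulmxDr mulmxDl -!scalemxAr -!scalemxAl.
rewrite mxE [X in re (X + _)]mxE [X in re (_ + X)]mxE.
by rewrite reD !reM.
Qed.

Lemma unitary_rows n (W : 'M[C]_n) j : W \is unitarymx -> \sum_k sqmod (W j k) = 1.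
Proof.
move=> /unitarymxP/matrixP/(_ j j); rewrite !mxE eqxx => /(congr1 re).
rewrite re_sum re1 => <-; apply: eq_bigr => k _.
by rewrite !mxE.
Qed.

Lemma unitary_cols n (W : 'M[C]_n) k : W \is unitarymx -> \sum_j sqmod (W j k) = 1.
Proof.
rewrite -trmx_unitary => /unitary_rows -/(_ k) <-.
by apply: eq_bigr => j _; rewrite mxE.
Qed.

Lemma qform_spectral n (T : 'M[R]_n) (V U : 'M[C]_n) (D : 'I_n -> R) j :
  toC T = V^t* *m diag_mx (\row_i rc (D i)) *m V ->
  qform U T j = \sum_k sqmod ((U *m V^t*) j k) * D k.
Proof.
move=> TE; rewrite /qform TE.
set Dm := diag_mx _; set W := U *m V^t*.
have -> : U *m (V^t* *m Dm *m V) *m U^t* = W *m Dm *m W^t*.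
  by rewrite /W trmx_mul map_mxM trmxCK !mulmxA.
rewrite mxE re_sum; apply: eq_bigr => k _.
rewrite mul_mx_diag !mxE mulrAC mulrC.
by rewrite reM mulrC.
Qed.

(** Peierls' inequality. The Rayleigh quotients are averages of the eigenvalues with weights
    [sqmod (W j k)], W unitary; rows sum to 1, which allows Jensen, and columns sum to 1, which
    restores the trace. With [trace_fun_attained] it presents [trace_fun f T] as a maximum over
    unitary [U] of sums of [f] at quantities linear in [T]. *)
Lemma trace_fun_ge n (T : 'M[R]_n) (U : 'M[C]_n) L f : T^T = T -> conv_lip L f ->
  U \is unitarymx -> \sum_j f (qform U T j) <= trace_fun f T.
Proof.
move=> Ts cf UU; have [V [D [VU pD TE]]] := spectral_sym Ts.
rewrite /trace_fun (sum_perm f pD).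
have VU' : V^t* \is unitarymx by rewrite trmxC_unitary.
have := mul_unitarymx UU VU'.
have := fun j => qform_spectral U j TE.
move: (U *m V^t*) => W qE WU.
apply: (@le_trans _ _ (\sum_j \sum_k sqmod (W j k) * f (D k))).
  apply: ler_sum => j _; rewrite qE.
  apply: (conv_lip_jensen _ cf) => [k|]; first exact: re_ge0.
  exact: (unitary_rows _ WU).
rewrite exchange_big/=; apply: ler_sum => k _.
by rewrite -mulr_suml (unitary_cols _ WU) mul1r.
Qed.

Lemma trace_fun_attained n (T : 'M[R]_n) : T^T = T ->
  exists2 U : 'M[C]_n, U \is unitarymx &
  forall f, trace_fun f T = \sum_j f (qform U T j).
Proof.
move=> Ts; have [V [D [VU pD TE]]] := spectral_sym Ts.
exists V => // f; rewrite /trace_fun (sum_perm f pD); apply: eq_bigr => j _.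
rewrite (qform_spectral V j TE); congr f.
move/unitarymxP: VU => ->.
rewrite (bigD1 j)//= big1 => [|k kj]; rewrite mxE /sqmod.
  by rewrite eqxx conjC1 mulr1 re1 !addr0 mul1r.
by rewrite eq_sym (negbTE kj)/= mul0r re0 mul0r.
Qed.

(** A maximum of convex functions is convex: take [U] optimal for the mixture, split each term by
    convexity of [f], and use Peierls' inequality for [T0] and [T1] with this same [U]. *)
Lemma trace_fun_convex_of n (T0 T1 : 'M[R]_n) L f a : T0^T = T0 -> T1^T = T1 ->
  conv_lip L f -> 0 <= a <= 1 ->
  trace_fun f ((1 - a) *: T0 + a *: T1) <= (1 - a) * trace_fun f T0 + a * trace_fun f T1.
Proof.
move=> s0 s1 cf a01; have /andP[a0 a1] := a01.
have st : ((1 - a) *: T0 + a *: T1)^T = (1 - a) *: T0 + a *: T1.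
  by rewrite linearD !linearZ/= s0 s1.
have [U UU ->] := trace_fun_attained st.
apply: (@le_trans _ _ ((1 - a) * (\sum_j f (qform U T0 j)) + a * (\sum_j f (qform U T1 j)))).
  rewrite !mulr_sumr -big_split/=; apply: ler_sum => j _.
  by rewrite qform_lin; exact: conv_lip_convex cf _.
by apply: lerD; apply: ler_wpM2l => //; rewrite ?subr_ge0//; exact: trace_fun_ge cf UU.
Qed.

(** Conjugation by a unitary matrix preserves the Frobenius norm, and the left side keeps only the
    diagonal. *)
Lemma sum_qform_sqr n (B : 'M[R]_n) (U : 'M[C]_n) : U \is unitarymx ->
  \sum_j qform U B j ^+ 2 <= frob B.
Proof.
move=> UU; pose Fr (A : 'M[C]_n) := \sum_i \sum_j sqmod (A i j).
have FrE A : Fr A = re (\tr (A *m A^t*)).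
  rewrite /mxtrace re_sum; apply: eq_bigr => i _.
  by rewrite mxE re_sum; apply: eq_bigr => j _; rewrite !mxE .
have -> : frob B = Fr (U *m toC B *m U^t*).
  rewrite FrE !trmx_mul !map_mxM trmxCK.
  set A := toC B; set A' := A^t*.
  have -> : U *m A *m U^t* *m (U *m (A' *m U^t*)) = U *m (A *m A') *m U^t*.
    rewrite !mulmxA; congr (_ *m _ *m _).
    by rewrite mulmxKtV.
  rewrite mxtrace_mulC !mulmxA.
  have -> : U^t* *m U = 1%:M by rewrite -invmx_unitary// mulVmx// unitarymx_unit.
  rewrite mul1mx -FrE.
  apply: eq_bigr => i _; apply: eq_bigr => j _.
  by rewrite mxE /sqmod conj_Creal ?rc_real// -rmorphM reK.
apply: ler_sum => j _; rewrite (bigD1 j)//=.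
rewrite -[leLHS]addr0; apply: lerD; last by apply: sumr_ge0 => k _; exact: re_ge0.
exact: sqr_re_le.
Qed.

(** With [U] optimal for [T0], the difference is at most [L] times the sum of the absolute Rayleigh
    quotients of [T0 - T1]. Cauchy-Schwarz contributes the factor sqrt n, the passage from [frob] to
    [normFt] the factor sqrt 2. *)
Lemma trace_fun_lip_of n (T0 T1 : 'M[R]_n) L f : 0 <= L -> T0^T = T0 -> T1^T = T1 ->
  conv_lip L f ->
  trace_fun f T0 - trace_fun f T1 <= L * (Num.sqrt (2 * n%:R) * normFt (T0 - T1)).
Proof.
move=> L0 s0 s1 cf; have [U UU ->] := trace_fun_attained s0.
apply: (@le_trans _ _ (\sum_j f (qform U T0 j) - \sum_j f (qform U T1 j))).
  by rewrite lerD2l lerN2; exact: trace_fun_ge cf UU.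
rewrite -sumrB.
apply: (@le_trans _ _ (L * \sum_j `|qform U (T0 - T1) j|)).
  rewrite mulr_sumr; apply: ler_sum => j _.
  have -> : qform U (T0 - T1) j = qform U T0 j - qform U T1 j.
    have -> : T0 - T1 = 1 *: T0 + (-1) *: T1 by rewrite scale1r scaleN1r.
    by rewrite qform_lin mul1r mulN1r.
  exact: conv_lip_lip.
apply: ler_wpM2l => //.
rewrite -ler_sqr ?nnegrE; last 2 first.
- by apply: sumr_ge0.
- by rewrite mulr_ge0// ?sqrtr_ge0 ?normFt_ge0.
apply: (le_trans (sum_sqr_le _)).
rewrite exprMn sqr_sqrtr ?mulr_ge0// (mulrC 2) -mulrA.
apply: ler_wpM2l => //.
under eq_bigr do rewrite real_normK ?num_real//.
apply: (le_trans (sum_qform_sqr _ UU)); apply: frob_le_normFt.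
by rewrite linearB/= s0 s1.
Qed.

End Spectral.

Section TraceFunComplex.
Variable R : realType.
Let C : numClosedFieldType := R[i].
Let rc : {rmorphism R -> C} := real_complex R.

Let reD (z t : C) : complex.Re (z + t) = complex.Re z + complex.Re t.
Proof. by case: z t => [a b] [c d]. Qed.

Let reM (x : R) (z : C) : complex.Re (rc x * z) = x * complex.Re z.
Proof. by case: z => a b /=; rewrite mul0r subr0. Qed.

Let rc_real x : rc x \is Num.real.
Proof. by apply/complex_realP; exists x. Qed.

Let reJ (z : C) : complex.Re (z * z^*) = complex.Re z ^+ 2 + complex.Im z ^+ 2.
Proof. by rewrite -normCK -add_Re2_Im2. Qed.

Let re_ge0 (z : C) : 0 <= complex.Re (z * z^*).
Proof. by rewrite reJ addr_ge0 ?sqr_ge0. Qed.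

Let sqr_re_le (z : C) : complex.Re z ^+ 2 <= complex.Re (z * z^*).
Proof. by rewrite reJ lerDl sqr_ge0. Qed.

Lemma trace_fun_convex n (T0 T1 : 'M[R]_n) L f a : T0^T = T0 -> T1^T = T1 ->
  conv_lip L f -> 0 <= a <= 1 ->
  trace_fun f ((1 - a) *: T0 + a *: T1) <= (1 - a) * trace_fun f T0 + a * trace_fun f T1.
Proof.
exact: (trace_fun_convex_of reD reM erefl (@RRe_real R) rc_real re_ge0).
Qed.

Lemma trace_fun_lip n (T0 T1 : 'M[R]_n) L f : 0 <= L -> T0^T = T0 -> T1^T = T1 ->
  conv_lip L f ->
  trace_fun f T0 - trace_fun f T1 <= L * (Num.sqrt (2 * n%:R) * normFt (T0 - T1)).
Proof.
exact: (trace_fun_lip_of reD reM erefl (@RRe_real R) rc_real re_ge0 sqr_re_le).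
Qed.

End TraceFunComplex.

(** * Concentration of quasiconvex Lipschitz functions *)

Section RealProbability.
Context (R : realType) d (T : measurableType d) (P : probability T R).

Definition pr (A : set T) : R := fine (P A).

Lemma prE A : measurable A -> P A = (pr A)%:E.
Proof. by move=> mA; rewrite /pr fineK// fin_num_measure. Qed.

Lemma pr_ge0 A : 0 <= pr A.
Proof. by rewrite fine_ge0. Qed.

Lemma pr_le A B : measurable A -> measurable B -> A `<=` B -> pr A <= pr B.
Proof.
by move=> mA mB AB; rewrite -lee_fin -!prE//; apply: le_measure; rewrite ?inE.
Qed.

Lemma pr_setT : pr setT = 1.
Proof. by rewrite /pr probability_setT. Qed.

Lemma pr_set0 : pr set0 = 0.
Proof. by rewrite /pr measure0. Qed.

Lemma pr_setU A B : measurable A -> measurable B -> pr (A `|` B) <= pr A + pr B.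
Proof.
move=> mA mB; rewrite -lee_fin EFinD -!prE//; first exact: measureU2.
exact: measurableU.
Qed.

Lemma pr_setC A : measurable A -> pr (~` A) = 1 - pr A.
Proof.
move=> mA; apply: EFin_inj; rewrite -prE; last exact: measurableC.
by rewrite probability_setC// EFinB prE.
Qed.

Lemma pr_bigU (I : finType) (Q : pred I) (E : I -> set T) : (forall i, measurable (E i)) ->
  pr (\big[setU/set0]_(i | Q i) E i) <= \sum_(i | Q i) pr (E i).
Proof.
move=> mE; elim: (index_enum I) => [|i r IH]; first by rewrite !big_nil pr_set0.
rewrite !big_cons; case: ifP => // _.
apply: (le_trans (pr_setU _ _)) => //; last by rewrite lerD2l.
by apply: bigsetU_measurable.
Qed.

Lemma pr_union_bound (I : finType) (Q : pred I) (A : set T) (E : I -> set T) :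
  measurable A -> (forall i, measurable (E i)) ->
  (forall w, A w -> exists2 i, Q i & E i w) -> pr A <= \sum_(i | Q i) pr (E i).
Proof.
move=> mA mE AE; apply: le_trans (pr_bigU Q mE); apply: pr_le => //.
  exact: bigsetU_measurable.
move=> w /AE[i Qi Ew]; by rewrite (bigD1 i)//=; left.
Qed.

Lemma pr_partition n (E : 'I_n -> set T) : (forall i, measurable (E i)) ->
  trivIset setT E -> (forall w, exists i, E i w) -> \sum_i pr (E i) = 1.
Proof.
move=> mE tE cE; apply: EFin_inj; rewrite -sumEFin.
under eq_bigr do rewrite -prE//.
rewrite -measure_bigsetU_ord// -(probability_setT P); congr (P _).
apply/seteqP; split => // w _; have [i Ei] := cE w.
by rewrite (bigD1 i)//=; left.
Qed.

Lemma pr_bigcap m (X : 'I_m -> T -> R) (B : 'I_m -> set R) :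
  independent_RVs P X -> (forall k, measurable (B k)) ->
  (forall k, measurable (X k @^-1` B k)) ->
  pr (\bigcap_k (X k @^-1` B k)) = \prod_k pr (X k @^-1` B k).
Proof.
move=> iX mB mX; have := iX [set: 'I_m]%SET B mB.
have -> : [set` [set: 'I_m]%SET] = [set: 'I_m].
  by apply/seteqP; split => // k _ /=; rewrite inE.
rewrite {1}/pr => ->.
rewrite (eq_bigr (fun k => (pr (X k @^-1` B k))%:E)) => [|k _]; last exact: prE.
by rewrite prodEFin/=; apply: eq_bigl => k; rewrite inE.
Qed.

End RealProbability.

Section LipschitzMeasurable.
Context (R : realType) d (T : measurableType d).

Lemma norm2_ge0 m (x : 'rV[R]_m) : 0 <= norm2 x.
Proof. exact: sqrtr_ge0. Qed.

Lemma norm2_le m (x : 'rV[R]_m) e : 0 <= e -> (forall k, `|x ord0 k| <= e) ->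
  norm2 x <= Num.sqrt m%:R * e.
Proof.
move=> e0 xe; idtac.
have -> : Num.sqrt m%:R * e = Num.sqrt (m%:R * e ^+ 2).
  by rewrite sqrtrM// sqrtr_sqr ger0_norm.
apply: ler_wsqrtr; apply: (@le_trans _ _ (\sum_(k < m) e ^+ 2)).
  apply: ler_sum => k _; rewrite -[leLHS]real_normK ?num_real//.
  by rewrite ler_sqr ?nnegrE.
by rewrite sumr_const card_ord mulr_natl.
Qed.

(** [G] is evaluated after rounding every coordinate down to the grid of mesh 1/(n+1). The rounded
    function takes countably many values, on cells that are finite intersections of preimages under
    single coordinates, and converges because [G] is Lipschitz. No sigma-algebra on row vectors is
    involved. *)
Lemma measurable_lipschitz m (X : 'I_m -> T -> R) (L : R) (G : 'rV[R]_m -> R) :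
  0 <= L -> (forall k, measurable_fun setT (X k)) ->
  (forall x y, `|G x - G y| <= L * norm2 (x - y)) ->
  measurable_fun setT (fun w => G (\row_k X k w)).
Proof.
move=> L0 mX GL.
pose q n (x : R) : R := (Num.floor (x * n.+1%:R))%:~R / n.+1%:R.
have qx n x : `|x - q n x| <= n.+1%:R^-1.
  have /andP[h1 h2] := floor_itv (x * n.+1%:R).
  have n0 : 0 < n.+1%:R :> R by rewrite ltr0n.
  have h3 : q n x <= x by rewrite /q ler_pdivrMr.
  rewrite ger0_norm ?subr_ge0// lerBlDr -[X in X + _]mul1r -mulrDl.
  by rewrite ler_pdivlMr// addrC; apply: ltW; rewrite intrD in h2.
apply: (@measurable_fun_cvg _ _ _ _ (fun n w => G (\row_k q n (X k w)))).
- move=> n _ B mB; rewrite setTI.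
  pose F (s : {ffun 'I_m -> int}) : set T :=
    if G (\row_k ((s k)%:~R / n.+1%:R)) \in B then
      \bigcap_k (X k @^-1` `[(s k)%:~R / n.+1%:R, ((s k) + 1)%:~R / n.+1%:R[) else set0.
  have -> : (fun w => G (\row_k q n (X k w))) @^-1` B = \bigcup_s F s.
    have n0 : 0 < n.+1%:R :> R by rewrite ltr0n.
    apply/seteqP; split => w /=.
      move=> Bw; exists [ffun k => Num.floor (X k w * n.+1%:R)] => //.
      rewrite /F ifT => [k _ /=|].
        rewrite !ffunE in_itv/= ler_pdivrMr// ltr_pdivlMr//; exact: floor_itv.
      by rewrite inE; congr (B (G _)): Bw; apply/rowP => k; rewrite !mxE ffunE.
    move=> [s _]; rewrite /F; case: ifPn => // /set_mem Bs sw.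
    congr (B (G _)): Bs; apply/rowP => k; rewrite !mxE.
    have := sw k I; rewrite /= in_itv/= ler_pdivrMr// ltr_pdivlMr// => h.
    by rewrite /q (floor_def h).
  apply: countable_bigcupT_measurable => // s; rewrite /F; case: ifP => // _.
  apply: fin_bigcap_measurable => // k _.
  by rewrite -[X in measurable X]setTI; apply: mX => //; exact: measurable_itv.
- move=> w _; apply/cvgrPdist_le => e e0.
  have [n hn] : exists n, L * (Num.sqrt m%:R / n.+1%:R) <= e.
    exists (Num.truncn (L * Num.sqrt m%:R / e)).
    rewrite mulrA ler_pdivrMr ?ltr0n// -ler_pdivrMl// mulrC.
    have := truncn_itv (_ : 0 <= L * Num.sqrt m%:R / e).
    rewrite divr_ge0 ?mulr_ge0 ?sqrtr_ge0 ?(ltW e0)// => /(_ isT) /andP[_ /ltW].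
    by [].
  exists n => // k /= nk; apply: (le_trans (GL _ _)); apply: le_trans hn.
  apply: ler_wpM2l => //; apply: norm2_le => [|j]; first by rewrite invr_ge0.
  rewrite !mxE; apply: (le_trans (qx _ _)).
  by rewrite lef_pV2 ?posrE ?ltr0n// ler_nat.
Qed.

End LipschitzMeasurable.

Section Concentration.
Context (R : realType) d (T : measurableType d) (P : probability T R).

(** The vector is rounded to a grid whose weights are the probabilities of the cells; independence
    makes the rounded law a product, so [talagrand] applies. Rounding changes [F] by at most [del],
    hence the convex set is a sublevel set at height [a + del], and the grid points of height at
    least [a' - del] are at distance at least [D / L] from it. The exponential Markov inequality
    concludes. *)
Lemma convex_concentration_discrete m (X : 'I_m -> T -> R) (b L : R) (F : 'rV[R]_m -> R)
    (a a' : R) (K : nat) (D : R) :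
  0 < b -> 0 < L -> (forall k, measurable_fun setT (X k)) -> independent_RVs P X ->
  (forall k w, `|X k w| <= b) ->
  (forall e x y t, F x <= e -> F y <= e -> 0 <= t <= 1 -> F ((1 - t) *: x + t *: y) <= e) ->
  (forall x y, `|F x - F y| <= L * norm2 (x - y)) ->
  let del := L * (Num.sqrt m%:R * (2 * b / K.+1%:R)) in
  0 <= D -> D <= a' - a - 2 * del ->
  pr P [set w | F (\row_k X k w) <= a] * pr P [set w | a' <= F (\row_k X k w)]
    <= expR (- ((36 * b ^+ 2)^-1 * (D / L) ^+ 2)).
Proof.
move=> b0 L0 mX iX Xb Fq FL del D0 hD.
have K0 : 0 < K.+1%:R :> R by rewrite ltr0n.
pose h : R := 2 * b / K.+1%:R.
have h0 : 0 < h by rewrite divr_gt0// mulr_gt0.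
have hKE : h * K.+1%:R = 2 * b by rewrite /h divfK// gt_eqF.
(* The last of the [K.+2] grid points is [b] itself: its half-open cell catches the value [b], and
   no grid point leaves [-b, b]. *)
pose pt (j : 'I_K.+2) : R := - b + h * j%:R.
pose B (j : 'I_K.+2) : set R := `[pt j, pt j + h[%classic.
have ptb j : `|pt j| <= b.
  rewrite ler_norml /pt; apply/andP; split; first by rewrite lerDl mulr_ge0// ltW.
  have : h * j%:R <= h * K.+1%:R by rewrite ler_pM2l// ler_nat -ltnS.
  by rewrite hKE; lra.
have mB j : measurable (B j) by exact: measurable_itv.
have mXB k j : measurable (X k @^-1` B j).
  by rewrite -[X in measurable X]setTI; apply: mX.
have cB x : `|x| <= b -> exists j, B j x.
  rewrite ler_norml => /andP[x1 x2].
  have y0 : 0 <= (x + b) / h by apply: divr_ge0; [lra|exact: ltW].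
  have /andP[t1 t2] := truncn_itv y0.
  have tK : (Num.truncn ((x + b) / h) < K.+2)%N.
    rewrite ltnS -(ler_nat R); apply: (le_trans t1).
    by rewrite ler_pdivrMr// mulrC hKE; lra.
  exists (Ordinal tK); rewrite /B/= in_itv/= /pt/=; apply/andP; split.
    by move: t1; rewrite ler_pdivlMr//; rewrite mulrC; lra.
  move: t2; rewrite ltr_pdivrMr// -natr1 mulrDl mul1r mulrC; lra.
have tB : trivIset setT B.
  apply/trivIsetP => /= i j _ _ ij; apply/seteqP; split => // x [].
  rewrite /B/= !in_itv/= /pt => /andP[i1 i2] /andP[j1 j2].
  case/negP: ij; apply/eqP/val_inj/eqP; rewrite eqn_leq; apply/andP; split.
    rewrite -ltnS -(ltr_nat R) -natr1 -(ltr_pM2l h0) mulrDr mulr1; lra.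
  rewrite -ltnS -(ltr_nat R) -natr1 -(ltr_pM2l h0) mulrDr mulr1; lra.
pose w (k : 'I_m) (j : 'I_K.+2) : R := pr P (X k @^-1` B j).
have w0 k j : 0 <= w k j by exact: pr_ge0.
have w1 k : \sum_j w k j = 1.
  apply: pr_partition => [j||t]; first exact: mXB.
    by move=> i j _ _ [t [Bi Bj]]; apply: tB => //; exists (X k t).
  by have [j Bj] := cB _ (Xb k t); exists j.
pose v (k : 'I_m) := pt.
pose E (s : {ffun 'I_m -> 'I_K.+2}) := \bigcap_k (X k @^-1` B (s k)).
have mE s : measurable (E s) by apply: fin_bigcap_measurable.
have prEs s : pr P (E s) = pweight w s by exact: pr_bigcap.
have near s t : E s t -> `|F (\row_k X k t) - F (\row_k ppoint v s k)| <= del.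
  move=> Est; apply: (le_trans (FL _ _)); rewrite /del ler_pM2l//.
  apply: norm2_le; first exact: ltW.
  move=> k; rewrite !mxE /ppoint /v; have := Est k I.
  rewrite /B/= in_itv/= => /andP[e1 e2].
  by rewrite ger0_norm ?subr_ge0//; rewrite lerBlDl ltW.
have cE t : exists s, E s t.
  have /choice[f hf] : forall k, exists j, B j (X k t) by move=> k; exact: cB.
  by exists [ffun k => f k] => k _ /=; rewrite ffunE; exact: hf.
pose A : set ('I_m -> R) := [set x | F (\row_k x k) <= a + del].
have cA : fconvex A.
  move=> x y t Ax Ay t01; rewrite /A/=.
  have -> : \row_k ((1 - t) * x k + t * y k) =
     (1 - t) *: (\row_k x k) + t *: (\row_k y k) by apply/rowP => k; rewrite !mxE.
  exact: Fq.
have mF : measurable_fun setT (fun w => F (\row_k X k w)).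
  by apply: measurable_lipschitz mX FL; exact: ltW.
have mF1 : measurable [set w | F (\row_k X k w) <= a].
  rewrite -[X in measurable X]setTI; have := mF measurableT `]-oo, a]%classic.
  by rewrite (_ : _ @^-1` _ = [set w | F (\row_k X k w) <= a])//; exact.
have mF2 : measurable [set w | a' <= F (\row_k X k w)].
  rewrite -[X in measurable X]setTI; have := mF measurableT `[a', +oo[%classic.
  rewrite (_ : _ @^-1` _ = [set w | a' <= F (\row_k X k w)]); first exact.
  by apply/seteqP; split => t /=; rewrite in_itv/= ?andbT//.
have pA : pr P [set w | F (\row_k X k w) <= a] <=
    \sum_s pweight w s * (ppoint v s \in A)%:R.
  apply: (@le_trans _ _ (\sum_(s | ppoint v s \in A) pr P (E s))).
    apply: pr_union_bound => // t /= Ft; have [s Es] := cE t; exists s => //.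
    rewrite inE /A/=; have := near s t Es; rewrite ler_norml => /andP[_ ?].
    have := near s t Es; rewrite ler_norml => /andP[? _]; lra.
  rewrite [leRHS](bigID (fun s => ppoint v s \in A))/= [X in _ <= _ + X]big1 ?addr0.
    by apply: ler_sum => s sA; rewrite sA mulr1 prEs.
  by move=> s /negbTE ->; rewrite mulr0.
(* For empty [A] the first probability vanishes; otherwise the infimum defining the distance is
   genuine and can be bounded below. *)
have [A0|/set0P A0] := eqVneq A set0.
  apply: (@le_trans _ _ 0); last exact: expR_ge0.
  apply: mulr_le0_ge0; last exact: pr_ge0.
  apply: (le_trans pA); rewrite big1// => s _; rewrite A0.
  by rewrite (_ : _ \in _ = false) ?mulr0//; apply/negbTE; rewrite notin_setE.
set c := (36 * b ^+ 2)^-1.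
have c0 : 0 <= c by rewrite invr_ge0 mulr_ge0// sqr_ge0.
have pB : pr P [set w | a' <= F (\row_k X k w)] <=
   (\sum_s pweight w s * expR (c * sqdist_set A (ppoint v s))) * expR (- (c * (D / L) ^+ 2)).
  apply: (@le_trans _ _ (\sum_(s | a' - del <= F (\row_k ppoint v s k)) pr P (E s))).
    apply: pr_union_bound => // t /= Ft; have [s Es] := cE t; exists s => //.
    have := near s t Es; rewrite ler_norml => /andP[? ?]; lra.
  rewrite mulr_suml [leRHS](bigID (fun s => a' - del <= F (\row_k ppoint v s k)))/=.
  rewrite -[leLHS]addr0; apply: lerD; last first.
    apply: sumr_ge0 => s _; rewrite !mulr_ge0 ?expR_ge0//.
    by apply: prodr_ge0 => k _.
  apply: ler_sum => s Fs; rewrite prEs -mulrA -[leLHS]mulr1.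
  apply: ler_wpM2l; first by apply: prodr_ge0 => k _.
  rewrite -expRD -expR0 ler_expR subr_ge0; apply: ler_wpM2l => //.
  apply: lb_le_inf; first by case: A0 => y Ay; exists (sqdist (ppoint v s) y); exists y.
  move=> _ [y Ay <-]; rewrite /A/= in Ay.
  have h1 : D <= L * norm2 (\row_k ppoint v s k - \row_k y k).
    apply: le_trans (FL _ _); apply: le_trans (ler_norm _); lra.
  have -> : sqdist (ppoint v s) y = norm2 (\row_k ppoint v s k - \row_k y k) ^+ 2.
    rewrite sqr_sqrtr; last by apply: sumr_ge0 => k _; exact: sqr_ge0.
    by apply: eq_bigr => k _; rewrite !mxE.
  have DL0 : 0 <= D / L by apply: divr_ge0 => //; exact: ltW.
  by rewrite ler_sqr ?nnegrE ?norm2_ge0// ler_pdivrMr// mulrC.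
have := talagrand b0 w0 w1 (fun k j => ptb j) cA; rewrite -/c.
set S1 := \sum_s _; set S2 := \sum_s _ => S12.
apply: (@le_trans _ _ (S2 * (S1 * expR (- (c * (D / L) ^+ 2))))).
  by apply: ler_pM => //; exact: pr_ge0.
by rewrite mulrA -[leRHS]mul1r; apply: ler_wpM2r; rewrite ?expR_ge0// mulrC.
Qed.

(** The mesh is taken so fine that the two rounding errors use at most half of the gap [a' - a]. The
    other half serves as [D], which turns 36 into 144. *)
Lemma convex_concentration m (X : 'I_m -> T -> R) (b L : R) (F : 'rV[R]_m -> R) (a a' : R) :
  0 < b -> 0 < L -> (forall k, measurable_fun setT (X k)) -> independent_RVs P X ->
  (forall k w, `|X k w| <= b) ->
  (forall e x y t, F x <= e -> F y <= e -> 0 <= t <= 1 -> F ((1 - t) *: x + t *: y) <= e) ->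
  (forall x y, `|F x - F y| <= L * norm2 (x - y)) -> a < a' ->
  pr P [set w | F (\row_k X k w) <= a] * pr P [set w | a' <= F (\row_k X k w)]
    <= expR (- ((a' - a) ^+ 2 / (144 * (b * L) ^+ 2))).
Proof.
move=> b0 L0 mX iX Xb Fq FL aa'.
pose K := Num.truncn (8 * (L * Num.sqrt m%:R * b) / (a' - a)).
have K0 : 0 < K.+1%:R :> R by rewrite ltr0n.
have aa0 : 0 < a' - a by rewrite subr_gt0.
have q0 : 0 <= 8 * (L * Num.sqrt m%:R * b) / (a' - a).
  by rewrite divr_ge0 ?(ltW aa0)// !mulr_ge0 ?sqrtr_ge0 ?(ltW b0) ?(ltW L0).
have /andP[_ hK] := truncn_itv q0.
have := @convex_concentration_discrete m X b L F a a' K ((a' - a) / 2) b0 L0 mX iX Xb Fq FL.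
move=> /(_ _ _)/le_trans; apply.
- by rewrite divr_ge0 ?(ltW aa0).
- rewrite ltr_pdivrMr// -/K in hK.
  have : L * (Num.sqrt m%:R * (2 * b / K.+1%:R)) <= (a' - a) / 4.
    have -> : L * (Num.sqrt m%:R * (2 * b / K.+1%:R)) =
       (8 * (L * Num.sqrt m%:R * b)) / K.+1%:R / 4 by field; rewrite gt_eqF.
    by rewrite ler_pM2r// ler_pdivrMr// [leRHS]mulrC; exact: ltW.
  set x := L * _; lra.
rewrite le_eqVlt; apply/orP; left; apply/eqP; congr expR; field.
by rewrite !gt_eqF.
Qed.

(* The centre [c] is a point where the distribution function passes [expR (- u / 2)];
   no median is needed. *)
Lemma concentration_center (F : T -> R) (lo hi u s : R) :
  measurable_fun setT F -> (forall w, lo <= F w <= hi) -> 0 < u -> 0 < s ->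
  (forall a a', s <= a' - a ->
    pr P [set w | F w <= a] * pr P [set w | a' <= F w] <= expR (- u)) ->
  exists c, pr P [set w | 2 * s <= `|F w - c|] <= 2 * expR (- (u / 2)).
Proof.
move=> mF Fb u0 s0 H.
have mle a : measurable [set w | F w <= a].
  rewrite -[X in measurable X]setTI; have := mF measurableT `]-oo, a]%classic.
  by rewrite (_ : _ @^-1` _ = [set w | F w <= a])//; exact.
have mge a : measurable [set w | a <= F w].
  rewrite -[X in measurable X]setTI; have := mF measurableT `[a, +oo[%classic.
  rewrite (_ : _ @^-1` _ = [set w | a <= F w]); first exact.
  by apply/seteqP; split => t /=; rewrite in_itv/= ?andbT//.
pose e := expR (- (u / 2)).
have e0 : 0 < e by exact: expR_gt0.
have e1 : e < 1 by rewrite -expR0 ltr_expR oppr_lt0 divr_gt0.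
have ee : expR (- u) = e * e by rewrite -expRD; congr expR; lra.
pose S := [set a | pr P [set w | F w <= a] <= e].
have Slo : S (lo - 1).
  rewrite /S/= (_ : [set w | _] = set0) ?pr_set0 ?ltW//.
  apply/seteqP; split => // w /=; have /andP[? ?] := Fb w; lra.
have Shi a : S a -> a <= hi.
  rewrite /S/= => Sa; rewrite leNgt; apply/negP => ha.
  move: Sa; rewrite (_ : [set w | _] = setT) ?pr_setT ?leNgt ?e1//.
  apply/seteqP; split => // w _ /=; have /andP[? ?] := Fb w; lra.
have hS : has_sup S by split; [exists (lo - 1)|exists hi].
pose c := sup S; exists c.
have h1 : pr P [set w | F w <= c - s] <= e.
  have [a Sa ca] := sup_adherent s0 hS.
  by apply: le_trans Sa; apply: pr_le => // w /= /le_trans; apply; exact: ltW.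
have h2 : pr P [set w | c + 2 * s <= F w] <= e.
  have nS : ~ S (c + s).
    by move=> /(ub_le_sup hS.2); rewrite -/c gerDl leNgt s0.
  have {nS} : e < pr P [set w | F w <= c + s] by rewrite ltNge; apply/negP.
  set p := pr P _ => pe.
  have := H (c + s) (c + 2 * s) ltac:(lra); rewrite -/p ee => hh.
  set q := pr P _ in hh *.
  rewrite -(ler_pM2l e0); apply: le_trans hh.
  by apply: ler_wpM2r; [exact: pr_ge0|exact: ltW].
apply: (@le_trans _ _ (e + e)); last by rewrite mulr_natl mulr2n.
apply: le_trans (lerD h1 h2).
have mU : measurable ([set w | F w <= c - s] `|` [set w | c + 2 * s <= F w]).
  exact: measurableU.
apply: le_trans (pr_setU _ _ _) => //.
apply: pr_le => //.
  rewrite -[X in measurable X]setTI.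
  have mG : measurable_fun setT (fun w => `|F w - c|).
    by apply/measurableT_comp => //; apply: measurable_funB.
  have := mG measurableT `[2 * s, +oo[%classic.
  rewrite (_ : _ @^-1` _ = [set w | 2 * s <= `|F w - c|]); first exact.
  by apply/seteqP; split => t /=; rewrite in_itv/= ?andbT//.
move=> w /=; have [x0|x0] := leP 0 (F w - c).
  by rewrite ger0_norm// => ?; right; lra.
by rewrite ltr0_norm// => ?; left; lra.
Qed.

End Concentration.

(** * The clamped logarithm *)

Section LogClamp.
Variable R : realType.
Implicit Types eta K x : R.

Definition logclamp eta K x : R := ln (Num.min (Num.max `|x| eta) K).

Definition hinge eta x : R := Num.max 0 (`|x| / eta - 1).

(* [logclamp] is not convex; it is the constant [ln eta] plus the difference of the
   convex functions [hinge] and [logdef], both with Lipschitz constant [eta^-1]. *)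
Definition logdef eta K x : R := hinge eta x - (logclamp eta K x - ln eta).

Lemma hinge_conv_lip eta : 0 < eta -> conv_lip eta^-1 (hinge eta).
Proof.
move=> e0 x0; have [x0e|x0e] := leP `|x0| eta.
  exists 0; first by rewrite normr0 invr_ge0 ltW.
  move=> x; rewrite mul0r addr0 /hinge.
  have -> : Num.max 0 (`|x0| / eta - 1) = 0.
    by apply/max_idPl; rewrite subr_le0 ler_pdivrMr// mul1r.
  by rewrite le_max lexx.
exists (Num.sg x0 / eta).
  rewrite normrM normrV ?unitfE ?gt_eqF// (gtr0_norm e0) ler_piMl ?invr_ge0 ?(ltW e0)//.
  by rewrite normr_sg; case: (x0 != 0).
move=> x; rewrite /hinge.
have -> : Num.max 0 (`|x0| / eta - 1) = `|x0| / eta - 1.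
  by apply/max_idPr; rewrite subr_ge0 ler_pdivlMr// mul1r ltW.
rewrite le_max; apply/orP; right.
have -> : `|x0| / eta - 1 + Num.sg x0 / eta * (x - x0) = Num.sg x0 * x / eta - 1.
  by rewrite [in `|x0|]normrEsg; field; rewrite gt_eqF.
rewrite lerD2r ler_wpM2r ?invr_ge0 ?(ltW e0)//.
apply: (le_trans (ler_norm _)); rewrite normrM normr_sg.
by case: (x0 != 0); rewrite ?mul1r ?mul0r.
Qed.

Lemma logclampE_small eta K x : eta <= K -> `|x| <= eta -> logclamp eta K x = ln eta.
Proof. by move=> eK xe; rewrite /logclamp (max_idPr _)// (min_idPl _). Qed.

Lemma logclampE_mid eta K x : eta <= `|x| -> `|x| <= K -> logclamp eta K x = ln `|x|.
Proof. by move=> xe xK; rewrite /logclamp (max_idPl _)// (min_idPl _). Qed.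

Lemma logclampE_large eta K x : eta <= K -> K <= `|x| -> logclamp eta K x = ln K.
Proof.
by move=> eK xK; rewrite /logclamp (max_idPl _) ?(min_idPr _)//; exact: le_trans xK.
Qed.

Lemma ln_ratio (a b : R) : 0 < a -> 0 < b -> ln a - ln b <= a / b - 1.
Proof.
move=> a0 b0; rewrite -ln_div ?posrE//.
by apply: ln_le_subr1; rewrite divr_gt0.
Qed.

Lemma hinge_small eta x : 0 < eta -> `|x| <= eta -> hinge eta x = 0.
Proof. by move=> e0 xe; apply/max_idPl; rewrite subr_le0 ler_pdivrMr// mul1r. Qed.

Lemma hinge_large eta x : 0 < eta -> eta <= `|x| -> hinge eta x = `|x| / eta - 1.
Proof. by move=> e0 xe; apply/max_idPr; rewrite subr_ge0 ler_pdivlMr// mul1r. Qed.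

(** As a function of |x| the slope is 0 up to [eta], then 1/eta - 1/|x| up to [K], then 1/eta: it is
    nondecreasing, the kink of [logclamp] at [K] turning into an upward jump. The supporting line at
    [x0] uses this slope with the sign of [x0]; [slopex] reduces the inequality to absolute values
    and [ln_ratio] settles it. *)
Lemma logdef_conv_lip eta K : 0 < eta -> eta <= K -> conv_lip eta^-1 (logdef eta K).
Proof.
move=> e0 eK x0; have K0 : 0 < K by exact: lt_le_trans eK.
have small x : `|x| <= eta -> logdef eta K x = 0.
  by move=> xe; rewrite /logdef hinge_small// logclampE_small// subrr subr0.
have mid x : eta <= `|x| -> `|x| <= K ->
    logdef eta K x = `|x| / eta - 1 - ln `|x| + ln eta.
  by move=> xe xK; rewrite /logdef hinge_large// logclampE_mid//; lra.
have large x : K <= `|x| -> logdef eta K x = `|x| / eta - 1 - ln K + ln eta.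
  move=> xK; rewrite /logdef hinge_large//; last exact: le_trans xK.
  by rewrite logclampE_large//; lra.
(* Beyond [eta], [logclamp] is the smaller of [ln |x|] and [ln K], so both branch formulas are lower
   bounds of [logdef] there. *)
have geK x : eta <= `|x| -> `|x| / eta - 1 - ln K + ln eta <= logdef eta K x.
  move=> xe; have [xK|xK] := leP `|x| K; last by rewrite large// ltW.
  rewrite mid// lerD2r lerD2l lerN2 ler_ln ?posrE//; exact: lt_le_trans xe.
have gex x : eta <= `|x| -> `|x| / eta - 1 - ln `|x| + ln eta <= logdef eta K x.
  move=> xe; have [xK|xK] := leP `|x| K; first by rewrite mid.
  rewrite large ?(ltW xK)// lerD2r lerD2l lerN2 ler_ln ?posrE// ?(ltW xK)//.
  exact: lt_le_trans xe.
have ei0 : 0 <= eta^-1 by rewrite invr_ge0 ltW.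
have slope a : 0 <= a -> a <= eta^-1 -> `|Num.sg x0 * a| <= eta^-1.
  move=> a0 ae; rewrite normrM normr_sg (ger0_norm a0).
  by case: (x0 != 0); rewrite ?mul1r ?mul0r.
have slopex a x : 0 <= a -> Num.sg x0 * a * (x - x0) <= a * (`|x| - `|x0|).
  move=> a0; rewrite mulrAC [leLHS]mulrC ler_wpM2l// mulrBr -normrEsg lerD2r.
  apply: (le_trans (ler_norm _)); rewrite normrM normr_sg.
  by case: (x0 != 0); rewrite ?mul1r ?mul0r.
have [x0e|x0e] := leP `|x0| eta.
  exists 0; first by rewrite normr0.
  move=> x; rewrite mul0r addr0 small//.
  have [xe|xe] := leP `|x| eta; first by rewrite small.
  apply: le_trans (gex _ (ltW xe)).
  have := @ln_ratio `|x| eta (lt_trans e0 xe) e0; lra.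
have p0 : 0 < `|x0| by exact: lt_trans x0e.
have ie : `|x0| / `|x0| = 1 by rewrite divff ?gt_eqF.
have ee : eta / eta = 1 by rewrite divff ?gt_eqF.
have [x0K|x0K] := leP `|x0| K.
  have a0 : 0 <= eta^-1 - `|x0|^-1 by rewrite subr_ge0 lef_pV2 ?posrE// ltW.
  have a1 : eta^-1 - `|x0|^-1 <= eta^-1 by rewrite gerBl invr_ge0.
  exists (Num.sg x0 * (eta^-1 - `|x0|^-1)); first exact: slope.
  move=> x; have := slopex _ x a0; rewrite (mid x0) ?(ltW x0e)//.
  set s := _ * (x - x0).
  have [xe|xe] := leP `|x| eta.
    rewrite (small x)//.
    have : (eta^-1 - `|x0|^-1) * (`|x| - `|x0|) <= (eta^-1 - `|x0|^-1) * (eta - `|x0|).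
      by rewrite ler_wpM2l// lerD2r.
    have := @ln_ratio eta `|x0| e0 p0; nra.
  have := gex _ (ltW xe).
  have := @ln_ratio `|x| `|x0| (lt_trans e0 xe) p0; nra.
exists (Num.sg x0 * eta^-1); first exact: slope.
move=> x; have := slopex _ x ei0; rewrite (large x0) ?(ltW x0K)//.
set s := _ * (x - x0).
have [xe|xe] := leP `|x| eta.
  rewrite (small x)//.
  have : ln eta <= ln K by rewrite ler_ln ?posrE.
  have : eta^-1 * `|x| <= eta^-1 * eta by rewrite ler_wpM2l.
  nra.
have := geK _ (ltW xe); nra.
Qed.

Lemma logclamp_decomp eta K x : logclamp eta K x = ln eta + hinge eta x - logdef eta K x.
Proof. rewrite /logdef; ring. Qed.

End LogClamp.

(** * Linear statistics as quasiconvex Lipschitz functions of the vector *)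

Section MatrixModel.
Context (R : realType) (m n : nat) (Phi : 'rV[R]_m -> 'M[R]_n).
Hypothesis Phi_sym : forall x, (Phi x)^T = Phi x.
Hypothesis Phi_lip : (lip_norm2 Phi < +oo)%E.
Hypothesis Phi_conv : forall A : set 'M[R]_n, (forall T, A T -> T^T = T) ->
  @convex_set R 'M[R]_n A -> @convex_set R 'rV[R]_m (Phi @^-1` A).
Hypothesis m_gt0 : (0 < m)%N.

Let Lam := fine (lip_norm2 Phi).

Lemma norm2_eq0 (x : 'rV[R]_m) : norm2 x = 0 -> x = 0.
Proof.
move=> /eqP; rewrite sqrtr_eq0 => h.
have h0 k : x ord0 k ^+ 2 = 0.
  apply/eqP; rewrite eq_le sqr_ge0 andbT.
  apply: le_trans h; rewrite (bigD1 k)//= lerDl.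
  by apply: sumr_ge0 => j _; exact: sqr_ge0.
apply/rowP => k; rewrite mxE; have /eqP := h0 k.
by rewrite sqrf_eq0 => /eqP.
Qed.

(** The supremum ranges over pairs of distinct points; [m_gt0] supplies one, in dimension 0 the
    value would be -oo. *)
Lemma lip_norm2_ge0 : (0 <= lip_norm2 Phi)%E.
Proof.
pose x : 'rV[R]_m := const_mx 1.
have x0 : x != 0.
  apply/eqP => /rowP /(_ (Ordinal m_gt0)); rewrite !mxE => /eqP.
  by rewrite oner_eq0.
apply: (@le_trans _ _ (normFt (Phi x - Phi 0) / norm2 (x - 0))%:E).
  by rewrite lee_fin divr_ge0 ?normFt_ge0 ?norm2_ge0.
by apply: ereal_sup_ubound; exists (x, 0).
Qed.

Lemma lip_norm2_fin : lip_norm2 Phi = Lam%:E.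
Proof. by rewrite fineK// ge0_fin_numE// lip_norm2_ge0. Qed.

Lemma Lam_ge0 : 0 <= Lam.
Proof. by rewrite -lee_fin -lip_norm2_fin lip_norm2_ge0. Qed.

Lemma Phi_lipschitz x y : normFt (Phi x - Phi y) <= Lam * norm2 (x - y).
Proof.
have [->|xy] := eqVneq x y.
  rewrite subrr; have -> : normFt (0 : 'M[R]_n) = 0.
    rewrite /normFt big1 ?sqrtr0// => i _; rewrite big1// => j _.
    by rewrite mxE expr0n.
  by rewrite mulr_ge0 ?Lam_ge0 ?norm2_ge0.
have n0 : 0 < norm2 (x - y).
  rewrite lt_def norm2_ge0 andbT; apply/eqP => /norm2_eq0/eqP.
  by rewrite subr_eq0 (negbTE xy).
rewrite -ler_pdivrMr// -lee_fin -lip_norm2_fin.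
by apply: ereal_sup_ubound; exists (x, y).
Qed.

Lemma convex_comb_le (a b e t : R) : 0 <= t <= 1 -> a <= e -> b <= e ->
  (1 - t) * a + t * b <= e.
Proof. by move=> /andP[? ?] ? ?; nra. Qed.

(** The sublevel set of [trace_fun f] within the symmetric matrices is convex by [trace_fun_convex],
    so its preimage under [Phi] is convex. *)
Lemma trace_quasiconvex L f e x y t : conv_lip L f ->
  trace_fun f (Phi x) <= e -> trace_fun f (Phi y) <= e -> 0 <= t <= 1 ->
  trace_fun f (Phi ((1 - t) *: x + t *: y)) <= e.
Proof.
move=> cf xe ye /andP[t0 t1].
pose A : set 'M[R]_n := [set T | T^T = T /\ trace_fun f T <= e].
have convA : @convex_set R 'M[R]_n A.
  move=> T0 T1 a /set_mem[s0 h0] /set_mem[s1 h1]; apply/mem_set.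
  have a01 : 0 <= (1 - a%:num : R) <= 1.
    by rewrite subr_ge0 gerBl; apply/andP; split; [exact: le1|exact: ge0].
  have -> : conv a T0 T1 = (1 - (1 - a%:num)) *: T0 + (1 - a%:num) *: T1.
    by rewrite /conv/= subKr.
  split; first by rewrite linearD !linearZ/= s0 s1.
  apply: (le_trans (trace_fun_convex s0 s1 cf a01)).
  exact: convex_comb_le.
(* [conv] puts the weight [t] on its first argument, hence [y] before [x]. *)
have := @Phi_conv A (fun T => @proj1 _ _) convA y x (Itv01 t0 t1)
  (mem_set (conj (Phi_sym y) ye)) (mem_set (conj (Phi_sym x) xe)).
move=> /set_mem[_].
by congr (trace_fun f (Phi _) <= e); rewrite /conv/= addrC.
Qed.

Lemma trace_lipschitz L f x y : 0 <= L -> conv_lip L f ->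
  `|trace_fun f (Phi x) - trace_fun f (Phi y)| <=
    L * Num.sqrt (2 * n%:R) * Lam * norm2 (x - y).
Proof.
move=> L0 cf.
have h x' y' : trace_fun f (Phi x') - trace_fun f (Phi y') <=
    L * Num.sqrt (2 * n%:R) * Lam * norm2 (x' - y').
  apply: (le_trans (trace_fun_lip L0 (Phi_sym _) (Phi_sym _) cf)).
  rewrite -!mulrA ler_wpM2l// ler_wpM2l ?sqrtr_ge0//; exact: Phi_lipschitz.
rewrite ler_norml; apply/andP; split; last exact: h.
rewrite lerNl opprB.
have -> : norm2 (x - y) = norm2 (y - x); last exact: h.
congr Num.sqrt; apply: eq_bigr => k _; rewrite !mxE; ring.
Qed.

End MatrixModel.

(** * Measurability of the eigenvalues *)

Section MeasurableEigenvalues.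
Context (R : realType) d (T : measurableType d).

Lemma measurable_funP_gt (f : T -> R) :
  (forall x, measurable [set w | x < f w]) -> measurable_fun setT f.
Proof.
move=> h; apply: (measurability _ (RGenOInfty.measurableE R)) => //.
move=> _ [_ [x ->] <-]; rewrite setTI.
rewrite (_ : _ @^-1` _ = [set w | x < f w])//.
by apply/seteqP; split => w /=; rewrite in_itv/= andbT.
Qed.

Lemma measurable_gt (f : T -> R) x : measurable_fun setT f -> measurable [set w | x < f w].
Proof.
move=> mf; rewrite -[X in measurable X]setTI; have := mf measurableT `]x, +oo[%classic.
rewrite (_ : _ @^-1` _ = [set w | x < f w]); first exact.
by apply/seteqP; split => w /=; rewrite in_itv/= andbT.
Qed.

Lemma measurable_ge (f : T -> R) x : measurable_fun setT f -> measurable [set w | x <= f w].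
Proof.
move=> mf; rewrite -[X in measurable X]setTI; have := mf measurableT `[x, +oo[%classic.
rewrite (_ : _ @^-1` _ = [set w | x <= f w]); first exact.
by apply/seteqP; split => w /=; rewrite in_itv/= andbT.
Qed.

Definition pospart (x y : R) : R := Num.max 0 (y - x).

Lemma pospart_conv_lip x : conv_lip 1 (pospart x).
Proof.
move=> y0; have [h|h] := leP y0 x.
  exists 0 => [|y]; first by rewrite normr0.
  rewrite mul0r addr0 /pospart (max_idPl _) ?subr_le0//.
  by rewrite le_max lexx.
exists 1 => [|y]; first by rewrite normr1.
rewrite /pospart (max_idPr _) ?subr_ge0 ?(ltW h)// mul1r.
by rewrite le_max; apply/orP; right; lra.
Qed.

Lemma tnth_sorted_le n (s : n.-tuple R) (j k : 'I_n) : sorted <=%R s -> (j <= k)%N ->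
  tnth s j <= tnth s k.
Proof.
move=> ss jk; rewrite !(tnth_nth 0).
by apply: (sorted_leq_nth le_trans le_refl 0 ss); rewrite ?inE ?size_tuple.
Qed.

Lemma sum_ord_geq (n j : nat) : (\sum_(i < n | (j <= i)%N) 1 = n - j)%N.
Proof.
rewrite -(big_mkord (fun i => (j <= i)%N) (fun=> 1%N)).
rewrite -[RHS]muln1 -sum_nat_const_nat; apply/esym.
by have := big_nat_widenl j 0 n xpredT (fun=> 1%N) (leq0n j).
Qed.

(** Convex Lipschitz statistics are measurable; the rescaled difference [D N] of two of them sums
    ramps [h N] that increase to the indicator of y > x. In the sorted list the entry of index j
    exceeds x exactly when at least n - j entries do, that is, when some [D N] exceeds n - j - 1. *)
Lemma measurable_eigenvalue n (Hm : T -> 'M[R]_n) : (forall w, (Hm w)^T = Hm w) ->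
  (forall x, measurable_fun setT (fun w => trace_fun (pospart x) (Hm w))) ->
  forall j, measurable_fun setT (fun w => tnth (eigenvalues (Hm w)) j).
Proof.
move=> Hs mG j; apply: measurable_funP_gt => x.
pose D N w := N.+1%:R * (trace_fun (pospart x) (Hm w) -
   trace_fun (pospart (x + N.+1%:R^-1)) (Hm w)).
pose h N (y : R) := N.+1%:R * (pospart x y - pospart (x + N.+1%:R^-1) y).
have DE N w : D N w = \sum_(k < n) h N (tnth (eigenvalues (Hm w)) k).
  by rewrite /D /trace_fun -sumrB mulr_sumr.
have N0 N : 0 < N.+1%:R :> R by rewrite ltr0n.
have Ni N : 0 < N.+1%:R^-1 :> R by rewrite invr_gt0.
have NN N : N.+1%:R * N.+1%:R^-1 = 1 :> R by rewrite divff// gt_eqF.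
have h0 N y : y <= x -> h N y = 0.
  move=> yx; rewrite /h /pospart !(max_idPl _) ?subr_le0 ?subrr ?mulr0//.
  by apply: (le_trans yx); rewrite lerDl ltW.
have h1 N y : x + N.+1%:R^-1 <= y -> h N y = 1.
  move=> yx; have xy : x <= y by apply: le_trans yx; rewrite lerDl ltW.
  rewrite /h /pospart !(max_idPr _) ?subr_ge0//.
  have -> : y - x - (y - (x + N.+1%:R^-1)) = N.+1%:R^-1 by ring.
  exact: NN.
have h01 N y : 0 <= h N y <= 1.
  have [yx|yx] := leP y x; first by rewrite h0// lexx ler01.
  have [yx'|yx'] := leP (x + N.+1%:R^-1) y; first by rewrite h1// ler01 lexx.
  rewrite /h /pospart (max_idPr _) ?subr_ge0 ?(ltW yx)//.
  rewrite (max_idPl _) ?subr_le0 ?(ltW yx')// subr0.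
  apply/andP; split; first by rewrite mulr_ge0// subr_ge0 ltW.
  by rewrite -[leRHS](NN N) ler_pM2l// lerBlDl ltW.
have -> : [set w | x < tnth (eigenvalues (Hm w)) j] =
    \bigcup_N [set w | n%:R - j%:R - 1 < D N w].
  apply/seteqP; split => w /=.
    move=> xl; set lj := tnth _ _ in xl.
    have lx : 0 < lj - x by rewrite subr_gt0.
    exists (Num.truncn ((lj - x)^-1)) => //=.
    have := truncn_itv (_ : 0 <= (lj - x)^-1); rewrite invr_ge0 ltW// => /(_ isT) /andP[_].
    set N := Num.truncn _ => hN.
    have xN : x + N.+1%:R^-1 <= lj.
      rewrite -lerBrDl -[leRHS]invrK lef_pV2 ?posrE ?invr_gt0//; exact: ltW.
    rewrite DE (bigID (fun k : 'I_n => (j <= k)%N))/=.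
    apply: (@lt_le_trans _ _ (n%:R - j%:R)); first by rewrite ltrBlDr ltrDl.
    rewrite -[leLHS]addr0; apply: lerD; last first.
      by apply: sumr_ge0 => k _; have /andP[] := h01 N (tnth (eigenvalues (Hm w)) k).
    rewrite (eq_bigr (fun=> 1%:R)); last first.
      move=> k jk; apply: h1; apply: (le_trans xN).
      apply: tnth_sorted_le => //; exact: eigenvalues_sorted.
    rewrite -natrB ?(ltnW (ltn_ord j))// -natr_sum ler_nat.
    by rewrite sum_ord_geq.
  move=> [N _] /=; rewrite DE ltNge => hN; rewrite ltNge; apply: contra hN => jx.
  rewrite (bigID (fun k : 'I_n => (k <= j)%N))/= big1 ?add0r; last first.
    move=> k kj; apply: h0; apply: le_trans jx.
    apply: tnth_sorted_le => //; exact: eigenvalues_sorted.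
  apply: (@le_trans _ _ (\sum_(i < n | ~~ (i <= j)%N) 1%:R)).
    by apply: ler_sum => k _; have /andP[] := h01 N (tnth (eigenvalues (Hm w)) k).
  have -> : n%:R - j%:R - 1 = (n - j.+1)%:R :> R.
    by rewrite natrB// -natr1; ring.
  rewrite -natr_sum ler_nat.
  under eq_bigl do rewrite -ltnNge.
  by rewrite sum_ord_geq.
apply: bigcupT_measurable => N; apply: measurable_gt.
by apply: measurable_funM => //; apply: measurable_funB.
Qed.

End MeasurableEigenvalues.

(** * Truncation of the coordinates and concentration of linear statistics *)

Section CutVector.
Context (R : realType) d (T : measurableType d) (P : probability T R).

Definition cut1 (t : \bar R) (x : R) : R := if (`|x|%:E < t)%E then x else 0.

Lemma measurable_cut1 t : measurable_fun setT (cut1 t).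
Proof.
case: t => [t| |].
- rewrite /cut1; apply: measurable_fun_ifT => //.
  under eq_fun do rewrite lte_fin.
  exact: measurable_fun_ltr.
- rewrite (_ : cut1 _ = id)//; apply/funext => x.
  by rewrite /cut1 ltry.
- by rewrite (_ : cut1 _ = cst 0)//; apply/funext => x; rewrite /cut1 ltNge leNye.
Qed.

Lemma cut_vectorE t m (X : 'I_m -> T -> R) w :
  cut_vector t (\row_k X k w) = \row_k (cut1 t (X k w)).
Proof. by apply/rowP => k; rewrite !mxE. Qed.

Lemma independent_comp m (X : 'I_m -> T -> R) (g : R -> R) : measurable_fun setT g ->
  independent_RVs P X -> independent_RVs P (fun k w => g (X k w)).
Proof.
move=> mg iX J B mB; apply: (iX J (fun k => g @^-1` B k)) => k.
by rewrite -[X in measurable X]setTI; exact: mg.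
Qed.

End CutVector.

Section TraceConcentration.
Context (R : realType) d (T : measurableType d) (P : probability T R).
Context (m n : nat) (Phi : 'rV[R]_m -> 'M[R]_n).
Hypothesis Phi_sym : forall x, (Phi x)^T = Phi x.
Hypothesis Phi_lip : (lip_norm2 Phi < +oo)%E.
Hypothesis Phi_conv : forall A : set 'M[R]_n, (forall T, A T -> T^T = T) ->
  @convex_set R 'M[R]_n A -> @convex_set R 'rV[R]_m (Phi @^-1` A).
Hypothesis m_gt0 : (0 < m)%N.
Hypothesis n_gt0 : (0 < n)%N.
Variable X : 'I_m -> T -> R.
Hypothesis mX : forall k, measurable_fun setT (X k).
Hypothesis iX : independent_RVs P X.

Lemma measurable_trace_fun (Y : 'I_m -> T -> R) L f : 0 <= L -> conv_lip L f ->
  (forall k, measurable_fun setT (Y k)) ->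
  measurable_fun setT (fun w => trace_fun f (Phi (\row_k Y k w))).
Proof.
move=> L0 cf mY.
have K0 : 0 <= L * Num.sqrt (2 * n%:R) * fine (lip_norm2 Phi).
  by rewrite !mulr_ge0// ?sqrtr_ge0// Lam_ge0.
apply: (measurable_lipschitz (G := fun x => trace_fun f (Phi x)) K0 mY) => x y.
exact: (trace_lipschitz Phi_sym Phi_lip m_gt0 x y L0 cf).
Qed.

Lemma measurable_model_eigenvalue (Y : 'I_m -> T -> R) :
  (forall k, measurable_fun setT (Y k)) ->
  forall j, measurable_fun setT (fun w => tnth (eigenvalues (Phi (\row_k Y k w))) j).
Proof.
move=> mY; apply: measurable_eigenvalue => // x.
exact: (measurable_trace_fun ler01 (pospart_conv_lip x) mY).
Qed.

(** Truncated coordinates are bounded by b = r / Lam and the statistic has Lipschitz constant L =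
    eta^(-1) sqrt(2n) Lam, so Lam cancels: (bL)^2 = 2 n r^2 / eta^2. The exponent s^2 / (144 (bL)^2)
    is required to be at least 2u, because [concentration_center] halves it; 576 is 144 times 2
    times 2. *)
Lemma trace_concentration (r eta s u : R) f : 0 < r -> 0 < eta -> 0 < s -> 0 < u ->
  u * (576 * n%:R * r ^+ 2) <= s ^+ 2 * eta ^+ 2 -> conv_lip eta^-1 f ->
  exists c, pr P [set w | 2 * s <=
    `|trace_fun f (Phi (\row_k cut1 (r%:E / lip_norm2 Phi) (X k w))) - c|]
   <= 2 * expR (- u).
Proof.
move=> r0 e0 s0 u0 hu cf.
set t := (r%:E / _)%E.
pose Y k w := cut1 t (X k w).
have ei0 : 0 <= eta^-1 by rewrite invr_ge0 ltW.
have := Lam_ge0 Phi_lip m_gt0; set Lam := fine _ => Lam0.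
pose F x := trace_fun f (Phi x).
have FL x y : `|F x - F y| <= eta^-1 * Num.sqrt (2 * n%:R) * Lam * norm2 (x - y).
  exact: (trace_lipschitz Phi_sym Phi_lip m_gt0 x y ei0 cf).
have n0 : 0 < n%:R :> R by rewrite ltr0n.
(* Here the threshold is +oo and the coordinates may be unbounded, but the statistic is constant. *)
have [L0|L0] := eqVneq Lam 0.
  exists (F 0).
  rewrite (_ : [set w | _] = set0) ?pr_set0; first by rewrite mulr_ge0// expR_ge0.
  apply/seteqP; split => // w /=; rewrite leNgt => /negP; apply.
  apply: le_lt_trans (FL _ _) _; rewrite L0 mulr0 mul0r; lra.
have {}Lam0 : 0 < Lam by rewrite lt_def L0.
pose b := r / Lam.
have b0 : 0 < b by rewrite divr_gt0.
have tE : t = b%:E by rewrite /t (lip_norm2_fin Phi_lip m_gt0) -/Lam inver (negbTE L0).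
have Yb k w : `|Y k w| <= b.
  rewrite /Y /cut1 tE; case: ifPn; last by rewrite normr0 ltW.
  by rewrite lte_fin => /ltW.
have mY k : measurable_fun setT (Y k).
  by apply: measurableT_comp => //; exact: measurable_cut1.
have iY : independent_RVs P Y by apply: independent_comp => //; exact: measurable_cut1.
pose L := eta^-1 * Num.sqrt (2 * n%:R) * Lam.
have Lp : 0 < L by rewrite !mulr_gt0 ?invr_gt0 ?sqrtr_gt0 ?mulr_gt0.
have mF : measurable_fun setT (fun w => F (\row_k Y k w)).
  exact: (measurable_trace_fun ei0 cf mY).
pose B := L * (Num.sqrt m%:R * b).
have FB w : F 0 - B <= F (\row_k Y k w) <= F 0 + B.
  have : `|F (\row_k Y k w) - F 0| <= B.
    apply: (le_trans (FL _ _)); rewrite /B ler_pM2l//; apply: norm2_le; first exact: ltW.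
    by move=> k; rewrite subr0 mxE.
  by rewrite ler_distl.
have bL : (b * L) ^+ 2 = r ^+ 2 * (2 * n%:R) / eta ^+ 2.
  have -> : b * L = r * (Num.sqrt (2 * n%:R) / eta) by rewrite /b /L; field; rewrite L0 gt_eqF.
  rewrite exprMn expr_div_n sqr_sqrtr; last by apply: mulr_ge0 => //; exact: ltW.
  exact: mulrA.
have bL0 : 0 < (b * L) ^+ 2 by rewrite exprn_gt0// mulr_gt0.
have u20 : 0 < 2 * u by rewrite mulr_gt0.
have -> : u = 2 * u / 2 by rewrite mulrAC divff ?mul1r// pnatr_eq0.
apply: (concentration_center mF FB u20 s0) => a a' saa.
have aa' : a < a' by apply: lt_le_trans (_ : a + s <= _); lra.
apply: le_trans (convex_concentration b0 Lp mY iY Yb _ FL aa') _.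
  by move=> e x y t' xe ye t01; exact: (trace_quasiconvex Phi_sym Phi_conv cf xe ye t01).
rewrite ler_expR lerN2.
have q0 : 0 < 144 * (b * L) ^+ 2 by apply: mulr_gt0 => //; exact: ltr0n.
rewrite ler_pdivlMr//; apply: (@le_trans _ _ (s ^+ 2)); last first.
  by rewrite ler_sqr ?nnegrE; [|exact: ltW|apply: ltW; rewrite subr_gt0].
have ee0 : 0 < eta ^+ 2 by rewrite exprn_gt0.
rewrite -(ler_pM2r ee0); apply: le_trans hu.
by rewrite bL le_eqVlt; apply/orP; left; apply/eqP; field; rewrite gt_eqF.
Qed.

End TraceConcentration.

(** * Linear statistics and the distances of spectral measures *)

Section Kolmogorov.
Variable R : realType.

Definition countle n (s : n.-tuple R) (x : R) : R := \sum_(j < n) (tnth s j <= x)%R%:R.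

(** All but [D] terms on each side are matched by the shift; the unmatched ones differ by at most
    [hi - lo] each. *)
Lemma sum_shift_le (u v : nat -> R) (lo hi : R) (n D : nat) :
  (forall k, lo <= u k <= hi) -> (forall k, lo <= v k <= hi) ->
  (forall k, (k + D < n)%N -> u k <= v (k + D)%N) ->
  \sum_(0 <= k < n) u k <= \sum_(0 <= k < n) v k + D%:R * (hi - lo).
Proof.
move=> ub vb uv; have [nD|Dn] := leqP n D.
  have h1 : \sum_(0 <= k < n) u k <= \sum_(0 <= k < n) hi.
    by apply: ler_sum => k _; have /andP[] := ub k.
  have h2 : \sum_(0 <= k < n) lo <= \sum_(0 <= k < n) v k.
    by apply: ler_sum => k _; have /andP[] := vb k.
  rewrite sumr_const_nat subn0 -[hi *+ n]mulr_natl in h1; rewrite sumr_const_nat subn0 -[lo *+ n]mulr_natl in h2.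
  have : n%:R * (hi - lo) <= D%:R * (hi - lo).
    apply: ler_wpM2r; last by rewrite ler_nat.
    by have /andP[? ?] := ub 0%N; rewrite subr_ge0; apply: le_trans (_ : u 0%N <= _).
  lra.
have sD : (n - D <= n)%N by exact: leq_subr.
rewrite (@big_cat_nat _ _ _ (n - D) 0 n)//= [X in _ <= X + _](@big_cat_nat _ _ _ D 0 n)//=; last exact: ltnW.
have h1 : \sum_(0 <= k < n - D) u k <= \sum_(D <= k < n) v k.
  rewrite -{2}(add0n D) big_addn; apply: ler_sum_nat => k /andP[_ kn].
  by apply: uv; rewrite addnC -ltn_subRL.
have h2 : \sum_(n - D <= k < n) u k <= D%:R * hi.
  apply: (@le_trans _ _ (\sum_(n - D <= k < n) hi)).
    by apply: ler_sum => k _; have /andP[] := ub k.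
  by rewrite sumr_const_nat subKn ?(ltnW Dn)// mulr_natl.
have h3 : D%:R * lo <= \sum_(0 <= k < D) v k.
  apply: (@le_trans _ _ (\sum_(0 <= k < D) lo)).
    by rewrite sumr_const_nat subn0 mulr_natl.
  by apply: ler_sum => k _; have /andP[] := vb k.
lra.
Qed.

Lemma sum_shift_ge (u v : nat -> R) (lo hi : R) (n D : nat) :
  (forall k, lo <= u k <= hi) -> (forall k, lo <= v k <= hi) ->
  (forall k, (k + D < n)%N -> u (k + D)%N <= v k) ->
  \sum_(0 <= k < n) u k <= \sum_(0 <= k < n) v k + D%:R * (hi - lo).
Proof.
move=> ub vb uv.
have : \sum_(0 <= k < n) - v k <= \sum_(0 <= k < n) - u k + D%:R * (- lo - - hi).
  apply: (@sum_shift_le (fun k => - v k) (fun k => - u k)) => k.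
  - by rewrite !lerN2 andbC.
  - by rewrite !lerN2 andbC.
  - by move=> kn; rewrite lerN2; exact: uv.
rewrite !sumrN; set p := \sum_(_ <= _ < _) _; set q := \sum_(_ <= _ < _) _; lra.
Qed.

Lemma countle_nat n (s : n.-tuple R) x :
  countle s x = (\sum_(j < n) nat_of_bool (tnth s j <= x)%R)%N%:R.
Proof. by rewrite /countle natr_sum. Qed.

Lemma countle_ge n (s : n.-tuple R) (k : 'I_n) : sorted <=%R s ->
  k.+1%:R <= countle s (tnth s k).
Proof.
move=> ss; rewrite countle_nat ler_nat (bigID (fun j : 'I_n => (j <= k)%N))/=.
apply: leq_trans (leq_addr _ _).
rewrite (eq_bigr (fun=> 1%N)); last by move=> j jk; rewrite tnth_sorted_le.
have -> : (\sum_(j < n | (j <= k)%N) 1 = k.+1)%N; last by [].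
rewrite (eq_bigl (fun j : 'I_n => (j < k.+1)%N)) => [|j]; last by rewrite ltnS.
by rewrite (big_ord_narrow (ltn_ord k)) sum_nat_const card_ord muln1.
Qed.

Lemma countle_lt n (s : n.-tuple R) (k : 'I_n) x : sorted <=%R s ->
  x < tnth s k -> countle s x <= k%:R.
Proof.
move=> ss xk; rewrite countle_nat ler_nat.
apply: (@leq_trans (\sum_(j < n) if (j < k)%N then 1 else 0)%N).
  apply: leq_sum => j _; case: ltnP => jk; first by case: (_ <= _).
  rewrite leqn0 eqb0 -ltNge; apply: (lt_le_trans xk); exact: tnth_sorted_le.
rewrite -big_mkcond/= (big_ord_narrow (ltnW (ltn_ord k))).
by rewrite sum_nat_const card_ord muln1.
Qed.

(** At the point [tnth b j] the list [b] already counts j + 1 entries, while [a] counts at most i of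
    them if [tnth a i] lies further right; with j = i + D the counts would differ by more than D. *)
Lemma countle_shift n (a b : n.-tuple R) (D : nat) (i j : 'I_n) :
  sorted <=%R a -> sorted <=%R b ->
  (forall x, countle b x <= countle a x + D%:R) -> (j = i + D :> nat)%N ->
  tnth a i <= tnth b j.
Proof.
move=> sa sb ab ij; rewrite leNgt; apply/negP => lt.
have h1 := countle_lt sa lt; have h2 := countle_ge j sb; have h3 := ab (tnth b j).
have : j.+1%:R <= (i + D)%:R :> R by rewrite natrD; lra.
by rewrite ler_nat ij ltnn.
Qed.

Lemma sum_tnth_nat n (s : n.-tuple R) (h : R -> R) :
  \sum_(j < n) h (tnth s j) = \sum_(0 <= k < n) h (nth 0 s k).
Proof.
by rewrite big_mkord; apply: eq_bigr => j _; rewrite (tnth_nth 0).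
Qed.

(** Order statistics are comparable after a shift by [D], so a monotone function loses at most [D]
    times its range. This is the discrete form of integration by parts against a Kolmogorov
    distance. *)
Lemma monotone_sum_le n (a b : n.-tuple R) (h : R -> R) (lo hi : R) (D : nat) :
  sorted <=%R a -> sorted <=%R b ->
  (forall x, `|countle a x - countle b x| <= D%:R) ->
  (forall x, lo <= h x <= hi) ->
  {homo h : x y / x <= y} \/ {homo h : x y /~ x <= y} ->
  \sum_(j < n) h (tnth a j) <= \sum_(j < n) h (tnth b j) + D%:R * (hi - lo).
Proof.
move=> sa sb ab hb hm; rewrite !sum_tnth_nat.
have nthE (s : n.-tuple R) k (kn : (k < n)%N) : nth 0 s k = tnth s (Ordinal kn).
  by rewrite (tnth_nth 0).
have ab1 x : countle b x <= countle a x + D%:R.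
  by have := ab x; rewrite ler_norml => /andP[? ?]; lra.
have ab2 x : countle a x <= countle b x + D%:R.
  by have := ab x; rewrite ler_norml => /andP[? ?]; lra.
case: hm => hm.
  apply: (@sum_shift_le (fun k => h (nth 0 a k)) (fun k => h (nth 0 b k))) => // k kD.
  apply: hm; have kn : (k < n)%N by apply: leq_ltn_trans kD; exact: leq_addr.
  by rewrite (nthE _ _ kn) (nthE _ _ kD); apply: countle_shift ab1 _.
apply: (@sum_shift_ge (fun k => h (nth 0 a k)) (fun k => h (nth 0 b k))) => // k kD.
apply: hm; have kn : (k < n)%N by apply: leq_ltn_trans kD; exact: leq_addr.
by rewrite (nthE _ _ kn) (nthE _ _ kD); apply: countle_shift ab2 _.
Qed.

Lemma logclamp_le (eta K x y : R) : 0 < eta -> eta <= K -> `|x| <= `|y| ->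
  logclamp eta K x <= logclamp eta K y.
Proof.
move=> e0 eK xy; rewrite /logclamp.
have K0 : 0 < K by exact: lt_le_trans eK.
rewrite ler_ln ?posrE ?lt_min ?K0 ?andbT ?lt_max ?e0 ?orbT//.
rewrite le_min; apply/andP; split; rewrite ge_min; apply/orP; [left|right]; last exact: lexx.
by rewrite ge_max !le_max xy lexx orbT.
Qed.

Lemma logclamp_bounds (eta K x : R) : 0 < eta -> eta <= K ->
  ln eta <= logclamp eta K x <= ln K.
Proof.
move=> e0 eK; have K0 : 0 < K by exact: lt_le_trans eK.
rewrite /logclamp !ler_ln ?posrE ?lt_min ?K0 ?andbT ?lt_max ?e0 ?orbT//.
by rewrite le_min le_max lexx orbT eK ge_min lexx orbT.
Qed.

(** [logclamp] decreases on the negative half-line and increases on the positive one. Each monotone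
    piece [h1], [h2] has values between [ln eta] and [ln K], whence the factor 2. *)
Lemma logclamp_sum_close n (a b : n.-tuple R) (eta K D : R) :
  0 < eta -> eta <= K -> sorted <=%R a -> sorted <=%R b ->
  (forall x, `|countle a x - countle b x| <= D) ->
  \sum_(j < n) logclamp eta K (tnth a j) <=
    \sum_(j < n) logclamp eta K (tnth b j) + 2 * D * (ln K - ln eta).
Proof.
move=> e0 eK sa sb abD; have K0 : 0 < K by exact: lt_le_trans eK.
(* Counting functions are integer-valued, so their distance may be rounded down to an index
   shift. *)
pose D0 := Num.truncn D.
have Dp : 0 <= D by exact: le_trans (abD 0).
have /andP[D0D DD0] := truncn_itv Dp.
have ab x : `|countle a x - countle b x| <= D0%:R.
  have : `|countle a x - countle b x| < D0.+1%:R by apply: le_lt_trans DD0; exact: abD.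
  rewrite !countle_nat; set p := (\sum_(j < n) _)%N; set q := (\sum_(j < n) _)%N.
  have -> : `|p%:R - q%:R| = (maxn (p - q) (q - p))%:R :> R.
    have [pq|pq] := leqP p q.
      rewrite (_ : (p - q = 0)%N); last by apply/eqP; rewrite subn_eq0.
      by rewrite max0n distrC natrB// ger0_norm// subr_ge0 ler_nat.
    rewrite (_ : (q - p = 0)%N); last by apply/eqP; rewrite subn_eq0 ltnW.
    by rewrite maxn0 natrB ?(ltnW pq)// ger0_norm// subr_ge0 ler_nat ltnW.
  by rewrite ltr_nat ltnS ler_nat.
pose h1 x := logclamp eta K (Num.max x 0).
pose h2 x := logclamp eta K (Num.min x 0).
have hE x : logclamp eta K x = h1 x + h2 x - ln eta.
  rewrite /h1 /h2; have l0 : logclamp eta K 0 = ln eta.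
    by apply: logclampE_small => //; rewrite normr0 ltW.
  have [x0|x0] := leP 0 x; first by rewrite l0 addrK.
  by rewrite l0 addrAC subrr add0r.
have m1 : {homo h1 : x y / x <= y}.
  move=> x y xy; apply: logclamp_le => //.
  have p (z : R) : 0 <= Num.max z 0 by rewrite le_max lexx orbT.
  rewrite (ger0_norm (p x)) (ger0_norm (p y)).
  by rewrite ge_max !le_max xy lexx orbT.
have m2 : {homo h2 : x y /~ x <= y}.
  move=> x y xy; apply: logclamp_le => //.
  have p (z : R) : Num.min z 0 <= 0 by rewrite ge_min lexx orbT.
  rewrite (ler0_norm (p x)) (ler0_norm (p y)) lerN2.
  by rewrite le_min !ge_min xy lexx orbT.
have hb g : forall x : R, ln eta <= logclamp eta K (g x) <= ln K.
  by move=> x; exact: logclamp_bounds.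
have s1 := monotone_sum_le sa sb ab (hb _) (or_introl m1).
have s2 := monotone_sum_le sa sb ab (hb _) (or_intror m2).
have split (s : n.-tuple R) : \sum_(j < n) logclamp eta K (tnth s j) =
    \sum_(j < n) h1 (tnth s j) + \sum_(j < n) h2 (tnth s j) - n%:R * ln eta.
  under eq_bigr do rewrite hE.
  by rewrite !big_split/= sumrN sumr_const card_ord mulr_natl.
rewrite !split.
have : D0%:R * (ln K - ln eta) <= D * (ln K - ln eta).
  by apply: ler_wpM2r => //; rewrite subr_ge0 ler_ln ?posrE.
move: s1 s2; rewrite -/h1 -/h2.
set S1 := \sum_j _; set S2 := \sum_j _; set S3 := \sum_j _; set S4 := \sum_j _.
lra.
Qed.

Lemma empirical_measure_le n (T : 'M[R]_n) x :
  empirical_measure T `]-oo, x]%classic = (n%:R^-1 * countle (eigenvalues T) x)%:E.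
Proof.
rewrite /empirical_measure EFinM -sumEFin; congr (_ * _)%E.
apply: eq_bigr => j _; rewrite diracE; congr ((nat_of_bool _)%:R%:E).
by apply/idP/idP; rewrite inE/= in_itv/=.
Qed.

Lemma dKSP n (A B : 'M[R]_n) (r : R) : (0 < n)%N ->
  ((dKS (empirical_measure A) (empirical_measure B) <= r%:E)%E <->
  forall x, `|countle (eigenvalues A) x - countle (eigenvalues B) x| <= n%:R * r).
Proof.
move=> n0; have n0' : 0 < n%:R :> R by rewrite ltr0n.
have E x : `|empirical_measure A `]-oo, x]%classic - empirical_measure B `]-oo, x]%classic|%E
   = (n%:R^-1 * `|countle (eigenvalues A) x - countle (eigenvalues B) x|)%:E.
  rewrite !empirical_measure_le -EFinB abse_EFin -mulrBr normrM.
  by rewrite (ger0_norm (_ : 0 <= n%:R^-1)) ?invr_ge0 ?ltW.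
split => [h x|h].
  rewrite -ler_pdivrMl// -lee_fin -E; apply: le_trans h.
  by apply: ereal_sup_ubound; exists x.
by apply: ge_ereal_sup => _ [x _ <-]; rewrite E lee_fin ler_pdivrMl.
Qed.

(** Both counting functions are constant between consecutive points of the two lists and vanish to
    the left of all of them, so a disagreement at [x] is already seen at the largest listed point
    below [x]. This turns the supremum in [dKS] into a finite maximum, hence its measurability. *)
Lemma countle_const n (a b : n.-tuple R) x : countle a x != countle b x ->
  exists k, (countle a x = countle a (tnth a k) /\ countle b x = countle b (tnth a k)) \/
            (countle a x = countle a (tnth b k) /\ countle b x = countle b (tnth b k)).
Proof.
move=> nab.
pose v (k : 'I_n + 'I_n) := match k with inl i => tnth a i | inr i => tnth b i end.
case: (pickP (fun k => v k <= x)) => [k0 k0x|nk]; last first.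
  case/negP: nab; apply/eqP; rewrite /countle !big1// => j _.
    by have := nk (inr j); rewrite /= => ->.
  by have := nk (inl j); rewrite /= => ->.
have [k kx kmax] : exists2 k, v k <= x & forall j, v j <= x -> v j <= v k.
  by case: (@arg_maxP _ _ _ k0 (fun k => v k <= x) v k0x) => k kx km; exists k.
have Ea : countle a x = countle a (v k).
  apply: eq_bigr => j _; congr (nat_of_bool _)%:R.
  apply/idP/idP => h; first exact: (kmax (inl j)).
  exact: le_trans kx.
have Eb : countle b x = countle b (v k).
  apply: eq_bigr => j _; congr (nat_of_bool _)%:R.
  apply/idP/idP => h; first exact: (kmax (inr j)).
  exact: le_trans kx.
by case: k {kx kmax} Ea Eb => k Ea Eb; exists k; [left|right].
Qed.

Lemma measurable_dKS d (T : measurableType d) n (A B : T -> 'M[R]_n) (r : R) :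
  (0 < n)%N -> 0 <= r ->
  (forall j, measurable_fun setT (fun w => tnth (eigenvalues (A w)) j)) ->
  (forall j, measurable_fun setT (fun w => tnth (eigenvalues (B w)) j)) ->
  measurable [set w | (r%:E < dKS (empirical_measure (A w)) (empirical_measure (B w)))%E].
Proof.
move=> n0 r0 mA mB.
pose diff w x := `|countle (eigenvalues (A w)) x - countle (eigenvalues (B w)) x|.
have mcnt (f : T -> R) : measurable_fun setT f -> measurable_fun setT (fun w => diff w (f w)).
  move=> mf; apply: measurableT_comp => //; apply: measurable_funB;
    apply: measurable_sum => j.
    rewrite (_ : (fun _ => _) = (fun w => if tnth (eigenvalues (A w)) j <= f w then 1 else 0)).
      by apply: measurable_fun_ifT => //; exact: measurable_fun_ler.
    by apply/funext => w; case: ifP.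
  rewrite (_ : (fun _ => _) = (fun w => if tnth (eigenvalues (B w)) j <= f w then 1 else 0)).
    by apply: measurable_fun_ifT => //; exact: measurable_fun_ler.
  by apply/funext => w; case: ifP.
rewrite (_ : [set w | _] = \big[setU/set0]_(k < n)
   ([set w | n%:R * r < diff w (tnth (eigenvalues (A w)) k)] `|`
    [set w | n%:R * r < diff w (tnth (eigenvalues (B w)) k)])).
  apply: bigsetU_measurable => k _; apply: measurableU; apply: measurable_gt; exact: mcnt.
apply/seteqP; split => w /=.
  rewrite ltNge => /negP dle.
  have [x hx] : exists x, n%:R * r < diff w x.
    apply/not_existsP => h; apply: dle; apply/(dKSP _ _ _ n0) => x.
    by rewrite leNgt; apply/negP; exact: h.
  have [|k hk] := @countle_const n (eigenvalues (A w)) (eigenvalues (B w)) x.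
    apply: contraTN hx => /eqP e; rewrite /diff e subrr normr0 -leNgt.
    by rewrite mulr_ge0.
  rewrite (bigD1 k)//=; left; case: hk => -[e1 e2]; [left|right];
    by rewrite /= /diff -e1 -e2.
elim/big_ind: _ => // [X Y hX hY [/hX|/hY]//|k _ h].
rewrite ltNge; apply/negP => /(dKSP _ _ _ n0) hle.
by case: h => /=; rewrite ltNge /diff hle.
Qed.

End Kolmogorov.

(** * Integration against the mean spectral measure *)

Section SetFunctionIntegral.
Context d (T : measurableType d) (R : realType).
Import HBNNSimple.

(** [mean_measure] is a bare set function. As the integral sees only its values on measurable sets,
    it can be traded for a genuine measure. *)
Lemma integral_eq_set_function (m1 m2 : set T -> \bar R) (f : T -> \bar R) :
  (forall A, measurable A -> m1 A = m2 A) ->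
  (\int[m1]_x f x = \int[m2]_x f x)%E.
Proof.
move=> m12; rewrite /integral.
have E (h : {nnsfun T >-> R}) : sintegral m1 h = sintegral m2 h.
  by apply: eq_fsbigr => r _; rewrite m12.
by congr (ereal_sup _ - ereal_sup _)%E; apply/seteqP; split => _ [h hf <-];
  exists h.
Qed.

End SetFunctionIntegral.

Section MeanMeasure.
Context (R : realType) d (T : measurableType d) (P : probability T R).
Context (n : nat) (Hm : T -> 'M[R]_n).
Hypothesis mlam : forall j, measurable_fun setT (fun w => tnth (eigenvalues (Hm w)) j).

Lemma bounded_integrable (f : T -> R) (B : R) : measurable_fun setT f ->
  (forall w, `|f w| <= B) -> P.-integrable setT (EFin \o f).
Proof.
move=> mf fB; apply: measurable_bounded_integrable => //.
  exact: (le_lt_trans (probability_le1 P measurableT) (ltry 1)).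
exists B; split; first exact: num_real.
by move=> M BM w _; apply: (le_trans (fB w)); exact: ltW.
Qed.

Lemma measurable_trace (f : R -> R) : measurable_fun setT f ->
  measurable_fun setT (fun w => trace_fun f (Hm w)).
Proof.
move=> mf; apply: measurable_sum => j.
by apply: measurableT_comp => //.
Qed.

Let lam (j : 'I_n) : T -> R := fun w => tnth (eigenvalues (Hm w)) j.
Let X (j : 'I_n) : {mfun T >-> R} :=
  HB.pack (lam j) (isMeasurableFun.Build _ _ _ _ _ (mlam j)).
(** [msum] takes a sequence indexed by natural numbers, so the laws of the eigenvalues are continued
    by the zero measure. *)
Let Xn (k : nat) : {measure set R -> \bar R} :=
  match @idP (k < n)%N with
  | ReflectT h => distribution P (X (Ordinal h))
  | ReflectF _ => mzero
  end.
Let ni : {nonneg R} := NngNum (ltac:(by rewrite invr_ge0) : 0 <= n%:R^-1 :> R).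
Let nu : {measure set R -> \bar R} := mscale ni (msum Xn n).

Let XnE (j : 'I_n) : Xn j = distribution P (X j) :> (set R -> \bar R).
Proof.
rewrite /Xn; case: {-}_ / idP => [h|]; last by rewrite ltn_ord.
by congr (distribution P (X _)); exact: val_inj.
Qed.

Let meanE A : measurable A -> mean_measure P (fun w => empirical_measure (Hm w)) A = nu A.
Proof.
move=> mA; rewrite /mean_measure /empirical_measure.
have md j : measurable_fun setT (fun w => \d_(tnth (eigenvalues (Hm w)) j) A : \bar R).
  rewrite (_ : (fun _ => _) = EFin \o \1_(lam j @^-1` A)).
    apply/measurable_EFinP; apply: measurable_indic.
    by rewrite -[X in measurable X]setTI; exact: mlam.
  by apply/funext => w; rewrite diracE /= indicE.
rewrite ge0_integralZl_EFin//; last 2 first.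
- by move=> w _; apply: sume_ge0.
- exact: emeasurable_sum.
rewrite ge0_integral_sum//.
rewrite /nu /mscale/= /msum; congr (_ * _)%E.
apply: eq_bigr => j _; rewrite XnE /distribution/= /pushforward.
rewrite (eq_integral (EFin \o \1_(lam j @^-1` A))); last first.
  by move=> w _; rewrite diracE /= indicE.
rewrite integral_indic ?setIT//.
by rewrite -[X in measurable X]setTI; exact: mlam.
Qed.

Let nu_ge0 (f : R -> \bar R) : measurable_fun setT f -> (forall x, 0 <= f x)%E ->
  (\int[nu]_x f x = n%:R^-1%:E * \sum_j \int[P]_w f (lam j w))%E.
Proof.
move=> mf f0; rewrite /nu ge0_integral_mscale// ge0_integral_measure_sum//.
congr (_ * _)%E; apply: eq_bigr => j _.
have -> : (\int[Xn j]_x f x = \int[distribution P (X j)]_x f x)%E.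
  by apply: eq_measure_integral => A mA _; rewrite XnE.
by rewrite ge0_integral_distribution.
Qed.

(** The mean spectral measure is the average [nu] of the laws of the eigenvalues. Positive and
    negative parts are integrated separately; boundedness keeps their difference finite. *)
Lemma integral_mean_measure (f : R -> R) (B : R) : (0 < n)%N ->
  measurable_fun setT f -> (forall x, `|f x| <= B) ->
  (\int[mean_measure P (fun w => empirical_measure (Hm w))]_x (f x)%:E =
   \int[P]_w (n%:R^-1 * trace_fun f (Hm w))%:E)%E.
Proof.
move=> n0 mf fB; rewrite (integral_eq_set_function _ meanE) integralE.
have fl j : measurable_fun setT (fun w => f (lam j w)).
  exact: (measurableT_comp mf (mlam j)).
have il j : P.-integrable setT (EFin \o (fun w => f (lam j w))).
  exact: (bounded_integrable (fl j) (fun w => fB _)).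
have mfE : measurable_fun setT (EFin \o f) by exact/measurable_EFinP.
rewrite !nu_ge0//; last 2 first.
- exact: measurable_funeneg.
- exact: measurable_funepos.
have fin j : (\int[P]_w (f (lam j w))%:E)%E \is a fin_num.
  exact: (integrable_fin_num measurableT (il j)).
transitivity (n%:R^-1%:E * \sum_j \int[P]_w (f (lam j w))%:E)%E.
  have ip j : P.-integrable setT (fun w => ((EFin \o f)^\+ (lam j w))%E).
    have := integrable_funepos measurableT (il j).
    by apply: eq_integrable => // w _; rewrite !funeposE.
  have im j : P.-integrable setT (fun w => ((EFin \o f)^\- (lam j w))%E).
    have := integrable_funeneg measurableT (il j).
    by apply: eq_integrable => // w _; rewrite !funenegE.
  have fp j := integrable_fin_num measurableT (ip j).
  have fm j := integrable_fin_num measurableT (im j).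
  rewrite -muleBr//; last first.
    by apply: fin_num_adde_defr; apply/sum_fin_numP => j _ _; exact: fp.
  congr (_ * _)%E.
  rewrite -fin_num_sumeN// -big_split/=; apply: eq_bigr => j _.
  rewrite [RHS]integralE; congr (_ - _)%E; apply: eq_integral => w _.
    by rewrite !funeposE.
  by rewrite !funenegE.
under [RHS]eq_integral do rewrite EFinM.
rewrite integralZl//.
  rewrite /trace_fun; under [in RHS]eq_integral do rewrite -sumEFin.
  by rewrite integral_sum.
apply: (@bounded_integrable _ (n%:R * B)); first exact: measurable_trace.
move=> w; apply: (le_trans (ler_norm_sum _ _ _)).
apply: (@le_trans _ _ (\sum_(j < n) B)); first exact: ler_sum.
by rewrite sumr_const card_ord mulr_natl.
Qed.

(** Division by [B + L] turns [f] into an admissible test function. *)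
Lemma dBL_bound (mu : probability R R) (f : R -> R) (B L r : R) : (0 < n)%N ->
  0 < B -> 0 <= L -> (forall x, `|f x| <= B) ->
  (forall x y, `|f x - f y| <= L * `|x - y|) -> measurable_fun setT f ->
  (dBL (mean_measure P (fun w => empirical_measure (Hm w))) mu <= r%:E)%E ->
  `|fine (\int[P]_w (n%:R^-1 * trace_fun f (Hm w))%:E) - fine (\int[mu]_x (f x)%:E)|
    <= (B + L) * r.
Proof.
move=> n0 B0 L0 fB fL mf h.
have BL0 : 0 < B + L by rewrite ltr_wpDr.
pose g x := (B + L)^-1 * f x.
have BLi : 0 < (B + L)^-1 by rewrite invr_gt0.
have mg : measurable_fun setT g by apply: measurable_funM.
have gB x : `|g x| <= B / (B + L).
  by rewrite /g normrM (gtr0_norm BLi) mulrC ler_wpM2r ?(ltW BLi).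
have gtest : (lip_const Num.norm Num.norm g + ereal_sup [set `|g x|%:E | x in setT] <= 1)%E.
  have -> : (1%E : \bar R) = ((L / (B + L))%:E + (B / (B + L))%:E)%E.
    by rewrite -EFinD -mulrDl addrC divff// gt_eqF.
  apply: leeD; last by apply: ge_ereal_sup => _ [x _ <-]; rewrite lee_fin.
  apply: ge_ereal_sup => _ [[x y] /= xy <-]; rewrite lee_fin.
  have xy0 : 0 < `|x - y| by rewrite normr_gt0 subr_eq0.
  rewrite ler_pdivrMr// /g -mulrBr normrM (gtr0_norm BLi) [leLHS]mulrC mulrAC.
  by rewrite ler_wpM2r ?(ltW BLi).
have : (`|\int[mean_measure P (fun w => empirical_measure (Hm w))]_x (g x)%:E -
   \int[mu]_x (g x)%:E| <= r%:E)%E.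
  by apply: le_trans h; apply: ereal_sup_ubound; exists g.
rewrite (integral_mean_measure n0 mg gB).
have tB w : `|n%:R^-1 * trace_fun f (Hm w)| <= B.
  rewrite normrM ger0_norm ?invr_ge0// ler_pdivrMl ?ltr0n//.
  apply: (le_trans (ler_norm_sum _ _ _)).
  apply: (@le_trans _ _ (\sum_(j < n) B)); first exact: ler_sum.
  by rewrite sumr_const card_ord mulr_natl.
have i1 : P.-integrable setT (EFin \o (fun w => n%:R^-1 * trace_fun f (Hm w))).
  apply: (@bounded_integrable _ B) => //.
  by apply: measurable_funM => //; exact: measurable_trace.
have i2 : mu.-integrable setT (EFin \o f).
  apply: measurable_bounded_integrable => //.
    exact: (le_lt_trans (probability_le1 mu measurableT) (ltry 1)).
  exists B; split; first exact: num_real.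
  by move=> M BM w _; apply: (le_trans (fB w)); exact: ltW.
have -> : (\int[P]_w (n%:R^-1 * trace_fun g (Hm w))%:E =
   (B + L)^-1%:E * \int[P]_w (n%:R^-1 * trace_fun f (Hm w))%:E)%E.
  rewrite -integralZl//; apply: eq_integral => w _.
  by rewrite -EFinM /trace_fun /g -mulr_sumr mulrCA.
have -> : (\int[mu]_x (g x)%:E = (B + L)^-1%:E * \int[mu]_x (f x)%:E)%E.
  by rewrite -integralZl//; apply: eq_integral => x _; rewrite -EFinM.
have := integrable_fin_num measurableT i1; have := integrable_fin_num measurableT i2.
move=> /fineK <- /fineK <-; set a := fine _; set b := fine _.
rewrite -!EFinM -EFinB abse_EFin lee_fin -mulrBr normrM (gtr0_norm BLi) /=.
by rewrite ler_pdivrMl.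
Qed.

End MeanMeasure.

(** * The logarithmic potential near the origin *)

Section Density.
Context (R : realType) (mu : probability R R) (kappa : R) (f : R -> R).
Hypothesis kappa0 : 0 < kappa.
Hypothesis hd : has_density_on `]- kappa, kappa[ mu f.
Hypothesis hf : forall x : R, x != 0 -> `|x| < kappa ->
  f x < kappa^-1 * `|x| `^ (- 1 + kappa).

Definition centered (t : R) : set R := `[- t, t]%classic.

Lemma centeredP t x : centered t x <-> `|x| <= t.
Proof. by rewrite /centered/= in_itv/= ler_norml. Qed.

Lemma measurable_centered t : measurable (centered t).
Proof. exact: measurable_itv. Qed.

Lemma density_interval_le (i : interval R) (c len : R) : 0 <= c ->
  [set` i] `<=` `]- kappa, kappa[%classic -> (forall x, x \in i -> f x <= c) ->
  (lebesgue_measure [set` i] <= len%:E)%E -> pr mu [set` i] <= c * len.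
Proof.
move=> c0 iD fc il; case: hd => mf f0 hmu.
have mi : measurable [set` i] by exact: measurable_itv.
rewrite -lee_fin -prE// hmu//.
apply: (@le_trans _ _ (\int[lebesgue_measure]_(x in [set` i]) (cst c%:E x))%E).
  apply: ge0_le_integral => //.
  - by move=> x /iD/f0; rewrite lee_fin.
  - by apply/measurable_EFinP; apply: measurable_funS mf.
rewrite (integral_cst lebesgue_measure mi).
rewrite EFinM; apply: lee_wpmul2l; last exact: il.
by rewrite lee_fin.
Qed.

Lemma density_point0 : pr mu [set 0] = 0.
Proof.
case: hd => mf f0 hmu; rewrite /pr hmu ?integral_set1//.
by move=> _ ->; rewrite /= in_itv/= oppr_lt0 kappa0.
Qed.

(** On the shell t/2 <= |x| <= t the density is at most kappa^(-1) (2/t) t^kappa, and the shell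
    consists of two intervals of length t/2. Summing over dyadic shells replaces integrating the
    singular bound. *)
Lemma density_halving t : 0 < t -> t < kappa ->
  pr mu (centered t) <= 2 * kappa^-1 * t `^ kappa + pr mu (centered (t / 2)).
Proof.
move=> t0 tk; pose c := kappa^-1 * (2 / t * t `^ kappa).
have k0 : 0 <= kappa^-1 by rewrite invr_ge0 ltW.
have c0 : 0 <= c by rewrite /c !mulr_ge0 ?powR_ge0 ?invr_ge0 ?(ltW t0) ?(ltW kappa0).
have fc x : t / 2 <= `|x| -> `|x| <= t -> f x <= c.
  move=> x1 x2; have x0 : 0 < `|x| by apply: lt_le_trans x1; rewrite divr_gt0.
  have xn0 : x != 0 by rewrite -normr_gt0.
  apply: (le_trans (ltW (hf xn0 (le_lt_trans x2 tk)))).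
  apply: ler_wpM2l => //.
  rewrite powRD; last by rewrite (gt_eqF x0) implybT.
  rewrite powR_inv1 ?(ltW x0)//; apply: ler_pM; rewrite ?invr_ge0 ?powR_ge0//.
    by rewrite -(invf_div t 2) lef_pV2 ?posrE// divr_gt0.
  by apply: ge0_ler_powR; rewrite ?nnegrE ?(ltW kappa0) ?(ltW t0).
have h1 : pr mu `[- t, - (t / 2)]%classic <= c * (t / 2).
  apply: density_interval_le => //.
  - move=> x /=; rewrite !in_itv/= => /andP[? ?]; apply/andP; split; lra.
  - move=> x; rewrite in_itv/= => /andP[? ?].
    have x0 : x <= 0 by lra.
    by apply: fc; rewrite ler0_norm//; lra.
  - rewrite lebesgue_measure_itv/= lte_fin; case: ifP => _; last first.
      by rewrite lee_fin divr_ge0// ltW.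
    by rewrite -EFinB lee_fin; lra.
have h2 : pr mu `[t / 2, t]%classic <= c * (t / 2).
  apply: density_interval_le => //.
  - move=> x /=; rewrite !in_itv/= => /andP[? ?]; apply/andP; split; lra.
  - move=> x; rewrite in_itv/= => /andP[? ?].
    have x0 : 0 <= x by lra.
    by apply: fc; rewrite ger0_norm//; lra.
  - rewrite lebesgue_measure_itv/= lte_fin; case: ifP => _; last first.
      by rewrite lee_fin divr_ge0// ltW.
    by rewrite -EFinB lee_fin; lra.
have cE : c * (t / 2) = kappa^-1 * t `^ kappa.
  by rewrite /c; field; rewrite !gt_eqF.
have mI (i : interval R) : measurable [set` i] by exact: measurable_itv.
have sub : centered t `<=`
    (`[- t, - (t / 2)]%classic `|` `[t / 2, t]%classic) `|` centered (t / 2).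
  move=> x /centeredP; rewrite ler_norml => /andP[? ?].
  have [?|?] := leP x (- (t / 2)).
    by left; left; rewrite /= in_itv/=; apply/andP; split; lra.
  have [?|?] := leP (t / 2) x.
    by left; right; rewrite /= in_itv/=; apply/andP; split; lra.
  by right; apply/centeredP; rewrite ler_norml; apply/andP; split; lra.
have mU : measurable (`[- t, - (t / 2)]%classic `|` `[t / 2, t]%classic : set R).
  exact: measurableU.
have s1 := pr_le mu (measurable_centered t) (measurableU _ _ mU (measurable_centered (t / 2))) sub.
have s2 := pr_setU mu mU (measurable_centered (t / 2)).
have s3 := pr_setU mu (mI `[- t, - (t / 2)]) (mI `[t / 2, t]).
rewrite cE in h1 h2; lra.
Qed.

Definition ratio2 : R := (1 / 2) `^ kappa.

Lemma ratio2_gt0 : 0 < ratio2.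
Proof. by rewrite powR_gt0. Qed.

Lemma ratio2_lt1 : ratio2 < 1.
Proof.
rewrite /ratio2 /powR ifF; last by apply/negbTE; rewrite gt_eqF.
rewrite -[ltRHS]expR0 ltr_expR pmulr_rlt0// ln_lt0//.
by apply/andP; split; lra.
Qed.

Lemma powR_half t n : 0 <= t -> (t / 2 ^+ n) `^ kappa = t `^ kappa * ratio2 ^+ n.
Proof.
move=> t0; elim: n => [|n IH]; first by rewrite !expr0 divr1 mulr1.
have -> : t / 2 ^+ n.+1 = t / 2 ^+ n * (1 / 2) by rewrite exprSr invfM mul1r mulrA.
rewrite powRM ?divr_ge0 ?exprn_ge0//.
by rewrite IH -mulrA -exprSr.
Qed.

(** Sum of the geometric series of ratio 2^(-kappa) that arises from iterating [density_halving]. *)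
Definition mass_const : R := 2 * kappa^-1 / (1 - ratio2).

Lemma mass_const_ge0 : 0 <= mass_const.
Proof.
by rewrite /mass_const divr_ge0// ?mulr_ge0 ?invr_ge0 ?(ltW kappa0)// subr_ge0 ltW// ratio2_lt1.
Qed.

(** After n halvings the remaining mass is that of [-t/2^n, t/2^n]; it tends to the mass of the
    point 0, which vanishes because the measure has a density there. *)
Lemma density_mass t : 0 < t -> t < kappa ->
  pr mu (centered t) <= mass_const * t `^ kappa.
Proof.
move=> t0 tk; have r1 := ratio2_lt1; have r0 := ratio2_gt0.
have t2 n : 0 < t / 2 ^+ n by rewrite divr_gt0// exprn_gt0.
have t2k n : t / 2 ^+ n < kappa.
  apply: le_lt_trans tk; rewrite ler_pdivrMr ?exprn_gt0//.
  by rewrite ler_pMr// exprn_ege1// ler1n.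
have iter n : pr mu (centered t) <=
    mass_const * t `^ kappa * (1 - ratio2 ^+ n) + pr mu (centered (t / 2 ^+ n)).
  elim: n => [|n IH]; first by rewrite expr0 subrr mulr0 add0r divr1.
  apply: (le_trans IH).
  have := density_halving (t2 n) (t2k n); rewrite powR_half ?(ltW t0)//.
  have -> : t / 2 ^+ n / 2 = t / 2 ^+ n.+1 by rewrite exprSr -mulrA -invfM.
  set p := pr _ _; set p' := pr _ _ => h.
  rewrite -lerBrDl; apply: (le_trans h); rewrite -lerBrDr.
  by rewrite le_eqVlt; apply/orP; left; apply/eqP; rewrite exprS /mass_const; field; lra.
have cvg0 : (fun n => pr mu (centered (t / 2 ^+ n))) @ \oo --> (0 : R).
  have cap : \bigcap_n centered (t / 2 ^+ n) = [set 0].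
    apply/seteqP; split => [x hx|_ -> n _]; last first.
      by apply/centeredP; rewrite normr0 ltW.
    apply/eqP; rewrite -normr_eq0; apply/negPn/negP => x0.
    have {}x0 : 0 < `|x| by rewrite lt_def x0 normr_ge0.
    pose N := Num.truncn (t / `|x|).
    have /centeredP := hx N I; rewrite ler_pdivlMr ?exprn_gt0// leNgt => /negP; apply.
    have y0 : 0 <= t / `|x| by rewrite divr_ge0// ltW.
    have /andP[_ tN] := truncn_itv y0.
    have : t / `|x| < 2 ^+ N.
      by apply: (lt_le_trans tN); rewrite -natrX ler_nat ltn_expl.
    by rewrite ltr_pdivrMr// mulrC.
  have m0 : measurable [set (0 : R)] by exact: measurable_set1.
  have mu0 : mu [set (0 : R)] = 0%:E by rewrite (prE mu m0) density_point0.
  have : (mu \o (fun n => centered (t / 2 ^+ n))) x @[x --> \oo] --> 0%:E.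
    rewrite -mu0 -cap; apply: nonincreasing_cvg_mu.
    - exact: (le_lt_trans (probability_le1 mu (measurable_centered _)) (ltry 1)).
    - by move=> n; exact: measurable_centered.
    - by rewrite cap.
    - move=> m n mn; apply/subsetPset => x /centeredP hx; apply/centeredP.
      apply: (le_trans hx); rewrite ler_pM2l// lef_pV2 ?posrE ?exprn_gt0//.
      by rewrite ler_weXn2l// ler1n.
  by move/fine_cvgP => [].
apply/ler_addgt0Pr => e e0.
have /cvgrPdist_lt /(_ e e0) [n _ /(_ n (leqnn n))] := cvg0.
rewrite sub0r normrN ger0_norm ?pr_ge0// => pn.
apply: (le_trans (iter n)); apply: lerD (ltW pn).
rewrite ler_piMr//; last by rewrite gerBl exprn_ge0// ltW.
by rewrite mulr_ge0 ?mass_const_ge0 ?powR_ge0.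
Qed.

Section LogIntegral.
Variables (C K : R).
Hypothesis CK : C <= K.
Hypothesis K_gt0 : 0 < K.
Hypothesis suppC : mu (~` centered C) = 0%E.

Lemma measurable_logclamp eta : measurable_fun setT (logclamp eta K).
Proof.
apply: measurableT_comp; first exact: measurable_ln.
by apply: measurable_minr => //; apply: measurable_maxr.
Qed.

Lemma logclamp_norm_le eta : 0 < eta -> eta <= K -> forall x,
  `|logclamp eta K x| <= `|ln eta| + `|ln K|.
Proof.
move=> e0 eK x; have /andP[h1 h2] := logclamp_bounds x e0 eK.
rewrite ler_norml; apply/andP; split.
  apply: le_trans h1; rewrite lerNl; apply: (le_trans (ler_norm _)).
  by rewrite normrN lerDl.
by apply: (le_trans h2); apply: (le_trans (ler_norm _)); rewrite lerDr.
Qed.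

Definition logpot eta : R := fine (\int[mu]_x (logclamp eta K x)%:E).

Lemma integrable_logclamp eta : 0 < eta -> eta <= K ->
  mu.-integrable setT (EFin \o logclamp eta K).
Proof.
move=> e0 eK; apply: bounded_integrable (logclamp_norm_le e0 eK).
exact: measurable_logclamp.
Qed.

Lemma logpotE eta : 0 < eta -> eta <= K ->
  (\int[mu]_x (logclamp eta K x)%:E = (logpot eta)%:E)%E.
Proof.
by move=> e0 eK; rewrite fineK//; apply: integrable_fin_num => //; exact: integrable_logclamp.
Qed.

Lemma logpot_norm_le eta : 0 < eta -> eta <= K -> `|logpot eta| <= `|ln eta| + `|ln K|.
Proof.
move=> e0 eK; rewrite -lee_fin -abse_EFin -logpotE//.
have mg : measurable_fun setT (EFin \o logclamp eta K).
  by apply/measurable_EFinP; exact: measurable_logclamp.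
apply: (le_trans (le_abse_integral mu measurableT mg)).
apply: (@le_trans _ _ (\int[mu]_x (cst (`|ln eta| + `|ln K|)%:E x))%E).
  apply: ge0_le_integral => //.
    by apply/measurable_EFinP; apply: measurableT_comp => //; exact: measurable_logclamp.
  by move=> x _; rewrite /= lee_fin; exact: logclamp_norm_le.
rewrite integral_cst//; rewrite -[leRHS]mule1; apply: lee_wpmul2l.
  by rewrite lee_fin addr_ge0.
exact: probability_le1.
Qed.

(** Halving the lower level lowers the clamped logarithm by at most [ln 2], and only where |x| <=
    eta. *)
Lemma logpot_halving eta : 0 < eta -> eta <= K ->
  logpot (eta / 2) <= logpot eta <= logpot (eta / 2) + ln 2 * pr mu (centered eta).
Proof.
move=> e0 eK; have e20 : 0 < eta / 2 by rewrite divr_gt0.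
have e2e : eta / 2 <= eta by rewrite ler_pdivrMr// ler_pMr// ler1n.
have e2K : eta / 2 <= K by exact: le_trans eK.
have i1 := integrable_logclamp e0 eK; have i2 := integrable_logclamp e20 e2K.
have ln2 : 0 <= ln 2 :> R by rewrite ln_ge0// ler1n.
have lnE : ln (eta / 2) = ln eta - ln 2 by rewrite ln_div ?posrE.
have pw x : 0 <= logclamp eta K x - logclamp (eta / 2) K x
    <= ln 2 * \1_(centered eta) x.
  rewrite indicE; have [xe|xe] := leP `|x| eta.
    rewrite mem_set ?mulr1; last exact/centeredP.
    rewrite [logclamp eta _ _]logclampE_small//.
    have /andP[h1 h2] := logclamp_bounds x e20 e2K.
    rewrite subr_ge0; apply/andP; split; last by rewrite lnE in h1; lra.
    have [xe2|xe2] := leP `|x| (eta / 2).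
      by rewrite logclampE_small// lnE gerBl.
    have p0 : 0 < `|x| by exact: lt_trans xe2.
    rewrite logclampE_mid ?(ltW xe2)// ?ler_ln ?posrE//.
    exact: le_trans eK.
  rewrite memNset ?mulr0; last by move=> /centeredP; rewrite leNgt xe.
  have [xK|xK] := leP `|x| K.
    rewrite !logclampE_mid ?(ltW xe) ?subrr ?lexx//.
    by apply: ltW; exact: le_lt_trans xe.
  by rewrite !logclampE_large ?(ltW xK)// subrr lexx.
have iB : (\int[mu]_x ((logclamp eta K x)%:E - (logclamp (eta / 2) K x)%:E) =
    (logpot eta - logpot (eta / 2))%:E)%E.
  by rewrite integralB_EFin// !logpotE// EFinB.
have mB : measurable_fun setT
    (fun x => (logclamp eta K x)%:E - (logclamp (eta / 2) K x)%:E)%E.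
  under eq_fun do rewrite -EFinB.
  by apply/measurable_EFinP; apply: measurable_funB; exact: measurable_logclamp.
apply/andP; split.
  rewrite -subr_ge0 -lee_fin -iB; apply: integral_ge0 => x _.
  by rewrite -EFinB lee_fin; have /andP[] := pw x.
rewrite -lerBlDl -lee_fin -iB.
apply: (@le_trans _ _ (\int[mu]_x ((ln 2)%:E * (\1_(centered eta) x)%:E))%E).
  apply: ge0_le_integral => //.
  - by move=> x _; rewrite -EFinB lee_fin; have /andP[] := pw x.
  - under eq_fun do rewrite -EFinM.
    apply/measurable_EFinP; apply: measurable_funM => //.
    by apply: measurable_indic; exact: measurable_centered.
  - by move=> x _; rewrite -EFinB -EFinM lee_fin; have /andP[] := pw x.
rewrite ge0_integralZl_EFin//; last first.
  by apply/measurable_EFinP; apply: measurable_indic; exact: measurable_centered.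
rewrite integral_indic//; last exact: measurable_centered.
by rewrite setIT EFinM -(prE mu (measurable_centered eta)).
Qed.

Definition log_const : R := ln 2 * mass_const / (1 - ratio2).

Lemma log_const_ge0 : 0 <= log_const.
Proof.
apply: divr_ge0; last by rewrite subr_ge0 ltW// ratio2_lt1.
by rewrite mulr_ge0 ?mass_const_ge0 ?ln_ge0 ?ler1n.
Qed.

Lemma logpot_iter eta n : 0 < eta -> eta <= K -> eta < kappa ->
  logpot (eta / 2 ^+ n) <= logpot eta <=
    logpot (eta / 2 ^+ n) + log_const * eta `^ kappa * (1 - ratio2 ^+ n).
Proof.
move=> e0 eK ek; have r1 := ratio2_lt1; have r0 := ratio2_gt0.
elim: n => [|n /andP[IH1 IH2]]; first by rewrite expr0 divr1 subrr mulr0 addr0 lexx.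
have t20 : 0 < eta / 2 ^+ n by rewrite divr_gt0// exprn_gt0.
have t2e : eta / 2 ^+ n <= eta.
  by rewrite ler_pdivrMr ?exprn_gt0// ler_pMr// exprn_ege1// ler1n.
have /andP[] := logpot_halving t20 (le_trans t2e eK).
have -> : eta / 2 ^+ n / 2 = eta / 2 ^+ n.+1 by rewrite exprSr -mulrA -invfM.
have := density_mass t20 (le_lt_trans t2e ek); rewrite powR_half ?(ltW e0)//.
have ln2 : 0 <= ln 2 :> R by rewrite ln_ge0// ler1n.
move=> /(ler_wpM2l ln2) h3 h1 h2.
apply/andP; split; first exact: le_trans IH1.
apply: (le_trans IH2); rewrite -lerBrDr.
apply: (le_trans h2); apply: le_trans (lerD (lexx _) h3) _.
rewrite -addrA lerD2l le_eqVlt; apply/orP; left; apply/eqP.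
by rewrite exprS /log_const; field; lra.
Qed.

Lemma measurable_lne_norm : measurable_fun setT (fun x : R => lne (`|x|%R)%:E).
Proof.
rewrite (_ : (fun _ => _) = (fun x : R => if x == 0 then -oo%E else (ln `|x|)%:E)).
  apply: measurable_fun_ifT => //.
    by apply: measurable_fun_eqr.
  apply/measurable_EFinP; apply: measurableT_comp; first exact: measurable_ln.
  exact: normr_measurable.
apply/funext => x; have [->|x0] := eqVneq x 0; first by rewrite normr0 le0_lneNy.
by rewrite lne_EFin// normr_gt0.
Qed.

(** The functions [g n], ln K minus the logarithm clamped at eta/2^n, are nonnegative and
    nondecreasing in n. Monotone convergence identifies the limit of their integrals, which
    [logpot_iter] bounds uniformly in n; the integral of the logarithm is therefore finite and
    one-sidedly close to [logpot eta]. *)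
Lemma log_integral eta : 0 < eta -> eta <= K -> eta < kappa ->
  exists v : R, (\int[mu]_x lne (`|x|%R)%:E = v%:E)%E /\
    logpot eta - log_const * eta `^ kappa <= v <= logpot eta.
Proof.
move=> e0 eK ek; have r1 := ratio2_lt1; have r0 := ratio2_gt0.
have t20 n : 0 < eta / 2 ^+ n by rewrite divr_gt0// exprn_gt0.
have t2e n : eta / 2 ^+ n <= eta.
  by rewrite ler_pdivrMr ?exprn_gt0// ler_pMr// exprn_ege1// ler1n.
have t2K n : eta / 2 ^+ n <= K by exact: le_trans (t2e n) eK.
have Icst : (\int[mu]_x (cst (ln K) x)%:E = (ln K)%:E)%E.
  rewrite -[RHS]mule1 -[X in (_ * X)%E](probability_setT mu).
  exact: (integral_cst mu measurableT (ln K)%:E).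
pose g n x : \bar R := (ln K - logclamp (eta / 2 ^+ n) K x)%:E.
have mg n : measurable_fun setT (g n).
  by apply/measurable_EFinP; apply: measurable_funB => //; exact: measurable_logclamp.
have g0 n x : setT x -> (0 <= g n x)%E.
  by move=> _; rewrite lee_fin subr_ge0; have /andP[] := logclamp_bounds x (t20 n) (t2K n).
have gmono x : setT x -> {homo g ^~ x : m n / (m <= n)%N >-> (m <= n)%E}.
  move=> _ m n mn; rewrite /g lee_fin lerD2l lerN2 /logclamp ler_ln; last 2 first.
  - by rewrite posrE lt_min K_gt0 andbT lt_max t20 orbT.
  - by rewrite posrE lt_min K_gt0 andbT lt_max t20 orbT.
  have le2 : eta / 2 ^+ n <= eta / 2 ^+ m.
    by rewrite ler_pM2l// lef_pV2 ?posrE ?exprn_gt0// ler_weXn2l// ler1n.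
  rewrite le_min; apply/andP; split; rewrite ge_min; apply/orP; [left|right]; last exact: lexx.
  by rewrite ge_max !le_max lexx le2 orbT.
have := @cvg_monotone_convergence _ _ _ mu setT measurableT g mg g0 gmono.
set G := fun x => limn (g ^~ x).
have Ig n : (\int[mu]_x g n x = (ln K - logpot (eta / 2 ^+ n))%:E)%E.
  have i1 : mu.-integrable setT (EFin \o cst (ln K)).
    by apply: (@bounded_integrable _ _ _ mu _ `|ln K|).
  rewrite (eq_integral (fun x => ((cst (ln K)) x)%:E - (logclamp (eta / 2 ^+ n) K x)%:E)%E).
    rewrite integralB_EFin//; last exact: integrable_logclamp.
    by rewrite logpotE// Icst EFinB.
  by move=> x _; rewrite /g EFinB.
under eq_fun do rewrite Ig.
move=> cvgI.
(* The limit is the unclamped logarithm only on [-K, K]; as [mu] lives on [centered C], this holds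
   almost everywhere. At x = 0 both sides are +oo. *)
have GE x : `|x| <= K -> G x = ((ln K)%:E - lne (`|x|%R)%:E)%E.
  move=> xK; apply/cvg_lim => //.
  have [x0|x0] := eqVneq x 0.
    rewrite x0 normr0 le0_lneNy//= addey//.
    apply/cvgeyPge => A.
    have ln2 : 0 < ln 2 :> R by rewrite ln_gt0// ltr1n.
    pose N := Num.truncn (`|A - ln K + ln eta| / ln 2).
    exists N.+1 => // n /= Nn; rewrite lee_fin.
    rewrite logclampE_small ?normr0 ?(ltW (t20 n))//.
    rewrite ln_div ?posrE ?exprn_gt0// lnXn// -[ln 2 *+ n]mulr_natl.
    have y0 : 0 <= `|A - ln K + ln eta| / ln 2 by rewrite divr_ge0// ltW.
    have /andP[_ hN] := truncn_itv y0.
    have : `|A - ln K + ln eta| / ln 2 <= n%:R.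
      by apply: (le_trans (ltW hN)); rewrite ler_nat.
    rewrite ler_pdivrMr// => h; have := ler_norm (A - ln K + ln eta); lra.
  have p0 : 0 < `|x| by rewrite normr_gt0.
  pose N := Num.truncn (eta / `|x|).
  have hN n : (N.+1 <= n)%N -> eta / 2 ^+ n <= `|x|.
    move=> Nn; rewrite ler_pdivrMr ?exprn_gt0// -ler_pdivrMl// mulrC.
    have y0 : 0 <= eta / `|x| by rewrite divr_ge0// ltW.
    have /andP[_ h] := truncn_itv y0.
    apply: (le_trans (ltW h)); rewrite -natrX ler_nat; apply: (leq_trans Nn); apply: ltnW; exact: ltn_expl.
  apply: cvg_near_cst; exists N.+1 => // n /hN hn.
  by rewrite /g logclampE_mid// lne_EFin// EFinB.
have mG : measurable_fun setT G.
  apply: (emeasurable_fun_cvg g) => // x _.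
  exact: (ereal_nondecreasing_is_cvgn (gmono x I)).
have G0 x : (0 <= G x)%E.
  apply: lime_ge; first exact: (ereal_nondecreasing_is_cvgn (gmono x I)).
  by apply: nearW => n; exact: g0.
have Iub : (\int[mu]_x G x <= (ln K - logpot eta + log_const * eta `^ kappa)%:E)%E.
  rewrite -(cvg_lim _ cvgI)//; apply: lime_le; first by apply/cvg_ex; eexists; exact: cvgI.
  apply: nearW => n; rewrite lee_fin.
  have /andP[_] := logpot_iter n e0 eK ek.
  have : log_const * eta `^ kappa * (1 - ratio2 ^+ n) <= log_const * eta `^ kappa.
    apply: ler_piMr; first by apply: mulr_ge0; [exact: log_const_ge0|exact: powR_ge0].
    by rewrite gerBl; apply: exprn_ge0; exact: ltW.
  lra.
have Ilb : ((ln K - logpot eta)%:E <= \int[mu]_x G x)%E.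
  rewrite -(cvg_lim _ cvgI)//; apply: lime_ge; first by apply/cvg_ex; eexists; exact: cvgI.
  apply: nearW => n; rewrite lee_fin lerD2l lerN2.
  by have /andP[] := logpot_iter n e0 eK ek.
have fI : (\int[mu]_x G x)%E \is a fin_num.
  by rewrite ge0_fin_numE ?integral_ge0//; exact: (le_lt_trans Iub (ltry _)).
have iG : mu.-integrable setT G.
  apply/integrableP; split => //.
  under eq_integral do rewrite gee0_abs//.
  exact: (le_lt_trans Iub (ltry _)).
exists (ln K - fine (\int[mu]_x G x)); split; last first.
  have := Iub; have := Ilb; rewrite -(fineK fI) !lee_fin; lra.
have i1 : mu.-integrable setT (EFin \o cst (ln K)).
  by apply: (@bounded_integrable _ _ _ mu _ `|ln K|).
transitivity (\int[mu]_x ((EFin \o cst (ln K)) x - G x))%E; last first.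
  by rewrite integralB// Icst EFinB fineK.
apply: ae_eq_integral => //.
- exact: measurable_lne_norm.
- apply: emeasurable_funB => //.
  by apply/measurable_EFinP; exact: measurable_cst.
exists (~` centered C); split => //.
  by apply: measurableC; exact: measurable_centered.
move=> x nx /centeredP xC; apply: nx => _.
rewrite GE; last exact: le_trans CK.
have [->|x0] := eqVneq x 0.
  by rewrite normr0 le0_lneNy.
rewrite lne_EFin ?normr_gt0// -EFinB /=.
by rewrite subKr.
Qed.

End LogIntegral.
End Density.

(** * Concentration of the clamped log-determinant *)

Section ExpectClose.
Context (R : realType) d (T : measurableType d) (P : probability T R).

(** Outside the bad event the deviation is at most [a]; on it, at most [2 * B + a], because p < 1
    leaves some good outcome, which forces |c| <= B + a. The unknown centre of concentration is thus
    exchanged for the mean. *)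
Lemma expect_close (F : T -> R) (B a c p : R) : measurable_fun setT F ->
  (forall w, `|F w| <= B) -> 0 <= a -> p < 1 -> pr P [set w | a < `|F w - c|] <= p ->
  `|fine (\int[P]_w (F w)%:E) - c| <= a + p * (2 * B + a).
Proof.
move=> mF FB a0 p1 hp.
have mG : measurable_fun setT (fun w => `|F w - c|).
  by apply: measurableT_comp => //; apply: measurable_funB.
have mbad : measurable [set w | a < `|F w - c|] by exact: measurable_gt.
have cB : `|c| <= B + a.
  have [w /= hw] : exists w, ~ (a < `|F w - c|).
    apply: contrapT => /forallNP hall.
    have : pr P setT <= p.
      rewrite (_ : setT = [set w | a < `|F w - c|])//.
      by apply/seteqP; split => // w _; apply: contrapT; exact: hall.
    by rewrite pr_setT leNgt p1.
  have {}hw : `|F w - c| <= a by rewrite leNgt; apply/negP.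
  have -> : c = F w - (F w - c) by ring.
  by apply: (le_trans (ler_normB _ _)); apply: lerD.
have iF := bounded_integrable P mF FB.
have ic : P.-integrable setT (EFin \o cst c).
  by apply: (@bounded_integrable _ _ _ P _ `|c|).
have fF := integrable_fin_num measurableT iF.
have Ic : (\int[P]_w (cst c w)%:E = c%:E)%E.
  rewrite -[RHS]mule1 -[X in (_ * X)%E](probability_setT P).
  exact: (integral_cst P measurableT c%:E).
have B0 : 0 <= 2 * B + a.
  have [w _] : exists w : T, True.
    apply: contrapT => /forallNP hall.
    have : pr P setT = 0.
      rewrite (_ : setT = set0) ?pr_set0//.
      by apply/seteqP; split => // w _; have := hall w.
    by rewrite pr_setT => /eqP; rewrite oner_eq0.
  have := le_trans (normr_ge0 _) (FB w); lra.
rewrite -lee_fin -abse_EFin EFinB fineK// -{1}Ic -integralB_EFin//.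
under eq_integral do rewrite -EFinB.
have mFc : measurable_fun setT (EFin \o (fun w => F w - cst c w)).
  by apply/measurable_EFinP; apply: measurable_funB.
apply: (le_trans (le_abse_integral P measurableT mFc)).
pose bad := [set w | a < `|F w - c|].
apply: (@le_trans _ _ (\int[P]_w (a + (2 * B + a) * \1_bad w)%:E)%E).
  apply: ge0_le_integral => //.
  - by apply: measurableT_comp.
  - apply/measurable_EFinP; apply: measurable_funD => //; by apply: measurable_funM.
  - move=> w _; rewrite /= lee_fin indicE.
    have [wb|wb] := boolP (w \in bad).
      rewrite mulr1; apply: (le_trans (ler_normB _ _)).
      have := FB w; lra.
    rewrite mulr0 addr0 leNgt; apply/negP => h.
    by move/negP: wb; apply; rewrite inE.
under eq_integral do rewrite EFinD EFinM.
rewrite ge0_integralD//; last 2 first.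
- by move=> w _; rewrite -EFinM lee_fin mulr_ge0.
- under eq_fun do rewrite -EFinM; apply/measurable_EFinP; by apply: measurable_funM.
rewrite ge0_integralZl_EFin//; last first.
  by apply/measurable_EFinP; apply: measurable_indic.
rewrite integral_indic// setIT.
have -> : (\int[P]_w a%:E = a%:E)%E.
  rewrite -[RHS]mule1 -[X in (_ * X)%E](probability_setT P).
  exact: (integral_cst P measurableT a%:E).
apply: (@le_trans _ _ (a%:E + (2 * B + a)%:E * (pr P bad)%:E)%E).
  by rewrite -(prE P mbad).
by rewrite -EFinM -EFinD lee_fin lerD2l mulrC; apply: ler_wpM2r.
Qed.

End ExpectClose.

Lemma four_deviations (R : realType) (t1 t2 t3 c1 c2 s D E : R) :
  - (2 * s) <= t2 - c1 <= 2 * s -> - (2 * s) <= t3 - c2 <= 2 * s ->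
  t1 <= E + t2 - t3 + D -> E + t2 - t3 <= t1 + D ->
  - (4 * s + D) <= t1 - E - (c1 - c2) <= 4 * s + D.
Proof. by move=> /andP[? ?] /andP[? ?] ? ?; apply/andP; split; lra. Qed.

Section TailBound.
Context (R : realType) d (T : measurableType d) (P : probability T R).
Context (m n : nat) (Phi : 'rV[R]_m -> 'M[R]_n).
Hypothesis Phi_sym : forall x, (Phi x)^T = Phi x.
Hypothesis Phi_lip : (lip_norm2 Phi < +oo)%E.
Hypothesis Phi_conv : forall A : set 'M[R]_n, (forall T, A T -> T^T = T) ->
  @convex_set R 'M[R]_n A -> @convex_set R 'rV[R]_m (Phi @^-1` A).
Hypothesis m_gt0 : (0 < m)%N.
Hypothesis n_gt0 : (0 < n)%N.
Variable X : 'I_m -> T -> R.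
Hypothesis mX : forall k, measurable_fun setT (X k).
Hypothesis iX : independent_RVs P X.

Lemma logclamp_lip (eta K x y : R) : 0 < eta -> eta <= K ->
  `|logclamp eta K x - logclamp eta K y| <= 2 / eta * `|x - y|.
Proof.
move=> e0 eK.
have h x' y' : logclamp eta K x' - logclamp eta K y' <= 2 / eta * `|x' - y'|.
  have := conv_lip_lip x' y' (hinge_conv_lip e0).
  have := conv_lip_lip y' x' (logdef_conv_lip e0 eK).
  rewrite !logclamp_decomp (distrC y' x'); set p := eta^-1 * _.
  have -> : 2 / eta * `|x' - y'| = 2 * p by rewrite /p mulrA.
  lra.
rewrite ler_norml; apply/andP; split; last exact: h.
by rewrite lerNl opprB distrC; exact: h.
Qed.

Let Hm w := Phi (\row_k X k w).

Let mlam j : measurable_fun setT (fun w => tnth (eigenvalues (Hm w)) j).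
Proof. exact: (measurable_model_eigenvalue Phi_sym Phi_lip m_gt0 mX). Qed.

Let cutX r k w := cut1 (r%:E / lip_norm2 Phi) (X k w).

Lemma trace_fun_norm_le (f : R -> R) (B : R) (A : 'M[R]_n) : (forall x, `|f x| <= B) ->
  `|n%:R^-1 * trace_fun f A| <= B.
Proof.
move=> fB; rewrite normrM ger0_norm ?invr_ge0// ler_pdivrMl ?ltr0n//.
apply: (le_trans (ler_norm_sum _ _ _)).
apply: (@le_trans _ _ (\sum_(j < n) B)); first exact: ler_sum.
by rewrite sumr_const card_ord mulr_natl.
Qed.

(** Off three bad events (deviation of [hinge], deviation of [logdef], failure of (S)) the
    normalised statistic is within [a] of a constant [c]: 4s/n from the two deviations, the rest of
    [a] from undoing the truncation by [logclamp_sum_close]. Then [c] is within a + p (2B + a) of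
    the mean by [expect_close], and the mean within (B + 2/eta) r of [logpot], where 2/eta is the
    Lipschitz constant of [logclamp]. *)
Lemma tail_bound (mu : probability R R) (r eta K B s u p3 delta : R) :
  let a := 4 * s / n%:R + 2 * r * (ln K - ln eta) in
  let p := 4 * expR (- u) + p3 in
  0 < r -> 0 < eta -> eta <= K -> 0 < s -> 0 < u ->
  u * (576 * n%:R * r ^+ 2) <= s ^+ 2 * eta ^+ 2 ->
  pr P [set w | (r%:E < dKS (empirical_measure (Phi (\row_k X k w)))
    (empirical_measure (Phi (\row_k cut1 (r%:E / lip_norm2 Phi) (X k w)))))%E] <= p3 ->
  0 < B -> (forall x, `|logclamp eta K x| <= B) ->
  (dBL (mean_measure P (fun w => empirical_measure (Phi (\row_k X k w)))) mu <= r%:E)%E ->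
  p < 1 -> 2 * a + p * (2 * B + a) + (B + 2 / eta) * r < delta ->
  pr P [set w | delta <= `|n%:R^-1 * trace_fun (logclamp eta K) (Phi (\row_k X k w))
     - logpot mu K eta|] <= p.
Proof.
move=> a p r0 e0 eK s0 u0 hu hp3 B0 fB hdBL p1 hdelta.
have n0 : 0 < n%:R :> R by rewrite ltr0n.
have K0 : 0 < K by exact: lt_le_trans eK.
have lnK : 0 <= ln K - ln eta by rewrite subr_ge0 ler_ln ?posrE.
have [c1 hc1] := trace_concentration Phi_sym Phi_lip Phi_conv m_gt0 n_gt0 mX iX
  r0 e0 s0 u0 hu (hinge_conv_lip e0).
have [c2 hc2] := trace_concentration Phi_sym Phi_lip Phi_conv m_gt0 n_gt0 mX iX
  r0 e0 s0 u0 hu (logdef_conv_lip e0 eK).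
pose Hc w := Phi (\row_k cutX r k w).
pose E1 := [set w | 2 * s <= `|trace_fun (hinge eta) (Hc w) - c1|].
pose E2 := [set w | 2 * s <= `|trace_fun (logdef eta K) (Hc w) - c2|].
pose E3 := [set w | (r%:E < dKS (empirical_measure (Hm w)) (empirical_measure (Hc w)))%E].
have ei0 : 0 <= eta^-1 by rewrite invr_ge0 ltW.
have mcut k : measurable_fun setT (cutX r k).
  by apply: measurableT_comp => //; exact: measurable_cut1.
have mabs (G : T -> R) c : measurable_fun setT G -> measurable [set w | 2 * s <= `|G w - c|].
  move=> mG; apply: measurable_ge; apply: measurableT_comp => //.
  by apply: measurable_funB.
have mE1 : measurable E1.
  apply: mabs.
  exact: (measurable_trace_fun Phi_sym Phi_lip m_gt0 ei0 (hinge_conv_lip e0) mcut).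
have mE2 : measurable E2.
  apply: mabs.
  exact: (measurable_trace_fun Phi_sym Phi_lip m_gt0 ei0 (logdef_conv_lip e0 eK) mcut).
have mE3 : measurable E3.
  apply: (measurable_dKS n_gt0 (ltW r0) mlam).
  exact: (measurable_model_eigenvalue Phi_sym Phi_lip m_gt0 mcut).
pose F w := n%:R^-1 * trace_fun (logclamp eta K) (Hm w).
have mF : measurable_fun setT F.
  apply: measurable_funM => //; apply: (measurable_trace mlam).
  exact: measurable_logclamp.
have FB w : `|F w| <= B by exact: trace_fun_norm_le.
pose c := ln eta + (c1 - c2) / n%:R.
have a0 : 0 <= a.
  by apply: addr_ge0; [rewrite divr_ge0 ?mulr_ge0 ?(ltW s0) ?(ltW n0)|rewrite !mulr_ge0 ?(ltW r0)].
have Fc w : ~ E1 w -> ~ E2 w -> ~ E3 w -> `|F w - c| <= a.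
  rewrite /E1 /E2 /E3/= => /negP; rewrite -ltNge => /ltW h1.
  move=> /negP; rewrite -ltNge => /ltW h2.
  move=> /negP; rewrite -leNgt => /(dKSP _ _ _ n_gt0) h3.
  have sH : sorted <=%R (eigenvalues (Hm w)) by apply: eigenvalues_sorted; exact: Phi_sym.
  have sc : sorted <=%R (eigenvalues (Hc w)) by apply: eigenvalues_sorted; exact: Phi_sym.
  have d1 : trace_fun (logclamp eta K) (Hm w) <= trace_fun (logclamp eta K) (Hc w) +
      2 * (n%:R * r) * (ln K - ln eta) := logclamp_sum_close e0 eK sH sc h3.
  have h3' x : `|countle (eigenvalues (Hc w)) x - countle (eigenvalues (Hm w)) x| <= n%:R * r.
    by rewrite distrC; exact: h3.
  have d2 : trace_fun (logclamp eta K) (Hc w) <= trace_fun (logclamp eta K) (Hm w) +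
      2 * (n%:R * r) * (ln K - ln eta) := logclamp_sum_close e0 eK sc sH h3'.
  have tE : trace_fun (logclamp eta K) (Hc w) =
     n%:R * ln eta + trace_fun (hinge eta) (Hc w) - trace_fun (logdef eta K) (Hc w).
    rewrite /trace_fun; under eq_bigr do rewrite logclamp_decomp.
    rewrite sumrB; congr (_ - _).
    by rewrite big_split/= sumr_const card_ord mulr_natl.
  rewrite tE in d1 d2.
  have -> : F w - c = (trace_fun (logclamp eta K) (Hm w) - n%:R * ln eta - (c1 - c2)) / n%:R.
    by rewrite /F /c; field; rewrite gt_eqF.
  have aE : a = (4 * s + 2 * (n%:R * r) * (ln K - ln eta)) / n%:R.
    by rewrite /a; field; rewrite gt_eqF.
  rewrite normrM (gtr0_norm (_ : 0 < n%:R^-1)) ?invr_gt0// aE ler_wpM2r ?invr_ge0 ?(ltW n0)//.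
  move: h1 h2 d1 d2; rewrite !ler_norml; move: (_ * (ln K - _)) (n%:R * ln eta) => D E.
  move: (trace_fun _ _) (trace_fun _ _) (trace_fun _ _) => t1 t2 t3.
  exact: four_deviations.
have mbad b : measurable [set w | b < `|F w - c|].
  by apply: measurable_gt; apply: measurableT_comp => //; apply: measurable_funB.
have pU : pr P (E1 `|` E2 `|` E3) <= p.
  have mU : measurable (E1 `|` E2) by exact: measurableU.
  have q1 := pr_setU P mU mE3; have q2 := pr_setU P mE1 mE2.
  have q3 : pr P E3 <= p3 := hp3.
  rewrite -/(E1) in hc1; rewrite -/(E2) in hc2.
  rewrite /p; lra.
have sub b : a <= b -> [set w | b < `|F w - c|] `<=` E1 `|` E2 `|` E3.
  move=> ab w /= h; apply: contrapT => nU; move: h; rewrite ltNge; apply/negP/negPn.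
  apply: le_trans ab; apply: Fc => hE; apply: nU.
  - by left; left.
  - by left; right.
  - by right.
have pbad : pr P [set w | a < `|F w - c|] <= p.
  apply: le_trans pU; apply: pr_le => //; first by do 2 apply: measurableU => //.
  exact: sub.
have EFc := expect_close mF FB a0 p1 pbad.
have B2 : 0 <= 2 / eta by rewrite divr_ge0// ltW.
have EFm := dBL_bound mlam n_gt0 B0 B2 fB (fun x y => logclamp_lip x y e0 eK)
  (measurable_logclamp K eta) hdBL.
apply: le_trans pU; apply: pr_le.
- apply: measurable_ge; apply: measurableT_comp => //.
  by apply: measurable_funB.
- by do 2 apply: measurableU => //.
move=> w /= h.
have : a < `|F w - c|.
  rewrite ltNge; apply/negP => hFc.
  move: h; rewrite leNgt => /negP; apply.
  rewrite -/(Hm w) -/(F w).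
  move: EFc EFm; rewrite -/(logpot mu K eta); set e := fine _ => EFc EFm.
  have -> : F w - logpot mu K eta = (F w - c) - (e - c) + (e - logpot mu K eta) by ring.
  apply: (le_lt_trans (ler_normD _ _)).
  have := ler_normB (F w - c) (e - c).
  lra.
exact: sub.
Qed.

End TailBound.

Section Tent.
Variable R : realType.

(* A Lipschitz majorant of the indicator of [-eta, eta], to which [dBL] applies. *)
Definition tent (eta x : R) : R := Num.min 1 (Num.max 0 (2 - `|x| / eta)).

Lemma tent_bounds eta x : 0 <= tent eta x <= 1.
Proof.
by rewrite /tent le_min ler01 le_max lexx ge_min lexx.
Qed.

Lemma tent_one eta x : 0 < eta -> `|x| <= eta -> tent eta x = 1.
Proof.
move=> e0 xe; apply/min_idPl; rewrite le_max; apply/orP; right.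
have : `|x| / eta <= 1 by rewrite ler_pdivrMr// mul1r.
lra.
Qed.

Lemma tent_zero eta x : 0 < eta -> 2 * eta <= `|x| -> tent eta x = 0.
Proof.
move=> e0 xe; rewrite /tent (max_idPl _) ?(min_idPr _)//.
by rewrite subr_le0 ler_pdivlMr.
Qed.

Lemma tent_lip eta x y : 0 < eta -> `|tent eta x - tent eta y| <= eta^-1 * `|x - y|.
Proof.
move=> e0.
have h x' y' : tent eta x' - tent eta y' <= eta^-1 * `|x' - y'|.
  have D0 : 0 <= eta^-1 * `|x' - y'| by rewrite mulr_ge0// invr_ge0 ltW.
  have : `|y'| / eta - `|x'| / eta <= eta^-1 * `|x' - y'|.
    rewrite -mulrBl mulrC ler_wpM2l ?invr_ge0 ?(ltW e0)//.
    by rewrite distrC; exact: lerB_dist.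
  rewrite /tent; move: (eta^-1 * _) (`|x'| / eta) (`|y'| / eta) D0 => D a b D0 ab.
  have cl (z : R) : [\/ z <= 1 /\ Num.min 1 (Num.max 0 (2 - z)) = 1,
      2 <= z /\ Num.min 1 (Num.max 0 (2 - z)) = 0 |
      [/\ 1 <= z, z <= 2 & Num.min 1 (Num.max 0 (2 - z)) = 2 - z]].
    have [z1|z1] := leP z 1.
      by apply: Or31; split => //; rewrite (min_idPl _)// le_max; apply/orP; right; lra.
    have [z2|z2] := leP 2 z.
      by apply: Or32; split => //; rewrite (max_idPl _) ?(min_idPr _)//; lra.
    by apply: Or33; split; [lra|lra|rewrite (max_idPr _) ?(min_idPr _)//; lra].
  by case: (cl a) => [[? ->]|[? ->]|[? ? ->]]; case: (cl b) => [[? ->]|[? ->]|[? ? ->]]; lra.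
rewrite ler_norml; apply/andP; split; last exact: h.
by rewrite lerNl opprB distrC; exact: h.
Qed.

Lemma measurable_tent eta : measurable_fun setT (tent eta).
Proof.
apply: measurable_minr => //; apply: measurable_maxr => //.
by apply: measurable_funB => //; apply: measurable_funM.
Qed.

End Tent.

Section Markov.
Context (R : realType) d (T : measurableType d) (P : probability T R).

Lemma pr_markov (G : T -> R) (b B : R) : measurable_fun setT G ->
  (forall w, 0 <= G w <= B) -> 0 < b ->
  b * pr P [set w | b <= G w] <= fine (\int[P]_w (G w)%:E).
Proof.
move=> mG GB b0.
have mE : measurable [set w | b <= G w] by exact: measurable_ge.
have GB' w : `|G w| <= B by have /andP[? ?] := GB w; rewrite ger0_norm.
have iG := bounded_integrable P mG GB'.
rewrite -lee_fin fineK; last exact: (integrable_fin_num measurableT iG).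
apply: (@le_trans _ _ (\int[P]_w (b%:E * (\1_[set w | b <= G w] w)%:E))%E).
  rewrite ge0_integralZl_EFin ?(ltW b0)//; last first.
    by apply/measurable_EFinP; apply: measurable_indic.
  by rewrite integral_indic// setIT EFinM -(prE P mE).
apply: ge0_le_integral => //.
- by move=> w _; rewrite -EFinM lee_fin mulr_ge0 ?(ltW b0).
- under eq_fun do rewrite -EFinM; apply/measurable_EFinP; apply: measurable_funM => //.
- by apply/measurable_EFinP.
- move=> w _; rewrite -EFinM lee_fin indicE; case: (boolP (w \in _)) => [|_].
    by rewrite inE/= mulr1.
  by rewrite mulr0; have /andP[] := GB w.
Qed.

End Markov.

Section CountBound.
Context (R : realType) d (T : measurableType d) (P : probability T R).
Context (n : nat) (Hm : T -> 'M[R]_n).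
Hypothesis mlam : forall j, measurable_fun setT (fun w => tnth (eigenvalues (Hm w)) j).

(** Markov's inequality for the statistic of [tent]. Its mean is compared with [mu] at the cost (1 +
    1/eta) r, and [tent] is supported in [-2 eta, 2 eta]. *)
Lemma small_eigenvalues_bound (mu : probability R R) (r eta b : R) : (0 < n)%N ->
  0 < eta -> 0 < b ->
  (dBL (mean_measure P (fun w => empirical_measure (Hm w))) mu <= r%:E)%E ->
  b * pr P [set w | b <= n%:R^-1 * trace_fun (tent eta) (Hm w)] <=
    pr mu (centered (2 * eta)) + (1 + eta^-1) * r.
Proof.
move=> n0 e0 b0 hdBL.
have tB (x : R) : `|tent eta x| <= 1.
  by have /andP[? ?] := tent_bounds eta x; rewrite ger0_norm.
have mt := measurable_tent eta.
have h : fine (\int[mu]_x (tent eta x)%:E) <= pr mu (centered (2 * eta)).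
  have i1 : mu.-integrable setT (EFin \o tent eta) by exact: (bounded_integrable mu mt tB).
  rewrite -lee_fin fineK; last exact: (integrable_fin_num measurableT i1).
  rewrite -(prE mu (measurable_centered _)).
  apply: (@le_trans _ _ (\int[mu]_x (\1_(centered (2 * eta)) x)%:E)%E); last first.
    by rewrite integral_indic// ?setIT//; exact: measurable_centered.
  apply: ge0_le_integral => //.
  - by move=> x _; rewrite lee_fin; have /andP[] := tent_bounds eta x.
  - by apply/measurable_EFinP.
  - by apply/measurable_EFinP; apply: measurable_indic; exact: measurable_centered.
  - move=> x _; rewrite lee_fin indicE; case: (boolP (x \in _)) => [_|].
      by have /andP[] := tent_bounds eta x.
    rewrite notin_setE => /centeredP xe; rewrite tent_zero//.
    by rewrite leNgt; apply/negP => /ltW.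
have ei : 0 <= eta^-1 by rewrite invr_ge0 ltW.
have := dBL_bound mlam n0 ltr01 ei tB (fun x y => tent_lip x y e0) mt hdBL.
rewrite ler_norml => /andP[_ h2].
have mG : measurable_fun setT (fun w => n%:R^-1 * trace_fun (tent eta) (Hm w)).
  by apply: measurable_funM => //; exact: (measurable_trace mlam).
have GB w : 0 <= n%:R^-1 * trace_fun (tent eta) (Hm w) <= 1.
  apply/andP; split.
    rewrite mulr_ge0 ?invr_ge0//; apply: sumr_ge0 => j _.
    by have /andP[] := tent_bounds eta (tnth (eigenvalues (Hm w)) j).
  by apply: (le_trans (ler_norm _)); exact: trace_fun_norm_le.
have := pr_markov P mG GB b0; lra.
Qed.

End CountBound.

(** * Bounds on determinants and their expectations *)

Section Determinant.
Variable R : realType.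

Lemma det_upper n (A : 'M[R]_n) (eta K : R) : A^T = A -> 0 < eta -> eta <= 1 -> 1 <= K ->
  `|\det A| <= expR (trace_fun (logclamp eta K) A) *
    \prod_(j < n) (1 + `|tnth (eigenvalues A) j| * (K < `|tnth (eigenvalues A) j|)%R%:R).
Proof.
move=> sA e0 e1 K1; rewrite det_eigenvalues// /trace_fun expR_sum -big_split/=.
apply: ler_prod => j _; rewrite normr_ge0/=; set x := tnth _ _.
have K0 : 0 < K by exact: lt_le_trans K1.
have [xK|xK] := ltP K `|x|.
  rewrite mulr1 logclampE_large ?(ltW xK)//; last exact: le_trans K1.
  rewrite lnK ?posrE//; apply: (@le_trans _ _ (1 * (1 + `|x|))); first by rewrite mul1r lerDr.
  by rewrite ler_wpM2r// addr_ge0.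
rewrite mulr0 addr0 mulr1.
have [xe|xe] := leP `|x| eta.
  by rewrite logclampE_small ?lnK ?posrE//; exact: le_trans K1.
by rewrite logclampE_mid ?(ltW xe)// lnK// posrE; exact: lt_trans xe.
Qed.

(** At an eigenvalue of size at most [eta] the tent is 1 and the clamped logarithm is nonpositive,
    so its factor is at most e^(-g). At the others the clamped logarithm is at most the true one. *)
Lemma det_lower n (A : 'M[R]_n) (eta K g : R) : A^T = A -> 0 < eta -> eta <= 1 -> 1 <= K ->
  0 <= g -> (forall j, expR (- g) <= `|tnth (eigenvalues A) j|) ->
  expR (trace_fun (logclamp eta K) A - g * trace_fun (tent eta) A) <= `|\det A|.
Proof.
move=> sA e0 e1 K1 g0 hg; rewrite det_eigenvalues// /trace_fun.
rewrite mulr_sumr -sumrB expR_sum; apply: ler_prod => j _; rewrite expR_ge0/=.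
have := hg j; set x := tnth _ _ => xg.
have x0 : 0 < `|x| by apply: lt_le_trans xg; exact: expR_gt0.
have K0 : 0 < K by exact: lt_le_trans K1.
have eK : eta <= K by exact: le_trans K1.
have [xe|xe] := leP `|x| eta.
  rewrite logclampE_small// tent_one// mulr1; apply: le_trans xg.
  by rewrite ler_expR gerDr; exact: ln_le0.
apply: (@le_trans _ _ (expR (logclamp eta K x))).
  rewrite ler_expR gerBl mulr_ge0//.
  by have /andP[] := tent_bounds eta x.
have [xK|xK] := leP `|x| K; first by rewrite logclampE_mid ?(ltW xe)// lnK.
by rewrite logclampE_large ?(ltW xK)// lnK ?posrE// ltW.
Qed.

(** Bounded through the largest factor. This decouples matrices of arbitrary joint law and explains
    the powers [l] in condition (C). *)
Lemma prod_le_sum_pow l (y : 'I_l -> R) : (0 < l)%N -> (forall i, 0 <= y i) ->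
  \prod_i y i <= \sum_i y i ^+ l.
Proof.
move=> l0 y0; pose i0 := [arg max_(i > Ordinal l0) y i]%O.
have ymax i : y i <= y i0 by rewrite /i0; case: arg_maxP => //= j _; apply.
apply: (@le_trans _ _ (y i0 ^+ l)).
  apply: (@le_trans _ _ (\prod_(i < l) y i0)).
    by apply: ler_prod => i _; rewrite y0 ymax.
  by rewrite prodr_const card_ord.
rewrite (bigD1 i0)//= lerDl; apply: sumr_ge0 => i _; exact: exprn_ge0.
Qed.

(** Split at x = e^(t/q): above this value, x^q >= e^t. *)
Lemma young_exp (x t q : R) : 0 <= x -> 0 < q ->
  x <= expR (- t) * x `^ (1 + q) + expR (t / q).
Proof.
move=> x0 q0; have [xt|xt] := leP x (expR (t / q)).
  by rewrite (le_trans xt)// lerDr mulr_ge0 ?expR_ge0 ?powR_ge0.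
have xp : 0 < x by exact: lt_trans (expR_gt0 _) xt.
rewrite (@le_trans _ _ (expR (- t) * x `^ (1 + q)))//; last by rewrite lerDl expR_ge0.
rewrite powRD; last by rewrite (gt_eqF xp) implybT.
rewrite powRr1// mulrCA ler_peMr//.
rewrite expRN ler_pdivlMl ?expR_gt0// mulr1.
have -> : expR t = expR (t / q) `^ q by rewrite -expRM divfK// gt_eqF.
by apply: ge0_ler_powR; rewrite ?nnegrE ?expR_ge0 ?(ltW q0) ?(ltW xt).
Qed.

End Determinant.

Section ExpectationBounds.
Context (R : realType) d (T : measurableType d) (P : probability T R).
Local Open Scope ereal_scope.

Lemma expectation_lower (D : T -> R) (E : set T) (c q : R) : measurable_fun setT D ->
  (forall w, 0 <= D w)%R -> measurable E -> (0 <= c)%R -> (forall w, E w -> c <= D w)%R ->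
  (q <= pr P E)%R -> (c * q)%:E <= \int[P]_w (D w)%:E.
Proof.
move=> mD D0 mE c0 ED qE.
apply: (@le_trans _ _ (\int[P]_w (c%:E * (\1_E w)%:E))).
  rewrite ge0_integralZl_EFin//; last by apply/measurable_EFinP; apply: measurable_indic.
  rewrite integral_indic// setIT EFinM; apply: lee_wpmul2l; first by rewrite lee_fin.
  apply: (@le_trans _ _ (pr P E)%:E); first by rewrite lee_fin.
  by rewrite -(prE P mE).
apply: ge0_le_integral => //.
- by move=> w _; rewrite -EFinM lee_fin mulr_ge0.
- under eq_fun do rewrite -EFinM; apply/measurable_EFinP; apply: measurable_funM => //.
- by apply/measurable_EFinP.
- move=> w _; rewrite -EFinM lee_fin indicE; case: (boolP (w \in _)) => [|_].
    by rewrite inE/= mulr1; exact: ED.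
  by rewrite mulr0.
Qed.

(** Off [E] the product of the [D i] is at most e^(sum of a) times the product of the [Y i]; on [E]
    it is at most the sum of the [D i ^+ l], to which [young_exp] is applied. Only marginal
    expectations remain, and [t] is free to balance [ED] against [pb]. *)
Lemma expectation_upper l (D Y : 'I_l -> T -> R) (a : 'I_l -> R) (E : set T)
    (EY ED t q pb : R) : (0 < l)%N ->
  (forall i, measurable_fun setT (D i)) -> (forall i, measurable_fun setT (Y i)) ->
  (forall i w, 0 <= D i w)%R -> (forall i w, 0 <= Y i w)%R -> measurable E ->
  (forall i w, ~ E w -> D i w <= expR (a i) * Y i w)%R -> (0 < q)%R ->
  (forall i, \int[P]_w (Y i w ^+ l)%:E <= EY%:E) ->
  (forall i, \int[P]_w (D i w `^ (l%:R * (1 + q)))%:E <= ED%:E) ->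
  (pr P E <= pb)%R ->
  \int[P]_w (\prod_i D i w)%:E <=
    (expR (\sum_i a i) * (l%:R * EY) +
     l%:R * (expR (- t) * ED + expR (t / q) * pb))%:E.
Proof.
move=> l0 mD mY D0 Y0 mE DY q0 hEY hED hpb.
have mYl i : measurable_fun setT (fun w => Y i w ^+ l)%R by exact: measurable_funX.
have mDq i : measurable_fun setT (fun w => D i w `^ (l%:R * (1 + q)))%R.
  by apply: (measurableT_comp (measurable_powR _)).
pose bound w : R := (expR (\sum_i a i) * (\sum_i Y i w ^+ l) +
  \sum_i (expR (- t) * D i w `^ (l%:R * (1 + q)) + expR (t / q) * \1_E w))%R.
have pw w : (\prod_i D i w <= bound w)%R.
  rewrite /bound indicE; have [wE|wE] := boolP (w \in E).
    apply: (@le_trans _ _ (\sum_i D i w ^+ l)%R); first exact: prod_le_sum_pow.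
    rewrite -[leLHS]add0r; apply: lerD.
      by rewrite mulr_ge0 ?expR_ge0//; apply: sumr_ge0 => i _; exact: exprn_ge0.
    apply: ler_sum => i _; rewrite mulr1 powRrM powR_mulrn//.
    by apply: young_exp => //; exact: exprn_ge0.
  rewrite -[leLHS]addr0; apply: lerD; last first.
    by apply: sumr_ge0 => i _; rewrite mulr0 addr0 mulr_ge0 ?expR_ge0 ?powR_ge0.
  apply: (@le_trans _ _ (\prod_i (expR (a i) * Y i w))%R).
    apply: ler_prod => i _; rewrite D0/=; apply: DY.
    by rewrite notin_setE in wE.
  rewrite big_split/= -expR_sum; apply: ler_wpM2l; first exact: expR_ge0.
  exact: prod_le_sum_pow.
apply: (@le_trans _ _ (\int[P]_w (bound w)%:E)).
  apply: ge0_le_integral => //.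
  - by move=> w _; rewrite lee_fin; apply: prodr_ge0.
  - by apply/measurable_EFinP; apply: measurable_prod.
  - apply/measurable_EFinP; apply: measurable_funD.
      by apply: measurable_funM => //; apply: measurable_sum.
    apply: measurable_sum => i; apply: measurable_funD; first by apply: measurable_funM.
    by apply: measurable_funM.
  - by move=> w _; rewrite lee_fin.
have bE w : (bound w)%:E = (expR (\sum_i a i))%:E * (\sum_i (Y i w ^+ l)%:E) +
   \sum_i ((expR (- t))%:E * (D i w `^ (l%:R * (1 + q)))%:E + (expR (t / q))%:E * (\1_E w)%:E).
  by rewrite /bound EFinD EFinM -!sumEFin.
under eq_integral do rewrite bE.
have m1 : measurable_fun setT (fun w => \sum_i (Y i w ^+ l)%:E).
  by apply: emeasurable_sum => i; apply/measurable_EFinP.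
have m2 i : measurable_fun setT (fun w => (expR (- t))%:E * (D i w `^ (l%:R * (1 + q)))%:E).
  under eq_fun do rewrite -EFinM.
  by apply/measurable_EFinP; apply: measurable_funM.
have m3 : measurable_fun setT (fun w => (expR (t / q))%:E * (\1_E w)%:E).
  under eq_fun do rewrite -EFinM.
  by apply/measurable_EFinP; apply: measurable_funM.
have p1 w : 0 <= \sum_i (Y i w ^+ l)%:E.
  by apply: sume_ge0 => i _; rewrite lee_fin exprn_ge0.
have p2 i w : 0 <= (expR (- t))%:E * (D i w `^ (l%:R * (1 + q)))%:E.
  by rewrite -EFinM lee_fin mulr_ge0 ?expR_ge0 ?powR_ge0.
have p3 w : 0 <= (expR (t / q))%:E * (\1_E w)%:E.
  by rewrite -EFinM lee_fin mulr_ge0 ?expR_ge0.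
rewrite ge0_integralD//; last 4 first.
- by move=> w _; apply: mule_ge0; [rewrite lee_fin expR_ge0|].
- exact: emeasurable_funM.
- by move=> w _; apply: sume_ge0 => i _; apply: adde_ge0.
- by apply: emeasurable_sum => i; apply: emeasurable_funD.
rewrite EFinD; apply: leeD.
  rewrite ge0_integralZl_EFin ?expR_ge0// EFinM; apply: lee_wpmul2l.
    by rewrite lee_fin expR_ge0.
  rewrite ge0_integral_sum//; last first.
  - by move=> i w _; rewrite lee_fin exprn_ge0.
  - by move=> i; apply/measurable_EFinP.
  apply: (@le_trans _ _ (\sum_(i < l) EY%:E)); first by apply: lee_sum => i _.
  by rewrite sumEFin sumr_const card_ord mulr_natl.
rewrite ge0_integral_sum//; last 2 first.
- by move=> i; apply: emeasurable_funD.
- by move=> i w _; apply: adde_ge0.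
apply: (@le_trans _ _ (\sum_(i < l) (expR (- t) * ED + expR (t / q) * pb)%:E)); last first.
  by rewrite sumEFin sumr_const card_ord mulr_natl.
apply: lee_sum => i _; rewrite ge0_integralD// EFinD; apply: leeD.
  rewrite ge0_integralZl_EFin ?expR_ge0//; last 2 first.
  - by move=> w _; rewrite lee_fin powR_ge0.
  - by apply/measurable_EFinP.
  by rewrite EFinM; apply: lee_wpmul2l; [rewrite lee_fin expR_ge0|exact: hED].
rewrite ge0_integralZl_EFin ?expR_ge0//; last by apply/measurable_EFinP; apply: measurable_indic.
rewrite integral_indic// setIT EFinM; apply: lee_wpmul2l; first by rewrite lee_fin expR_ge0.
apply: (@le_trans _ _ (pr P E)%:E); last by rewrite lee_fin.
by rewrite -(prE P mE).
Qed.

End ExpectationBounds.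

(** * Asymptotics in the size of the matrix *)

Section Asymptotics.
Variable R : realType.
Implicit Types a b e c : R.

Lemma near_ge_nat c : \forall N \near \oo, c <= N%:R.
Proof.
exists (Num.truncn `|c|).+1 => // n /= hn.
apply: (le_trans (ler_norm c)).
have /andP[_ h] := truncn_itv (normr_ge0 c).
by apply: (le_trans (ltW h)); rewrite ler_nat.
Qed.

Lemma near_powR_ge a c : 0 < a -> \forall N \near \oo, c <= N%:R `^ a.
Proof.
move=> a0; near=> N.
have N1 : 1 <= N%:R :> R by near: N; exact: near_ge_nat.
have [c0|c0] := leP c 0; first by rewrite (le_trans c0)// powR_ge0.
have hN : expR (ln c / a) <= N%:R by near: N; exact: near_ge_nat.
have N0 : 0 < N%:R :> R by exact: lt_le_trans N1.
rewrite /powR gt_eqF// -[leLHS]lnK ?posrE// ler_expR mulrC -ler_pdivrMr//.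
by rewrite -ler_expR lnK.
Unshelve. all: by end_near. Qed.

Lemma near_powRN_le a e : 0 < a -> 0 < e -> \forall N \near \oo, N%:R `^ (- a) <= e.
Proof.
move=> a0 e0; near=> N.
have h : e^-1 <= N%:R `^ a by near: N; exact: near_powR_ge.
rewrite powRN -[leRHS]invrK lef_pV2 ?posrE ?invr_gt0//.
by apply: lt_le_trans h; rewrite invr_gt0.
Unshelve. all: by end_near. Qed.

Lemma near_ln_le a e : 0 < a -> 0 < e -> \forall N \near \oo, ln N%:R <= e * N%:R `^ a.
Proof.
move=> a0 e0; have a2 : 0 < a / 2 by rewrite divr_gt0.
near=> N.
have N1 : 1 <= N%:R :> R by near: N; exact: near_ge_nat.
have N0 : 0 < N%:R :> R by exact: lt_le_trans N1.
have h : 2 / a / e <= N%:R `^ (a / 2) by near: N; exact: near_powR_ge.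
have p0 : 0 < N%:R `^ (a / 2) by rewrite powR_gt0.
have -> : N%:R `^ a = N%:R `^ (a / 2) * N%:R `^ (a / 2).
  by rewrite -powRD ?(gt_eqF N0) ?implybT//; congr (_ `^ _); lra.
have hl : a / 2 * ln N%:R <= N%:R `^ (a / 2).
  by rewrite -ln_powR; apply: (le_trans (ln_le_subr1 p0)); rewrite gerBl.
rewrite ler_pdivrMr// in h.
have : ln N%:R <= 2 / a * N%:R `^ (a / 2).
  rewrite -(ler_pM2l a2) mulrA.
  by have -> : a / 2 * (2 / a) = 1; [field; rewrite gt_eqF|rewrite mul1r].
move=> /le_trans; apply; rewrite mulrA (mulrC e); apply: ler_wpM2r => //; exact: ltW.
Unshelve. all: by end_near. Qed.

Lemma powR_add (x : R) a b : 0 < x -> x `^ a * x `^ b = x `^ (a + b).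
Proof. by move=> x0; rewrite powRD// (gt_eqF x0) implybT. Qed.

Lemma lne_le_expR (c x : R) (e : \bar R) : 0 < c ->
  (c^-1%:E * lne e <= x%:E)%E -> (e <= (expR (c * x))%:E)%E.
Proof.
move=> c0; case: e => [r| |]; last by rewrite leNye.
  have [r0|r0] := leP r 0.
    by move=> _; rewrite lee_fin (le_trans r0)// expR_ge0.
  rewrite lne_EFin// -EFinM !lee_fin ler_pdivrMl// => h.
  by rewrite -[leLHS]lnK ?posrE// ler_expR.
by rewrite /= gt0_muley ?lte_fin ?invr_gt0.
Qed.

Lemma lne_ge_of_expR (c x : R) (e : \bar R) : 0 < c ->
  ((expR (c * x))%:E <= e)%E -> (x%:E <= c^-1%:E * lne e)%E.
Proof.
move=> c0; case: e => [r| |]; last by rewrite leeNy_eq.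
  rewrite lee_fin => h; have r0 : 0 < r by apply: lt_le_trans h; exact: expR_gt0.
  by rewrite lne_EFin// -EFinM lee_fin ler_pdivlMl// -ler_expR lnK.
by rewrite /= gt0_muley ?leey// lte_fin invr_gt0.
Qed.

Lemma lne_le_of_expR (c x : R) (e : \bar R) : 0 < c ->
  (e <= (expR (c * x))%:E)%E -> (c^-1%:E * lne e <= x%:E)%E.
Proof.
move=> c0; case: e => [r| |]; last 2 first.
- by rewrite leye_eq.
- by rewrite le0_lneNy// => _; rewrite gt0_muleNy ?leNye// lte_fin invr_gt0.
rewrite lee_fin => h; have [r0|r0] := leP r 0.
  by rewrite le0_lneNy ?lee_fin// gt0_muleNy ?leNye// lte_fin invr_gt0.
by rewrite lne_EFin// -EFinM lee_fin ler_pdivrMl// -ler_expR lnK.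
Qed.

Lemma limn_esup_lty (u : nat -> \bar R) : (limn_esup u < +oo)%E ->
  exists C : R, \forall N \near \oo, (u N <= C%:E)%E.
Proof.
rewrite /limn_esup /limf_esup => /ereal_inf_lt[_ [V FV <-] hV].
have [C hC] : exists C : R, (ereal_sup [set u x | x in V] <= C%:E)%E.
  case: (ereal_sup _) hV => [r| |] // _; first by exists r.
  by exists 0; rewrite leNye.
exists C; apply: filterS FV => N VN; apply: le_trans hC.
by apply: ereal_sup_ubound; exists N.
Qed.

End Asymptotics.

Section Arithmetic.
Variable R : realFieldType.

(** The four facts of this section are the linear steps of [tail_asymptotic], with the powers of N
    replaced by variables. *)
Lemma tail_absorb (x y z : R) : x <= y -> y <= 1 / 5 * z -> 4 * x + y <= z.
Proof. by lra. Qed.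

Lemma double_le (x y z : R) : x * y <= x * (2 * z) -> 2 * x * y <= 4 * (x * z).
Proof. by lra. Qed.

Lemma deviation_le (a x y z : R) : a <= 4 * x + 4 * y -> x <= 1 / 16 -> y <= 1 / 16 ->
  1 <= z -> 2 * z + a <= 3 * z.
Proof. by lra. Qed.

Lemma total_deviation_lt (a b x y z t e : R) : 0 < e -> a <= 4 * x + 4 * y -> b <= 3 * z ->
  x <= e / 30 -> y <= e / 30 -> z <= e / 30 -> t <= e / 30 ->
  2 * a + b + (y + 2 * t) < e.
Proof. by lra. Qed.

End Arithmetic.

(** * Concentration for one sequence of matrices *)

Section OneMatrix.
Context (R : realType) (kappa : R) (d : nat -> measure_display)
  (Omega : forall N : nat, measurableType (d N)) (P : forall N : nat, probability (Omega N) R)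
  (M : nat -> nat) (X : forall N : nat, 'I_(M N) -> Omega N -> R)
  (Phi : forall N : nat, 'rV[R]_(M N) -> 'M[R]_N) (mu : nat -> probability R R).
Arguments X : clear implicits.
Arguments Phi : clear implicits.
Hypothesis kappa_gt0 : 0 < kappa.
Hypothesis M_gt0 : forall N, (0 < N)%N -> (0 < M N)%N.
Hypothesis mX : forall N k, measurable_fun setT (X N k).
Hypothesis Phi_sym : forall N x, (0 < N)%N -> (Phi N x)^T = Phi N x.
Hypothesis hI : forall N, (0 < N)%N -> independent_RVs (P N) (X N).
Hypothesis hM_lip : forall N, (0 < N)%N -> (lip_norm2 (Phi N) < +oo)%E.
Hypothesis hM_conv : forall N, (0 < N)%N ->
  forall A : set 'M[R]_N, (forall T, A T -> T^T = T) ->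
    @convex_set R 'M[R]_N A -> @convex_set R 'rV[R]_(M N) (Phi N @^-1` A).
Hypothesis hE_dBL : forall N, (0 < N)%N ->
  (dBL (mean_measure (P N) (fun w => empirical_measure (Phi N (\row_k X N k w)))) (mu N)
    <= (N%:R `^ (- kappa))%:E)%E.
Hypothesis hE_supp : exists K : set R, compact K /\
  forall N, (0 < N)%N -> mu N (~` K) = 0%E.
Hypothesis hE_density : forall N, (0 < N)%N -> exists f : R -> R,
  has_density_on `]- kappa, kappa[ (mu N) f /\
  forall x : R, x != 0 -> `|x| < kappa -> f x < kappa^-1 * `|x| `^ (- 1 + kappa).
Hypothesis hC_gap : forall eps : R, 0 < eps ->
  P N [set w | forall x, eigenvalue (Phi N (\row_k X N k w)) x ->
    ~ (- expR (- (N%:R `^ eps)) <= x <= expR (- (N%:R `^ eps)))] @[N --> \oo] --> 1%E.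
Hypothesis hS :
  (((N%:R * ln N%:R)^-1)%:E *
    lne (P N [set w |
      ((N%:R `^ (- kappa))%:E <
       dKS (empirical_measure (Phi N (\row_k X N k w)))
           (empirical_measure (Phi N
             (\row_k cut1 ((N%:R `^ (- kappa))%:E / lip_norm2 (Phi N)) (X N k w)))))%E]))%E
    @[N --> \oo] --> -oo%E.
Variable eps : R.
Arguments mX : clear implicits.
Hypothesis eps_gt0 : 0 < eps.
Hypothesis eps1 : eps < 1.
Hypothesis eps2 : eps < kappa / 2.
Hypothesis eps3 : eps < kappa ^+ 2 / 2.

Let H N w := Phi N (\row_k X N k w).
Arguments H : clear implicits.
(* The Lipschitz constant N^(kappa/2) of [logclamp] at this level is beaten by the
   N^-kappa of (E) and (S), while [mu] has mass O(N^(-kappa^2/2)) below it. *)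
Definition lo_cut (N : nat) : R := N%:R `^ (- (kappa / 2)).
Definition hi_cut (N : nat) : R := expR (N%:R `^ eps).
Definition log_stat (N : nat) (w : Omega N) : R :=
  N%:R^-1 * trace_fun (logclamp (lo_cut N) (hi_cut N)) (Phi N (\row_k X N k w)).
Arguments log_stat : clear implicits.
Definition log_pot (N : nat) : R := logpot (mu N) (hi_cut N) (lo_cut N).

Lemma measurable_H_eigenvalue N : (0 < N)%N ->
  forall j, measurable_fun setT (fun w => tnth (eigenvalues (H N w)) j).
Proof.
move=> N0; exact: (measurable_model_eigenvalue (fun x => Phi_sym x N0) (hM_lip N0) (M_gt0 N0) (mX N)).
Qed.

Lemma lo_cut_gt0 N : (0 < N)%N -> 0 < lo_cut N.
Proof. by move=> N0; rewrite powR_gt0// ltr0n. Qed.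

Lemma lo_cut_le1 N : (0 < N)%N -> lo_cut N <= 1.
Proof.
move=> N0; rewrite /lo_cut powRN invf_le1 ?powR_gt0 ?ltr0n//.
rewrite -[leLHS](powRr0 N%:R); apply: ler_powR; first by rewrite ler1n.
by rewrite divr_ge0// ltW.
Qed.

Lemma hi_cut_ge1 N : 1 <= hi_cut N.
Proof. by rewrite -expR0 ler_expR powR_ge0. Qed.

Lemma lo_cut_le_hi_cut N : (0 < N)%N -> lo_cut N <= hi_cut N.
Proof. by move=> N0; apply: (le_trans (lo_cut_le1 N0)); exact: hi_cut_ge1. Qed.

Definition ks_event (N : nat) : set (Omega N) :=
  [set w | ((N%:R `^ (- kappa))%:E < dKS (empirical_measure (Phi N (\row_k X N k w)))
    (empirical_measure (Phi N
      (\row_k cut1 ((N%:R `^ (- kappa))%:E / lip_norm2 (Phi N)) (X N k w)))))%E].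
Arguments ks_event : clear implicits.

Lemma dKS_asymptotic (A : R) : \forall N \near \oo,
  pr (P N) (ks_event N) <= expR (- (A * (N%:R * ln N%:R))).
Proof.
have /cvgeNyPle/(_ (- A)) hA := hS.
near=> N.
have N2 : 2 <= N%:R :> R by near: N; exact: near_ge_nat.
have N0 : (0 < N)%N by rewrite -(ltr_nat R); apply: lt_le_trans N2.
have n0 : 0 < N%:R :> R by rewrite ltr0n.
have l0 : 0 < ln N%:R :> R by rewrite ln_gt0//; lra.
have c0 : 0 < N%:R * ln N%:R :> R by rewrite mulr_gt0.
have mE : measurable (ks_event N).
  apply: (measurable_dKS N0 (powR_ge0 _ _) (measurable_H_eigenvalue N0)).
  apply: (measurable_model_eigenvalue (fun x => Phi_sym x N0) (hM_lip N0) (M_gt0 N0)) => k.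
  apply: measurableT_comp; first exact: measurable_cut1.
  exact: mX.
rewrite -lee_fin -(prE (P N) mE) mulrC -mulrN.
apply: (lne_le_expR c0); near: N; exact: hA.
Unshelve. all: by end_near. Qed.

(** [tail_bound] with r = N^(-kappa), eta = N^(-kappa/2), s = N^(1 - kappa/8), u = N^(1 + kappa/2)
    and B = N^eps. The condition on u holds with the slack N^(kappa/4) >= 576, and u exceeds every
    multiple of N log N. The deviation is made of multiples of N^(-kappa/8), N^(-(kappa - eps)),
    N^(-(1 - eps)) and N^(-kappa/2), all tending to 0. *)
Lemma tail_asymptotic (A delta : R) : 0 < delta -> \forall N \near \oo,
  pr (P N) [set w | delta <= `|log_stat N w - log_pot N|] <= expR (- (A * (N%:R * ln N%:R))).
Proof.
(* A rate of at least 1 makes the exceptional probability at most 1/N, which beats the height N^eps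
   of the clamp. *)
move=> delta0; pose A1 := Num.max A 1.
have A11 : 1 <= A1 by rewrite le_max lexx orbT.
have AA1 : A <= A1 by rewrite le_max lexx.
have k2 : 0 < kappa / 2 by rewrite divr_gt0.
have k4 : 0 < kappa / 4 by rewrite divr_gt0.
have k8 : 0 < kappa / 8 by rewrite divr_gt0.
have ke : 0 < kappa - eps by have := eps2; have := kappa_gt0; lra.
have e1 : 0 < 1 - eps by rewrite subr_gt0.
have d30 : 0 < delta / 30 by rewrite divr_gt0.
have A2 : 0 < A1 + 2 by lra.
have A20 : 0 < (A1 + 2)^-1 by rewrite invr_gt0.
have two1 : 0 < 1 / 16 :> R by rewrite divr_gt0.
have k2i : 0 < (kappa / 2)^-1 by rewrite invr_gt0.
near=> N.
have N5 : 5 <= N%:R :> R by near: N; exact: near_ge_nat.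
have n0 : 0 < N%:R :> R by apply: lt_le_trans N5.
have N0 : (0 < N)%N by rewrite -(ltr_nat R).
have N1 : 1 <= N%:R :> R by lra.
have l1 : 1 <= ln N%:R :> R.
  rewrite -ler_expR lnK ?posrE//; near: N; exact: near_ge_nat.
pose p a : R := N%:R `^ a.
have p0 a : 0 < p a by rewrite powR_gt0.
have pD a b : p a * p b = p (a + b) by exact: powR_add.
have pN a : p (- a) = (p a)^-1 by exact: powRN.
have p1 : p 1 = N%:R by rewrite /p powRr1// ltW.
have hS' : pr (P N) (ks_event N) <= expR (- ((A1 + 1) * (N%:R * ln N%:R))).
  by near: N; exact: dKS_asymptotic.
have h576 : 576 <= p (kappa / 4) by rewrite /p; near: N; exact: near_powR_ge.
have hl1 : ln N%:R <= (kappa / 2)^-1 * p eps by rewrite /p; near: N; exact: near_ln_le.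
have hl2 : ln N%:R <= (A1 + 2)^-1 * p (kappa / 2) by rewrite /p; near: N; exact: near_ln_le.
have q1 : p (- (kappa / 8)) <= delta / 30 by rewrite /p; near: N; exact: near_powRN_le.
have q1' : p (- (kappa / 8)) <= 1 / 16 by rewrite /p; near: N; exact: near_powRN_le.
have q2 : p (- (kappa - eps)) <= delta / 30 by rewrite /p; near: N; exact: near_powRN_le.
have q2' : p (- (kappa - eps)) <= 1 / 16 by rewrite /p; near: N; exact: near_powRN_le.
have q3 : p (- (1 - eps)) <= delta / 30 by rewrite /p; near: N; exact: near_powRN_le.
have q4 : p (- (kappa / 2)) <= delta / 30 by rewrite /p; near: N; exact: near_powRN_le.
pose L : R := N%:R * ln N%:R.
have lnL : ln N%:R <= L by rewrite /L ler_peMl// (le_trans ler01).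
have L0 : 0 <= L by exact: le_trans (le_trans ler01 l1) lnL.
have eL : expR (- L) <= p (- 1).
  rewrite pN p1 -[X in _ <= X^-1]lnK ?posrE// -expRN ler_expR lerN2//.
have p5 : p (- 1) <= 1 / 5 by rewrite pN p1 div1r lef_pV2 ?posrE//.
pose u : R := N%:R * p (kappa / 2).
have uL : (A1 + 2) * L <= u.
  rewrite /L /u mulrCA; apply: ler_wpM2l; first exact: ltW.
  by rewrite -ler_pdivlMl.
have u0 : 0 < u by rewrite mulr_gt0.
pose p3 : R := expR (- ((A1 + 1) * L)).
(* (S) was used at rate A1 + 1: the spare factor e^(-L) <= 1/5 pays for the five terms. *)
have pA1 : 4 * expR (- u) + p3 <= expR (- (A1 * L)).
  have e3 : expR (- u) <= p3.
    rewrite ler_expR lerN2; apply: le_trans uL; apply: ler_wpM2r => //.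
    by rewrite lerD2l ler1n.
  have p3E : p3 = expR (- L) * expR (- (A1 * L)).
    by rewrite -expRD; congr expR; ring.
  have : p3 <= 1 / 5 * expR (- (A1 * L)).
    rewrite p3E; apply: ler_wpM2r; first exact: expR_ge0.
    exact: le_trans p5.
  exact: tail_absorb.
have pL : expR (- (A1 * L)) <= p (- 1).
  apply: le_trans eL; rewrite ler_expR lerN2 ler_peMl//.
have r0 : 0 < p (- kappa) by [].
have s0 : 0 < N%:R * p (- (kappa / 8)) by rewrite mulr_gt0.
have pe0 : 0 < p eps by [].
have lnK : ln (hi_cut N) = p eps by rewrite expRK.
have lneta : ln (lo_cut N) = - (kappa / 2 * ln N%:R) by rewrite ln_powR mulNr.
have hl1' : kappa / 2 * ln N%:R <= p eps.
  by rewrite -ler_pdivlMl// ?divr_gt0.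
have pe1 : 1 <= p eps.
  by rewrite -[leLHS](powRr0 N%:R); apply: ler_powR => //; exact: ltW.
have fB x : `|logclamp (lo_cut N) (hi_cut N) x| <= p eps.
  have /andP[b1 b2] := logclamp_bounds x (lo_cut_gt0 N0) (lo_cut_le_hi_cut N0).
  rewrite ler_norml -{2}lnK b2 andbT; apply: le_trans b1.
  by rewrite lneta lerN2.
have hu : u * (576 * N%:R * p (- kappa) ^+ 2) <=
    (N%:R * p (- (kappa / 8))) ^+ 2 * lo_cut N ^+ 2.
  have e2 : p (- kappa) ^+ 2 = p (- (kappa * 2)).
    by rewrite expr2 pD; congr p; field.
  have e3 : lo_cut N ^+ 2 = p (- kappa).
    by rewrite expr2 -/(p _) pD; congr p; field.
  have e4 : p (- (kappa / 8)) ^+ 2 = p (- (kappa / 4)).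
    by rewrite expr2 pD; congr p; field.
  rewrite /u e2 e3 exprMn e4.
  have -> : N%:R * p (kappa / 2) * (576 * N%:R * p (- (kappa * 2))) =
      576 * (N%:R ^+ 2 * (p (kappa / 2) * p (- (kappa * 2)))) by ring.
  have -> : N%:R ^+ 2 * p (- (kappa / 4)) * p (- kappa) =
      p (kappa / 4) * (N%:R ^+ 2 * (p (kappa / 2) * p (- (kappa * 2)))).
    have e5 : p (- (kappa / 4)) * p (- kappa) = p (kappa / 4) * (p (kappa / 2) * p (- (kappa * 2))).
      by rewrite !pD; congr p; field.
    by rewrite -mulrA e5; ring.
  apply: ler_wpM2r => //; first by rewrite !mulr_ge0 ?(ltW (p0 _)).
have keE : p (- kappa) * p eps = p (- (kappa - eps)) by rewrite pD; congr p; field.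
pose a : R := 4 * (N%:R * p (- (kappa / 8))) / N%:R +
  2 * p (- kappa) * (ln (hi_cut N) - ln (lo_cut N)).
have aE : a <= 4 * p (- (kappa / 8)) + 4 * p (- (kappa - eps)).
  rewrite /a; apply: lerD.
    have -> : 4 * (N%:R * p (- (kappa / 8))) / N%:R = 4 * p (- (kappa / 8)); last exact: lexx.
    by field; rewrite gt_eqF.
  rewrite -keE lnK lneta opprK.
  have : p (- kappa) * (p eps + kappa / 2 * ln N%:R) <= p (- kappa) * (2 * p eps).
    by apply: ler_wpM2l; [exact: ltW|rewrite (mulr_natl (p eps)) mulr2n lerD2l].
  exact: double_le.
have a0 : 0 <= a.
  apply: addr_ge0; first by rewrite divr_ge0 ?mulr_ge0 ?(ltW (p0 _)) ?(ltW n0).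
  rewrite mulr_ge0 ?mulr_ge0 ?(ltW (p0 _))// subr_ge0 ler_ln ?posrE ?lo_cut_gt0//.
    exact: lo_cut_le_hi_cut.
  exact: expR_gt0.
have pb : (4 * expR (- u) + p3) * (2 * p eps + a) <= 3 * p (- (1 - eps)).
  have -> : 3 * p (- (1 - eps)) = p (- 1) * (3 * p eps).
    by rewrite mulrCA pD; congr (_ * p _); field.
  apply: ler_pM.
  - by rewrite addr_ge0 ?mulr_ge0 ?expR_ge0.
  - by rewrite addr_ge0// mulr_ge0// ltW.
  - exact: le_trans pL.
  - exact: deviation_le aE q1' q2' pe1.
have Br : (p eps + 2 / lo_cut N) * p (- kappa) = p (- (kappa - eps)) + 2 * p (- (kappa / 2)).
  rewrite mulrDl mulrC keE; congr (_ + _).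
  by rewrite /lo_cut powRN invrK -/(p _) -mulrA pD; congr (_ * p _); field.
have := @tail_bound R _ _ (P N) _ _ (Phi N) (fun x => Phi_sym x N0) (hM_lip N0) (hM_conv N0)
  (M_gt0 N0) N0 (X N) (mX N) (hI N0) (mu N) (p (- kappa)) (lo_cut N) (hi_cut N) (p eps)
  (N%:R * p (- (kappa / 8))) u p3 delta r0 (lo_cut_gt0 N0) (lo_cut_le_hi_cut N0) s0 u0 hu hS' pe0 fB
  (hE_dBL N0).
rewrite -/a => /(_ _ _)/le_trans; apply.
- by apply: (le_lt_trans pA1); apply: (le_lt_trans pL); apply: (le_lt_trans p5); rewrite ltr_pdivrMr// mul1r ltr1n.
- by rewrite Br; exact: total_deviation_lt delta0 aE pb q1 q2 q3 q4.
apply: (le_trans pA1); rewrite ler_expR lerN2; exact: ler_wpM2r.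
Unshelve. all: by end_near. Qed.

End OneMatrix.

(** * The approximating measures and the small eigenvalues *)

Section LimitingMeasure.
Context (R : realType) (kappa : R) (mu : nat -> probability R R).
Hypothesis kappa_gt0 : 0 < kappa.
Hypothesis hE_supp : exists K : set R, compact K /\
  forall N, (0 < N)%N -> mu N (~` K) = 0%E.
Hypothesis hE_density : forall N, (0 < N)%N -> exists f : R -> R,
  has_density_on `]- kappa, kappa[ (mu N) f /\
  forall x : R, x != 0 -> `|x| < kappa -> f x < kappa^-1 * `|x| `^ (- 1 + kappa).
Variable eps : R.
Hypothesis eps_gt0 : 0 < eps.

Lemma common_support : exists C : R, forall N, (0 < N)%N -> mu N (~` centered C) = 0%E.
Proof.
have [K [cK hK]] := hE_supp.
have [C0 [_ hC0]] := compact_bounded cK.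
exists (C0 + 1) => N N0.
have mK : measurable K.
  by apply: closed_measurable; apply: compact_closed => //; exact: Rhausdorff.
apply/eqP; rewrite eq_le measure_ge0 andbT -(hK N N0).
apply: le_measure.
- by rewrite inE; apply: measurableC; exact: measurable_centered.
- by rewrite inE; apply: measurableC.
- move=> x xC Kx; apply: xC; apply/centeredP.
  by apply: (hC0 (C0 + 1)) => //; rewrite ltrDl.
Qed.

Definition limit_potential (N : nat) : R := fine (\int[mu N]_x lne (`|x|%R)%:E).

(** [log_integral] at the moving level N^(-kappa/2), with error O(N^(-kappa^2/2)); the upper level
    e^(N^eps) eventually exceeds the common support. *)
Lemma limit_potential_asymptotic (delta : R) : 0 < delta -> \forall N \near \oo,
  (\int[mu N]_x lne (`|x|%R)%:E = (limit_potential N)%:E)%E /\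
  `|log_pot kappa mu eps N - limit_potential N| <= delta.
Proof.
move=> delta0; have [C hC] := common_support.
have k2 : 0 < kappa / 2 by rewrite divr_gt0.
have k22 : 0 < kappa / 2 * kappa by rewrite mulr_gt0.
have lc0 : 0 < log_const kappa + 1 by rewrite ltr_wpDl// log_const_ge0.
have dl : 0 < delta / (log_const kappa + 1) by rewrite divr_gt0.
have kk : 0 < kappa / 2 by [].
near=> N.
have N1 : 1 <= N%:R :> R by near: N; exact: near_ge_nat.
have n0 : 0 < N%:R :> R by apply: lt_le_trans N1.
have N0 : (0 < N)%N by rewrite -(ltr_nat R).
have CK : C <= hi_cut eps N.
  have h : C <= N%:R `^ eps by near: N; exact: near_powR_ge.
  by apply: (le_trans h); apply: le_trans (expR_ge1Dx _); rewrite lerDr.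
have ek : lo_cut kappa N < kappa.
  apply: (@le_lt_trans _ _ (kappa / 2)); first by rewrite /lo_cut; near: N; exact: near_powRN_le.
  by rewrite ltr_pdivrMr// ltr_pMr// ltr1n.
have el : N%:R `^ (- (kappa / 2 * kappa)) <= delta / (log_const kappa + 1).
  by near: N; exact: near_powRN_le.
have [f [hd hf]] := hE_density N0.
have K0 : 0 < hi_cut eps N by exact: expR_gt0.
have [v [vE /andP[v1 v2]]] := log_integral kappa_gt0 hd hf CK K0 (hC N N0)
  (lo_cut_gt0 kappa N0) (lo_cut_le_hi_cut kappa_gt0 eps N0) ek.
have vE' : limit_potential N = v by rewrite /limit_potential vE.
rewrite vE'; split => //.
have -> : log_pot kappa mu eps N = logpot (mu N) (hi_cut eps N) (lo_cut kappa N) by [].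
rewrite ger0_norm ?subr_ge0//.
rewrite lerBlDl -lerBlDr; apply: le_trans v1; rewrite lerD2l lerN2.
have -> : lo_cut kappa N `^ kappa = N%:R `^ (- (kappa / 2 * kappa)).
  by rewrite /lo_cut -powRrM mulNr.
apply: (@le_trans _ _ ((log_const kappa + 1) * N%:R `^ (- (kappa / 2 * kappa)))).
  by apply: ler_wpM2r; [exact: powR_ge0|rewrite lerDl].
by rewrite mulrC -ler_pdivlMr.
Unshelve. all: by end_near. Qed.

(** [log_integral] at clamp levels independent of N. The bound ensures that errors of size e^(-N log
    N) are negligible against the main term e^(N v) of the upper estimate. *)
Lemma limit_potential_bounded : exists V : R, forall N, (0 < N)%N ->
  `|limit_potential N| <= V.
Proof.
have [C hC] := common_support.
pose eta := Num.min 1 (kappa / 2); pose K := Num.max C 1.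
have e0 : 0 < eta by rewrite lt_min ltr01 divr_gt0.
have e1 : eta <= 1 by rewrite ge_min lexx.
have K1 : 1 <= K by rewrite le_max lexx orbT.
have K0 : 0 < K by exact: lt_le_trans K1.
have CK : C <= K by rewrite le_max lexx.
have ek : eta < kappa.
  apply: (@le_lt_trans _ _ (kappa / 2)); first by rewrite ge_min lexx orbT.
  by rewrite ltr_pdivrMr// ltr_pMr// ltr1n.
have eK : eta <= K by exact: le_trans K1.
exists (`|ln eta| + `|ln K| + log_const kappa * eta `^ kappa) => N N0.
have [f [hd hf]] := hE_density N0.
have [v [vE /andP[v1 v2]]] := log_integral kappa_gt0 hd hf CK K0 (hC N N0) e0 eK ek.
rewrite /limit_potential vE /=.
have := logpot_norm_le (mu N) e0 eK; rewrite ler_norml => /andP[h1 h2].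
have h3 : 0 <= log_const kappa * eta `^ kappa.
  by rewrite mulr_ge0 ?log_const_ge0 ?powR_ge0.
rewrite ler_norml; apply/andP; split; lra.
Qed.

Section SmallEigenvalues.
Context (d : nat -> measure_display) (Omega : forall N : nat, measurableType (d N))
  (P : forall N : nat, probability (Omega N) R).
Variable H : forall N, Omega N -> 'M[R]_N.
Arguments H : clear implicits.
Hypothesis H_sym : forall N w, (0 < N)%N -> (H N w)^T = H N w.
Hypothesis mH : forall N, (0 < N)%N ->
  forall j, measurable_fun setT (fun w => tnth (eigenvalues (H N w)) j).
Hypothesis hE_dBL : forall N, (0 < N)%N ->
  (dBL (mean_measure (P N) (fun w => empirical_measure (H N w))) (mu N)
    <= (N%:R `^ (- kappa))%:E)%E.
Hypothesis hC_gap : P N [set w | forall x, eigenvalue (H N w) x ->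
    ~ (- expR (- (N%:R `^ eps)) <= x <= expR (- (N%:R `^ eps)))] @[N --> \oo] --> 1%E.
Hypothesis eps2 : eps < kappa / 2.
Hypothesis eps3 : eps < kappa ^+ 2 / 2.

(** The factor N^eps is the logarithmic loss that one small eigenvalue may cause. By [density_mass]
    and (E) the expected fraction of such eigenvalues is O(N^(-kappa^2/2) + N^(-kappa) +
    N^(-kappa/2)), and [eps] lies below all three exponents; each term receives a third of
    [q * delta]. *)
Lemma count_asymptotic (delta q : R) : 0 < delta -> 0 < q -> \forall N \near \oo,
  pr (P N) [set w | delta <= N%:R `^ eps * (N%:R^-1 * trace_fun (tent (lo_cut kappa N)) (H N w))]
    <= q.
Proof.
move=> delta0 q0.
have k2 : 0 < kappa / 2 by rewrite divr_gt0.
have k4 : 0 < kappa / 4 by rewrite divr_gt0.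
pose D := mass_const kappa * 2 `^ kappa.
have D0 : 0 <= D by rewrite mulr_ge0 ?powR_ge0 ?mass_const_ge0.
have D1 : 0 < D + 1 by rewrite ltr_wpDl.
have qd : 0 < q * delta / (3 * (D + 1)) by rewrite divr_gt0 ?mulr_gt0.
have qd' : 0 < q * delta / 3 by rewrite divr_gt0 ?mulr_gt0.
have a1 : 0 < kappa ^+ 2 / 2 - eps by rewrite subr_gt0.
have a2 : 0 < kappa / 2 - eps by rewrite subr_gt0.
have a3 : 0 < kappa - eps by have := kappa_gt0; have := eps2; lra.
near=> N.
have N1 : 1 <= N%:R :> R by near: N; exact: near_ge_nat.
have n0 : 0 < N%:R :> R by apply: lt_le_trans N1.
have N0 : (0 < N)%N by rewrite -(ltr_nat R).
have ek : lo_cut kappa N <= kappa / 4 by rewrite /lo_cut; near: N; exact: near_powRN_le.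
have h1 : N%:R `^ (- (kappa ^+ 2 / 2 - eps)) <= q * delta / (3 * (D + 1)).
  by near: N; exact: near_powRN_le.
have h2 : N%:R `^ (- (kappa / 2 - eps)) <= q * delta / 3 by near: N; exact: near_powRN_le.
have h3 : N%:R `^ (- (kappa - eps)) <= q * delta / 3 by near: N; exact: near_powRN_le.
have pe0 : 0 < N%:R `^ eps by rewrite powR_gt0.
have b0 : 0 < delta / N%:R `^ eps by rewrite divr_gt0.
have e0 := lo_cut_gt0 kappa N0.
have := small_eigenvalues_bound (mH N0) N0 e0 b0 (hE_dBL N0).
rewrite (_ : [set w | delta / N%:R `^ eps <= _] =
  [set w | delta <= N%:R `^ eps * (N%:R^-1 * trace_fun (tent (lo_cut kappa N)) (H N w))]); last first.
  by apply/seteqP; split => w /=; rewrite ler_pdivrMr// mulrC.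
set pp := pr _ _ => hp.
have [f [hd hf]] := hE_density N0.
have e20 : 0 < 2 * lo_cut kappa N by rewrite mulr_gt0.
have e2k : 2 * lo_cut kappa N < kappa by have := kappa_gt0; lra.
have hm := density_mass kappa_gt0 hd hf e20 e2k.
have hmE : mass_const kappa * (2 * lo_cut kappa N) `^ kappa = D * N%:R `^ (- (kappa ^+ 2 / 2)).
  rewrite powRM ?(ltW e0)// mulrA; congr (_ * _).
  by rewrite /lo_cut -powRrM; congr (_ `^ _); ring.
rewrite hmE in hm.
have eiE : (lo_cut kappa N)^-1 * N%:R `^ (- kappa) = N%:R `^ (- (kappa / 2)).
  by rewrite /lo_cut -powRN opprK powR_add//; congr (_ `^ _); field.
have rE : (1 + (lo_cut kappa N)^-1) * N%:R `^ (- kappa) =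
    N%:R `^ (- kappa) + N%:R `^ (- (kappa / 2)) by rewrite mulrDl mul1r eiE.
rewrite rE in hp.
have {hp hm}: delta / N%:R `^ eps * pp <= D * N%:R `^ (- (kappa ^+ 2 / 2)) +
    (N%:R `^ (- kappa) + N%:R `^ (- (kappa / 2))).
  by apply: (le_trans hp); rewrite lerD2r.
move=> /(ler_wpM2l (ltW pe0)).
have -> : N%:R `^ eps * (delta / N%:R `^ eps * pp) = delta * pp by field; rewrite gt_eqF.
rewrite !mulrDr mulrCA !powR_add//.
have -> : eps - kappa ^+ 2 / 2 = - (kappa ^+ 2 / 2 - eps) by rewrite opprB.
have -> : eps - kappa = - (kappa - eps) by rewrite opprB.
have -> : eps - kappa / 2 = - (kappa / 2 - eps) by rewrite opprB.
move=> h; rewrite -(ler_pM2l delta0); apply: (le_trans h).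
have : D * N%:R `^ (- (kappa ^+ 2 / 2 - eps)) <= q * delta / 3.
  apply: (@le_trans _ _ ((D + 1) * (q * delta / (3 * (D + 1))))).
    by apply: ler_pM => //; rewrite ?powR_ge0 ?lerDl.
  rewrite le_eqVlt; apply/orP; left; apply/eqP; field; rewrite gt_eqF//.
move: h2 h3; set x1 := N%:R `^ _; set x2 := N%:R `^ _; set x3 := D * _; lra.
Unshelve. all: by end_near. Qed.

(** The event of (C) expressed by the tuple of eigenvalues, which exhibits it as a finite
    intersection of measurable events. *)
Definition gap_event (N : nat) : set (Omega N) :=
  [set w | forall j, expR (- (N%:R `^ eps)) < `|tnth (eigenvalues (H N w)) j|].
Arguments gap_event : clear implicits.

Lemma measurable_gap_event N : (0 < N)%N -> measurable (gap_event N).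
Proof.
move=> N0; rewrite (_ : gap_event N = \bigcap_(j in [set: 'I_N])
   [set w | expR (- (N%:R `^ eps)) < `|tnth (eigenvalues (H N w)) j|]).
  apply: fin_bigcap_measurable => // j _; apply: measurable_gt.
  by apply: measurableT_comp => //; exact: (mH N0).
by apply/seteqP; split => w h j //=; apply: h.
Qed.

Lemma gap_asymptotic (q : R) : 0 < q -> \forall N \near \oo,
  pr (P N) (~` gap_event N) <= q.
Proof.
move=> q0.
have E N : (0 < N)%N -> [set w | forall x, eigenvalue (H N w) x ->
    ~ (- expR (- (N%:R `^ eps)) <= x <= expR (- (N%:R `^ eps)))] = gap_event N.
  move=> N0; apply/seteqP; split => w /= h.
    move=> j; rewrite ltNge; apply/negP; rewrite ler_norml.
    apply: h; rewrite eigenvalue_eigenvalues ?H_sym//; exact: mem_tnth.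
  move=> x; rewrite eigenvalue_eigenvalues ?H_sym// => /tnthP[j ->].
  by rewrite -ler_norml leNgt => /negP; apply; exact: h.
have /fine_cvgP[_ /cvgrPdist_le/(_ q q0) hq] := hC_gap.
near=> N.
have N1 : 1 <= N%:R :> R by near: N; exact: near_ge_nat.
have N0 : (0 < N)%N by rewrite -(ltr_nat R); apply: lt_le_trans N1.
rewrite (pr_setC (P N) (measurable_gap_event N0)).
have : `|1 - fine (P N [set w | forall x, eigenvalue (H N w) x ->
    ~ (- expR (- (N%:R `^ eps)) <= x <= expR (- (N%:R `^ eps)))])| <= q.
  by near: N; exact: hq.
by rewrite (E N N0) => h; apply: le_trans h; exact: ler_norm.
Unshelve. all: by end_near. Qed.

End SmallEigenvalues.
End LimitingMeasure.

(** * Two-sided bounds for the expected product of determinants *)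

Section DeterminantProduct.
Context (R : realType) (l : nat) (eps : R) (d : nat -> measure_display)
  (Omega : forall N : nat, measurableType (d N)) (P : forall N : nat, probability (Omega N) R).
Variable H : forall N, 'I_l -> Omega N -> 'M[R]_N.
Arguments H : clear implicits.
Variables (eta : nat -> R) (v : nat -> 'I_l -> R).
Hypothesis H_sym : forall N i w, (0 < N)%N -> (H N i w)^T = H N i w.
Hypothesis mH : forall N i, (0 < N)%N ->
  forall j, measurable_fun setT (fun w => tnth (eigenvalues (H N i w)) j).
Hypothesis eta0 : forall N, (0 < N)%N -> 0 < eta N.
Hypothesis eta1 : forall N, (0 < N)%N -> eta N <= 1.

Definition tail_event (delta : R) N i : set (Omega N) :=
  [set w | delta <= `|N%:R^-1 * trace_fun (logclamp (eta N) (hi_cut eps N)) (H N i w) - v N i|].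

Definition crowded_event (delta : R) N i : set (Omega N) :=
  [set w | delta <= N%:R `^ eps * (N%:R^-1 * trace_fun (tent (eta N)) (H N i w))].

Definition overflow N i w : R := \prod_(j < N) (1 + `|tnth (eigenvalues (H N i w)) j| *
  (hi_cut eps N < `|tnth (eigenvalues (H N i w)) j|)%R%:R).

Hypothesis tail_small : forall i (A delta : R), 0 < delta -> \forall N \near \oo,
  pr (P N) (tail_event delta i) <= expR (- (A * (N%:R * ln N%:R))).
Hypothesis v_bounded : exists V, forall N i, (0 < N)%N -> `|v N i| <= V.

Lemma measurable_tail_event delta N i : (0 < N)%N -> measurable (@tail_event delta N i).
Proof.
move=> N0; apply: measurable_ge; apply: measurableT_comp => //.
apply: measurable_funB => //; apply: measurable_funM => //.
exact: (measurable_trace (mH i N0) (measurable_logclamp _ _)).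
Qed.

Lemma measurable_crowded_event delta N i : (0 < N)%N -> measurable (@crowded_event delta N i).
Proof.
move=> N0; apply: measurable_ge; apply: measurable_funM => //; apply: measurable_funM => //.
exact: (measurable_trace (mH i N0) (measurable_tent _)).
Qed.

Lemma measurable_det N i : (0 < N)%N -> measurable_fun setT (fun w => `|\det (H N i w)|).
Proof.
move=> N0; under eq_fun do rewrite (det_eigenvalues (H_sym _ _ N0)).
apply: measurable_prod => j _; apply: measurableT_comp => //; exact: mH.
Qed.

Lemma measurable_overflow N i : (0 < N)%N -> measurable_fun setT (@overflow N i).
Proof.
move=> N0; apply: measurable_prod => j _; apply: measurable_funD => //.
have mx : measurable_fun setT (fun w => `|tnth (eigenvalues (H N i w)) j|).
  by apply: measurableT_comp => //; exact: mH.
apply: measurable_funM => //.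
rewrite (_ : (fun w => _) = fun w => if hi_cut eps N < `|tnth (eigenvalues (H N i w)) j| then 1 else 0).
  by apply: measurable_fun_ifT => //; exact: measurable_fun_ltr.
by apply/funext => w; case: ifP.
Qed.

Lemma overflow_ge0 N i w : 0 <= @overflow N i w.
Proof. by apply: prodr_ge0 => j _; rewrite addr_ge0// mulr_ge0. Qed.

Lemma trace_close delta N i w : (0 < N)%N -> ~ @tail_event delta N i w ->
  `|trace_fun (logclamp (eta N) (hi_cut eps N)) (H N i w) - N%:R * v N i| <= N%:R * delta.
Proof.
move=> N0 /negP; rewrite -ltNge => /ltW; rewrite -(@ler_pM2l _ N%:R) ?ltr0n//.
by rewrite -[X in X * `|_|]ger0_norm// -normrM mulrBr mulVKf// pnatr_eq0 -lt0n.
Qed.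

(** [expectation_upper] with t = (C + 1) L, where L = N log N: the first error term is e^(-L), and
    the rate A = (C + 1)/q + 1 of the tail event makes the second a multiple of e^(-L) as well.
    Since the [v N i] are bounded, e^(-L) is below the main term [Z]. *)
Lemma det_product_upper (C q delta : R) : (0 < l)%N -> 0 < delta -> 0 < q ->
  (forall i b, 0 < b -> \forall N \near \oo,
     (\int[P N]_w (overflow i w ^+ l)%:E <= (expR (N%:R * b))%:E)%E) ->
  (forall i, \forall N \near \oo,
     (\int[P N]_w (`|\det (H N i w)| `^ (l%:R * (1 + q)))%:E <= (expR (C * (N%:R * ln N%:R)))%:E)%E) ->
  \forall N \near \oo, (\int[P N]_w (\prod_i `|\det (H N i w)|)%:E <=
     (expR (N%:R * (\sum_i v N i + delta)))%:E)%E.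
Proof.
move=> l0 delta0 q0 hlarge hmom; have [V hV] := v_bounded.
pose b := delta / l.+2%:R; have b0 : 0 < b by rewrite divr_gt0.
(* One [b] for the deviation of each matrix, one for the overflow products, one for the constant
   factor l (l + 2). *)
have bE : delta = l%:R * b + b + b.
  by rewrite /b -natr1 -natr1; field; rewrite !natr1 pnatr_eq0.
pose A := (C + 1) / q + 1.
near=> N.
have N1 : 1 <= N%:R :> R by near: N; exact: near_ge_nat.
have n0 : 0 < N%:R :> R by apply: lt_le_trans N1.
have N0 : (0 < N)%N by rewrite -(ltr_nat R).
have hl : expR (l%:R * V) <= N%:R by near: N; exact: near_ge_nat.
have hb : ln (l%:R * l.+2%:R) / b <= N%:R by near: N; exact: near_ge_nat.
have htail : forall i, pr (P N) (tail_event b i) <= expR (- (A * (N%:R * ln N%:R))).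
  by near: N; apply: filter_forall => i; exact: tail_small.
have hl' : forall i, (\int[P N]_w (overflow i w ^+ l)%:E <= (expR (N%:R * b))%:E)%E.
  by near: N; apply: filter_forall => i; exact: hlarge.
have hm' : forall i, (\int[P N]_w (`|\det (H N i w)| `^ (l%:R * (1 + q)))%:E <=
    (expR (C * (N%:R * ln N%:R)))%:E)%E.
  by near: N; apply: filter_forall => i; exact: hmom.
pose L := N%:R * ln N%:R : R.
pose a i := N%:R * (v N i + b).
pose E : set (Omega N) := \big[setU/set0]_i tail_event b i.
have mE : measurable E by apply: bigsetU_measurable => i _; exact: measurable_tail_event.
have hpb : pr (P N) E <= l%:R * expR (- (A * L)).
  apply: (le_trans (pr_bigU _ _ _)) => [i|]; first exact: measurable_tail_event.
  apply: (@le_trans _ _ (\sum_(i < l) expR (- (A * L)))); first exact: ler_sum.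
  by rewrite sumr_const card_ord mulr_natl.
have hgood i w : ~ E w -> `|\det (H N i w)| <= expR (a i) * overflow i w.
  move=> nE; have nt : ~ tail_event b i w.
    by move=> h; apply: nE; rewrite /E (bigD1 i)//; left.
  apply: (le_trans (det_upper (H_sym i w N0) (eta0 N0) (eta1 N0) (hi_cut_ge1 eps N))).
  apply: ler_wpM2r; first exact: overflow_ge0.
  have := trace_close N0 nt; rewrite ler_norml => /andP[_ h].
  by rewrite ler_expR /a mulrDr -lerBlDl.
have := expectation_upper ((C + 1) * L) l0 (fun i => measurable_det i N0)
  (fun i => measurable_overflow i N0) (fun i w => normr_ge0 _) (@overflow_ge0 N)
  mE hgood q0 hl' hm' hpb.
move=> /le_trans; apply; rewrite lee_fin.
have eL1 : expR (- ((C + 1) * L)) * expR (C * L) = expR (- L).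
  by rewrite -expRD; congr expR; ring.
have eL2 : expR ((C + 1) * L / q) * (l%:R * expR (- (A * L))) = l%:R * expR (- L).
  by rewrite mulrCA -expRD /A; congr (_ * expR _); field; rewrite gt_eqF.
rewrite eL1 eL2.
set S := \sum_i v N i.
have aE : \sum_i a i = N%:R * (S + l%:R * b).
  by rewrite /a -mulr_sumr big_split/= sumr_const card_ord -(mulr_natl b).
have SV : - (l%:R * V) <= S.
  rewrite lerNl -sumrN; apply: (@le_trans _ _ (\sum_(i < l) V)).
    by apply: ler_sum => i _; have := hV N i N0; rewrite ler_norml lerNl => /andP[].
  by rewrite sumr_const card_ord mulr_natl.
pose Z := expR (N%:R * (S + l%:R * b + b)).
have h1 : expR (\sum_i a i) * expR (N%:R * b) = Z.
  by rewrite aE -expRD -mulrDr.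
have h2 : expR (- L) <= Z.
  rewrite ler_expR /L -mulrN ler_pM2l//.
  have : l%:R * V <= ln N%:R by rewrite -ler_expR lnK.
  have : 0 <= l%:R * b by rewrite mulr_ge0// ltW.
  by lra.
have h3 : l%:R * l.+2%:R <= expR (N%:R * b).
  have p : 0 < l%:R * l.+2%:R :> R by rewrite mulr_gt0 ?ltr0n.
  by rewrite -[leLHS]lnK ?posrE// ler_expR -ler_pdivrMr.
have -> : expR (N%:R * (S + delta)) = expR (N%:R * b) * Z.
  by rewrite /Z -expRD bE; congr expR; ring.
apply: (@le_trans _ _ (l%:R * l.+2%:R * Z)); last by apply: ler_wpM2r => //; exact: expR_ge0.
rewrite mulrCA h1.
have -> : l%:R * (expR (- L) + l%:R * expR (- L)) = l%:R * (l%:R + 1) * expR (- L) by ring.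
have -> : l%:R * l.+2%:R * Z = l%:R * Z + l%:R * (l%:R + 1) * Z.
  by rewrite -natr1 -natr1; ring.
by rewrite lerD2l; apply: ler_wpM2l => //; rewrite mulr_ge0// addr_ge0.
Unshelve. all: by end_near. Qed.

(** On an event of probability at least 1/2, [det_lower] holds for all matrices at once, each losing
    [b] to the deviation and [b] to the small eigenvalues; one further [b] pays for the factor
    1/2. *)
Lemma det_product_lower (delta : R) : 0 < delta ->
  (forall i b q, 0 < b -> 0 < q -> \forall N \near \oo, pr (P N) (crowded_event b i) <= q) ->
  (forall i q, 0 < q -> \forall N \near \oo,
    pr (P N) (~` gap_event eps (fun N => H N i) (N:=N)) <= q) ->
  \forall N \near \oo, ((expR (N%:R * (\sum_i v N i - delta)))%:E <=
    \int[P N]_w (\prod_i `|\det (H N i w)|)%:E)%E.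
Proof.
move=> delta0 hcrowd hgap.
pose b := delta / (2 * l%:R + 1).
have b0 : 0 < b by rewrite divr_gt0// ltr_wpDl// mulr_ge0.
have bE : delta = l%:R * (2 * b) + b.
  rewrite /b; field; rewrite gt_eqF// ltr_wpDl// mulr_ge0//.
(* Three bad events for each of the [l] matrices have total probability at most 3 l q <= 1/2; the
   successor keeps [q] defined for l = 0. *)
pose q := (6 * l.+1%:R)^-1 : R.
have q0 : 0 < q by rewrite invr_gt0 mulr_gt0.
near=> N.
have N1 : 1 <= N%:R :> R by near: N; exact: near_ge_nat.
have n0 : 0 < N%:R :> R by apply: lt_le_trans N1.
have N0 : (0 < N)%N by rewrite -(ltr_nat R).
have hb : ln 2 / b <= N%:R by near: N; exact: near_ge_nat.
have hlq : - ln q <= N%:R by near: N; exact: near_ge_nat.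
have l1 : 1 <= ln N%:R :> R.
  by rewrite -ler_expR lnK ?posrE//; near: N; exact: near_ge_nat.
have htail : forall i, pr (P N) (tail_event b i) <= expR (- (1 * (N%:R * ln N%:R))).
  by near: N; apply: filter_forall => i; exact: tail_small.
have htail' i : pr (P N) (tail_event b i) <= q.
  apply: (le_trans (htail i)); rewrite -[leRHS]lnK ?posrE// ler_expR mul1r lerNl.
  by apply: (le_trans hlq); rewrite ler_peMr// ltW.
have hcr : forall i, pr (P N) (crowded_event b i) <= q.
  by near: N; apply: filter_forall => i; exact: hcrowd.
have hg : forall i, pr (P N) (~` gap_event eps (fun N => H N i) (N:=N)) <= q.
  by near: N; apply: filter_forall => i; exact: hgap.
pose B i : set (Omega N) := tail_event b i `|` crowded_event b i `|`
  ~` gap_event eps (fun N => H N i) (N:=N).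
have mg i : measurable (gap_event eps (fun N => H N i) (N:=N)).
  exact: (measurable_gap_event eps (fun N => @mH N i)).
have mt i : measurable (@tail_event b N i) by exact: measurable_tail_event.
have mc i : measurable (@crowded_event b N i) by exact: measurable_crowded_event.
have mB i : measurable (B i).
  by apply: measurableU; [exact: measurableU|exact: measurableC].
have pB i : pr (P N) (B i) <= 3 * q.
  apply: (le_trans (pr_setU _ _ _)); [exact: measurableU|exact: measurableC|].
  have := pr_setU (P N) (mt i) (mc i).
  by have := htail' i; have := hcr i; have := hg i; lra.
pose E : set (Omega N) := ~` \big[setU/set0]_i B i.
have mE' : measurable (\big[setU/set0]_i B i) by apply: bigsetU_measurable => i _.
have pE : 1 / 2 <= pr (P N) E.
  rewrite (pr_setC (P N) mE').
  have h1 : pr (P N) (\big[setU/set0]_i B i) <= l%:R * (3 * q).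
    apply: (le_trans (pr_bigU _ _ mB)).
    apply: (@le_trans _ _ (\sum_(i < l) (3 * q))); first exact: ler_sum.
    by rewrite sumr_const card_ord (mulr_natl (3 * q)).
  have h2 : l%:R * (3 * q) <= 1 / 2.
    apply: (@le_trans _ _ (l.+1%:R * (3 * q))).
      by apply: ler_wpM2r; [rewrite mulr_ge0// ltW|rewrite ler_nat].
    rewrite /q; move: (ltr0Sn R l); move: (l.+1%:R) => x x0.
    by rewrite le_eqVlt; apply/orP; left; apply/eqP; field; rewrite gt_eqF.
  by lra.
have Elow w : E w -> expR (\sum_i N%:R * (v N i - 2 * b)) <= \prod_i `|\det (H N i w)|.
  move=> wE; rewrite expR_sum; apply: ler_prod => i _; rewrite expR_ge0/=.
  have nB : ~ B i w by move=> h; apply: wE; rewrite (bigD1 i)//; left.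
  have nt : ~ tail_event b i w by move=> h; apply: nB; left; left.
  have nc : ~ crowded_event b i w by move=> h; apply: nB; left; right.
  have gp : gap_event eps (fun N => H N i) (N:=N) w by apply: contrapT => h; apply: nB; right.
  have := det_lower (H_sym i w N0) (eta0 N0) (eta1 N0) (hi_cut_ge1 eps N) (powR_ge0 N%:R eps)
    (fun j => ltW (gp j)).
  apply: le_trans; rewrite ler_expR.
  have := trace_close N0 nt; rewrite ler_norml => /andP[h _].
  move/negP: nc; rewrite -ltNge => /ltW; rewrite -(ler_pM2l n0) mulrCA mulVKf ?gt_eqF// => h'.
  by lra.
have mD : measurable_fun setT (fun w => \prod_i `|\det (H N i w)|).
  by apply: measurable_prod => i _; exact: measurable_det.
have := expectation_lower mD (fun w => prodr_ge0 _ (fun i _ => normr_ge0 _)) (measurableC mE')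
  (expR_ge0 _) Elow pE.
apply: le_trans; rewrite lee_fin.
have -> : \sum_i N%:R * (v N i - 2 * b) = N%:R * (\sum_i v N i - l%:R * (2 * b)).
  by rewrite -mulr_sumr sumrB sumr_const card_ord -(mulr_natl (2 * b)).
have h2 : 2 <= expR (N%:R * b) by rewrite -[leLHS]lnK ?posrE// ler_expR -ler_pdivrMr.
rewrite mul1r ler_pdivlMr//.
apply: (@le_trans _ _ (expR (N%:R * (\sum_i v N i - delta)) * expR (N%:R * b))).
  by apply: ler_wpM2l => //; exact: expR_ge0.
by rewrite -expRD ler_expR bE; lra.
Unshelve. all: by end_near. Qed.

End DeterminantProduct.

(** * Passage to the limit for the normalised logarithm *)

Lemma cvge0P (R : realType) (u : nat -> \bar R) :
  (forall delta : R, 0 < delta -> \forall N \near \oo, (- delta%:E <= u N <= delta%:E)%E) ->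
  u N @[N --> \oo] --> 0%E.
Proof.
move=> hu; apply/fine_cvgP; split.
  near=> N; have /andP[h1 h2] : (- 1%:E <= u N <= 1%:E)%E by near: N; exact: hu.
  by apply/fin_real/andP; split; [apply: lt_le_trans h1|apply: le_lt_trans h2 _];
    rewrite ?ltry// -EFinN ltNyr.
apply/cvgrPdist_le => e e0; near=> N.
have : (- e%:E <= u N <= e%:E)%E by near: N; exact: hu.
rewrite sub0r normrN /=; case: (u N) => [r| |] /=; rewrite ?normr0 ?(ltW e0)//.
by rewrite !lee_fin -ler_norml.
Unshelve. all: by end_near. Qed.

Lemma cvge0_le (R : realType) (u : nat -> \bar R) (delta : R) : u N @[N --> \oo] --> 0%E ->
  0 < delta -> \forall N \near \oo, (u N <= delta%:E)%E.
Proof.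
move=> /fine_cvgP[ufin /cvgrPdist_le hu] delta0; near=> N.
have h : `|0 - fine (u N)| <= delta by near: N; exact: hu.
have fu : u N \is a fin_num by near: N.
rewrite -(fineK fu) lee_fin (le_trans (ler_norm _))//.
by rewrite sub0r normrN in h.
Unshelve. all: by end_near. Qed.

(** Gives one exponent [q] admissible in the moment condition of every matrix; the witness makes
    sense for empty [I] too. *)
Lemma positive_lower_bound (R : realType) (I : finType) (f : I -> R) :
  (forall i, 0 < f i) -> exists2 q, 0 < q & forall i, q < f i.
Proof.
move=> f0; have s0 : 0 <= \sum_i (f i)^-1 by apply: sumr_ge0 => i _; rewrite invr_ge0 ltW.
exists (\sum_i (f i)^-1 + 1)^-1 => [|i]; first by rewrite invr_gt0 ltr_wpDl.
have s1 : 0 < \sum_i (f i)^-1 + 1 by rewrite ltr_wpDl.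
rewrite -[ltRHS]invrK ltf_pV2 ?posrE ?invr_gt0//.
rewrite (bigD1 i)//= -addrA ltrDl ltr_wpDl// sumr_ge0// => j _.
by rewrite invr_ge0 ltW.
Qed.

Theorem theoremA1 (R : realType) (l : nat) (kappa : R) (kappa_gt0 : 0 < kappa)
  (d : nat -> measure_display) (Omega : forall N : nat, measurableType (d N))
  (P : forall N : nat, probability (Omega N) R)
  (M : nat -> nat) (M_gt0 : forall N, (0 < N)%N -> (0 < M N)%N)
  (X : forall N : nat, 'I_l -> 'I_(M N) -> {RV (P N) >-> R})
  (Phi : forall N : nat, 'I_l -> 'rV[R]_(M N) -> 'M[R]_N)
  (Phi_sym : forall N i x, (0 < N)%N -> (Phi N i x)^T = Phi N i x)
  (mu : nat -> 'I_l -> probability R R)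
  (vecX : forall N : nat, 'I_l -> Omega N -> 'rV[R]_(M N))
  (vecXE : forall N i w, vecX N i w = \row_k X N i k w)
  (H : forall N : nat, 'I_l -> Omega N -> 'M[R]_N)
  (HE : forall N i w, H N i w = Phi N i (vecX N i w))
  (* (I) *)
  (hI : forall N i, (0 < N)%N ->
    independent_RVs (P N) (fun k w => X N i k w))
  (* (M) *)
  (hM_lip : forall N i, (0 < N)%N -> (lip_norm2 (Phi N i) < +oo)%E)
  (hM_conv : forall N i, (0 < N)%N ->
    forall A : set 'M[R]_N, (forall T, A T -> T^T = T) ->
      @convex_set R 'M[R]_N A ->
      @convex_set R 'rV[R]_(M N) (Phi N i @^-1` A))
  (* (E) *)
  (hE_dBL : forall N i, (0 < N)%N ->
    (dBL (mean_measure (P N) (fun w => empirical_measure (H N i w))) (mu N i)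
      <= (N%:R `^ (- kappa))%:E)%E)
  (hE_supp : forall i, exists K : set R, compact K /\
    forall N, (0 < N)%N -> mu N i (~` K) = 0%E)
  (hE_density : forall N i, (0 < N)%N -> exists f : R -> R,
    has_density_on `]- kappa, kappa[ (mu N i) f /\
    (* at x = 0 the bound reads f 0 < +oo *)
    forall x : R, x != 0 -> `|x| < kappa ->
      f x < kappa^-1 * `|x| `^ (- 1 + kappa))
  (* (C^l) *)
  (hC_gap : forall i (eps : R), 0 < eps ->
    P N [set w | forall x, eigenvalue (H N i w) x ->
           ~ (- expR (- (N%:R `^ eps)) <= x <= expR (- (N%:R `^ eps)))]
      @[N --> \oo] --> 1%E)
  (hC_large : forall i (eps : R), 0 < eps ->
    ((N%:R^-1)%:E *
      lne ('E_(P N)[(fun w => \prod_(j < N)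
        (1 + `|tnth (eigenvalues (H N i w)) j|
             * (expR (N%:R `^ eps)
                  < `|tnth (eigenvalues (H N i w)) j|)%R%:R) ^+ l)%R]))%E
      @[N --> \oo] --> 0%E)
  (hC_moment : forall i, exists2 delta0 : R, 0 < delta0 &
    forall delta : R, 0 < delta -> delta < delta0 ->
    (limn_esup (fun N : nat => ((N%:R * ln N%:R)^-1)%:E *
       lne ('E_(P N)[(fun w => `|\det (H N i w)| `^ (l%:R * (1 + delta)))%R]))
      < +oo)%E)
  (* (S) *)
  (hS : forall i,
    (((N%:R * ln N%:R)^-1)%:E *
      lne (P N [set w |
        ((N%:R `^ (- kappa))%:E <
         dKS (empirical_measure (Phi N i (vecX N i w)))
             (empirical_measure (Phi N i
               (cut_vector ((N%:R `^ (- kappa))%:E / lip_norm2 (Phi N i))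
                  (vecX N i w)))))%E]))%E
      @[N --> \oo] --> -oo%E) :
  ((N%:R^-1)%:E * lne ('E_(P N)[(fun w => \prod_(i < l) `|\det (H N i w)|)%R])
    - \sum_(i < l) \int[mu N i]_x lne (`|x|%R)%:E)%E
    @[N --> \oo] --> 0%E.
Proof.
have VE : vecX = fun N i w => \row_k X N i k w.
  apply: functional_extensionality_dep => N; apply/funext => i; apply/funext => w; exact: vecXE.
have HF : H = fun N i w => Phi N i (\row_k X N i k w).
  apply: functional_extensionality_dep => N; apply/funext => i; apply/funext => w.
  by rewrite HE VE.
clear vecXE HE; subst vecX H.
have mX i N (k : 'I_(M N)) : measurable_fun setT (X N i k : Omega N -> R).
  exact: measurable_funPT.
have hS' i : (((N%:R * ln N%:R)^-1)%:E *
    lne (P N [set w |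
      ((N%:R `^ (- kappa))%:E <
       dKS (empirical_measure (Phi N i (\row_k X N i k w)))
           (empirical_measure (Phi N i
             (\row_k cut1 ((N%:R `^ (- kappa))%:E / lip_norm2 (Phi N i)) (X N i k w)))))%E]))%E
    @[N --> \oo] --> -oo%E.
  (* The truncated vector occurs under binders, so the hypothesis is transported along an equality
     of dependent functions. *)
  pose cvgY (Y : forall N, Omega N -> 'rV[R]_(M N)) :=
    (((N%:R * ln N%:R)^-1)%:E * lne (P N [set w | ((N%:R `^ (- kappa))%:E <
       dKS (empirical_measure (Phi N i (\row_k X N i k w)))
           (empirical_measure (Phi N i (Y N w))))%E]))%E @[N --> \oo] --> -oo%E.
  have YE : (fun N w => cut_vector ((N%:R `^ (- kappa))%:E / lip_norm2 (Phi N i))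
      (\row_k X N i k w)) = 
      (fun N w => \row_k cut1 ((N%:R `^ (- kappa))%:E / lip_norm2 (Phi N i)) (X N i k w)).
    apply: functional_extensionality_dep => N; apply/funext => w.
    exact: (cut_vectorE _ (fun k => X N i k) w).
  exact: (eq_ind _ cvgY (hS i) _ YE).
pose H i N w := Phi N i (\row_k X N i k w).
(* Small enough for [eps < 1], [eps < kappa / 2] and [eps < kappa ^+ 2 / 2], the margins used in the
   tail and counting estimates. *)
pose eps : R := Num.min kappa (Num.min (kappa ^+ 2) 1) / 4.
have m0 : 0 < Num.min kappa (Num.min (kappa ^+ 2) 1).
  by rewrite !lt_min kappa_gt0 exprn_gt0/=.
have [m1 m2 m3] : [/\ Num.min kappa (Num.min (kappa ^+ 2) 1) <= kappa,
    Num.min kappa (Num.min (kappa ^+ 2) 1) <= kappa ^+ 2 &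
    Num.min kappa (Num.min (kappa ^+ 2) 1) <= 1].
  by rewrite !ge_min !lexx !orbT.
have k20 : 0 < kappa ^+ 2 by rewrite exprn_gt0.
have eps0 : 0 < eps by rewrite divr_gt0.
have [eps1 eps2 eps3] : [/\ eps < 1, eps < kappa / 2 & eps < kappa ^+ 2 / 2].
  by rewrite /eps; move: m0 m1 m2 m3; move: (Num.min _ _) => m; move: (kappa ^+ 2) k20 => k2 *; split; lra.
pose v N i := limit_potential (fun N => mu N i) N.
have mH N i : (0 < N)%N -> forall j, measurable_fun setT (fun w => tnth (eigenvalues (H i N w)) j).
  move=> N0; apply: (measurable_H_eigenvalue M_gt0 (mX i) (fun N x => @Phi_sym N i x)) => //.
  by move=> n; exact: hM_lip.
have [vB hvB] : exists V, forall N i, (0 < N)%N -> `|v N i| <= V.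
  have /choice[V hV] : forall i, exists V : R, forall N, (0 < N)%N -> `|v N i| <= V.
    move=> i; exact: (limit_potential_bounded kappa_gt0 (hE_supp i) (fun N => @hE_density N i)).
  exists (\sum_i `|V i|) => N i N0; apply: (le_trans (hV i N N0)).
  by rewrite (bigD1 i)//= (le_trans (ler_norm _))// lerDl sumr_ge0.
have hv i delta : 0 < delta -> \forall N \near \oo,
    (\int[mu N i]_x lne (`|x|)%:E = (v N i)%:E)%E /\
    `|log_pot kappa (fun N => mu N i) eps N - v N i| <= delta.
  exact: (limit_potential_asymptotic kappa_gt0 (hE_supp i) (fun N => @hE_density N i) eps0).
have htail i (A delta : R) : 0 < delta -> \forall N \near \oo,
    pr (P N) (tail_event eps (fun N i => H i N) (lo_cut kappa) v delta i) <=
    expR (- (A * (N%:R * ln N%:R))).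
  (* Half of [delta] for the concentration around the clamped potential, half for removing the
     clamp. *)
  move=> delta0; have delta2 : 0 < delta / 2 by rewrite divr_gt0.
  near=> N.
  have N1 : 1 <= N%:R :> R by near: N; exact: near_ge_nat.
  have N0 : (0 < N)%N by rewrite -(ltr_nat R); apply: lt_le_trans N1.
  have [_ h1] : (\int[mu N i]_x lne (`|x|)%:E = (v N i)%:E)%E /\
    `|log_pot kappa (fun N => mu N i) eps N - v N i| <= delta / 2.
    by near: N; exact: hv.
  have : pr (P N) [set w | delta / 2 <= `|log_stat kappa (fun N => X N i) (fun N => Phi N i) eps w -
      log_pot kappa (fun N => mu N i) eps N|] <= expR (- (A * (N%:R * ln N%:R))).
    near: N; exact: (tail_asymptotic kappa_gt0 M_gt0 (mX i) (fun N x => @Phi_sym N i x)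
      (fun N => @hI N i) (fun N => @hM_lip N i) (fun N => @hM_conv N i) (fun N => @hE_dBL N i)
      (hS' i) eps0 eps1 eps2 A delta2).
  apply: le_trans; apply: pr_le.
  - by apply: measurable_tail_event => // n j; exact: mH.
  - apply: measurable_ge; apply: measurableT_comp => //.
    apply: measurable_funB => //; apply: measurable_funM => //.
    exact: (measurable_trace (mH N i N0) (measurable_logclamp _ _)).
  - move=> w; rewrite /tail_event /= => h.
    have := ler_distD (log_pot kappa (fun N => mu N i) eps N)
       (log_stat kappa (fun N => X N i) (fun N => Phi N i) eps w) (v N i).
    rewrite /log_stat in h *; move: h h1; lra.
have hlarge i (b : R) : 0 < b -> \forall N \near \oo,
    (\int[P N]_w (overflow eps (fun N i => H i N) i w ^+ l)%:E <= (expR (N%:R * b))%:E)%E.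
  move=> b0; near=> N.
  have N1 : 1 <= N%:R :> R by near: N; exact: near_ge_nat.
  apply: lne_le_expR; first exact: lt_le_trans N1.
  under eq_integral do rewrite /overflow -prodrXl.
  near: N; have := cvge0_le (hC_large i eps eps0) b0.
  by rewrite expectation.unlock.
have hmom : exists C q : R, 0 < q /\ forall i, \forall N \near \oo,
    (\int[P N]_w (`|\det (H i N w)| `^ (l%:R * (1 + q)))%:E <=
      (expR (C * (N%:R * ln N%:R)))%:E)%E.
  have /choice[q0 hq0] : forall i, exists q0 : R, 0 < q0 /\ forall q, 0 < q -> q < q0 ->
      exists C : R, \forall N \near \oo, (((N%:R * ln N%:R)^-1)%:E *
       lne (\int[P N]_w (`|\det (H i N w)| `^ (l%:R * (1 + q)))%:E) <= C%:E)%E.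
    move=> i; have [q0 q00 hq0] := hC_moment i; exists q0; split => // q q1 q2.
    have := limn_esup_lty (hq0 q q1 q2).
    by rewrite expectation.unlock.
  have [q q1 q2] := positive_lower_bound (fun i => (hq0 i).1).
  have /choice[C hC] := fun i => (hq0 i).2 q q1 (q2 i).
  exists (\sum_i `|C i|), q; split => // i; near=> N.
  have N1 : 2 <= N%:R :> R by near: N; exact: near_ge_nat.
  have c0 : 0 < N%:R * ln N%:R :> R by rewrite mulr_gt0 ?ln_gt0//; lra.
  apply: (@le_trans _ _ (expR (N%:R * ln N%:R * C i))%:E).
    apply: (lne_le_expR c0); near: N; exact: hC.
  rewrite lee_fin ler_expR mulrC; apply: ler_wpM2r; first exact: ltW.
  by rewrite (bigD1 i)//= (le_trans (ler_norm _))// lerDl sumr_ge0.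
have [C [q [q0 hC]]] := hmom.
have Hs N i w : (0 < N)%N -> (H i N w)^T = H i N w by exact: Phi_sym.
have e0 N : (0 < N)%N -> 0 < lo_cut kappa N by exact: lo_cut_gt0.
have e1 N : (0 < N)%N -> lo_cut kappa N <= 1 by exact: lo_cut_le1.
have hupper delta : 0 < delta -> \forall N \near \oo,
    (\int[P N]_w (\prod_i `|\det (H i N w)|)%:E <=
     (expR (N%:R * (\sum_i v N i + delta)))%:E)%E.
  (* For l = 0 the product is empty and has no largest factor, so the bound is read off directly
     from the integral of 1. *)
  move=> delta0; have [l0|l0] := posnP l.
    apply: nearW => N; rewrite (eq_integral (cst 1%:E)); last first.
      by move=> w _; rewrite big1// => -[i il]; exfalso; rewrite l0 in il.
    rewrite integral_cst// mul1e; apply: (@le_trans _ _ 1%:E); first exact: probability_le1.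
    rewrite lee_fin big1 ?add0r.
      by rewrite -expR0 ler_expR mulr_ge0// ltW.
    by move=> -[i il]; exfalso; rewrite l0 in il.
  exact: (det_product_upper Hs mH e0 e1 htail (ex_intro _ vB hvB) l0 delta0 q0 hlarge hC).
have hlower delta : 0 < delta -> \forall N \near \oo,
    ((expR (N%:R * (\sum_i v N i - delta)))%:E <=
     \int[P N]_w (\prod_i `|\det (H i N w)|)%:E)%E.
  move=> delta0; apply: (det_product_lower Hs mH e0 e1 htail delta0) => [i b p b0 p0|i p p0].
    exact: (count_asymptotic kappa_gt0 (fun N => @hE_density N i) (fun N => @mH N i)
      (fun N => @hE_dBL N i) eps2 eps3 b0 p0).
  exact: (gap_asymptotic (fun N w => @Hs N i w) (fun N => @mH N i) (hC_gap i eps eps0) p0).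
rewrite expectation.unlock; apply: cvge0P => delta delta0; near=> N.
have N1 : 1 <= N%:R :> R by near: N; exact: near_ge_nat.
have n0 : 0 < N%:R :> R by apply: lt_le_trans N1.
have hvN : forall i, (\int[mu N i]_x lne (`|x|)%:E = (v N i)%:E)%E /\
    `|log_pot kappa (fun N => mu N i) eps N - v N i| <= 1.
  by near: N; apply: filter_forall => i; exact: hv.
rewrite (eq_bigr (fun i => (v N i)%:E)) => [|i _]; last by have [] := hvN i.
rewrite sumEFin; apply/andP; split.
  rewrite leeBrDr// -EFinN -EFinD addrC; apply: (lne_ge_of_expR n0).
  by near: N; exact: hlower.
rewrite leeBlDr// -EFinD addrC; apply: (lne_le_of_expR n0).
by near: N; exact: hupper.
Unshelve. all: by end_near. Qed.
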